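(* Let $p,m\ge1$, $\sigma>0$ and $\Sigma\in\mathbb{R}^{p\times p}$ a covariance matrix. For $B\in\mathbb{R}^{p\times m}$ let $P_B$ be the law of $(X,Y)\in\mathbb{R}^p\times\mathbb{R}^m$ with $X\sim N(0,\Sigma)$ and $Y\mid X\sim N(B^TX,\sigma^2I_m)$. For $\epsilon\in[0,1)$ and arbitrary $Q$, let $(X_1,Y_1),\dots,(X_n,Y_n)$ be i.i.d. from $\mathbb{P}_{(\epsilon,B,Q)}=(1-\epsilon)P_B+\epsilon Q$. For $\mathcal{U}\subset\mathbb{R}^{p\times m}\setminus\{0\}$ and a distribution $\mathbb{P}$ of $(X,Y)$ define the multivariate regression depth $\mathcal{D}_{\mathcal{U}}(B,\mathbb{P})=\inf_{U\in\mathcal{U}}\mathbb{P}\{\langle U^TX,Y-B^TX\rangle\ge0\}$, and let $\widehat B$ be any maximizer over $B\in\mathbb{R}^{p\times m}$ of $\mathcal{D}_{\mathbb{R}^{p\times m}\setminus\{0\}}(B,\mathbb{P}_n)$, $\mathbb{P}_n$ the empirical measure. Let $\kappa=\inf_{v\ne0}\|\Sigma^{1/2}v\|/\|v\|$. Then there exist absolute constants $c_0,C,C'>0$ such that whenever $\epsilon^2+\frac{pm}{n}\le c_0$, $$\mathrm{Tr}\big((\widehat B-B)^T\Sigma(\widehat B-B)\big)\le C\sigma^2\Big(\frac{pm}{n}\vee\epsilon^2\Big),\qquad \|\widehat B-B\|_{\rm F}^2\le C\frac{\sigma^2}{\kappa^2}\Big(\frac{pm}{n}\vee\epsilon^2\Big),$$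 with $\mathbb{P}_{(\epsilon,B,Q)}$-probability at least $1-\exp(-C'(pm+n\epsilon^2))$, uniformly over all $Q$ and $B\in\mathbb{R}^{p\times m}$.
   Context: $\langle\cdot,\cdot\rangle$ is the Euclidean inner product on $\mathbb{R}^m$; $\|\cdot\|_{\rm F}$ the Frobenius norm; $a\vee b=\max(a,b)$. *)

(* Defs.v *)
From HB Require Import structures.
From mathcomp Require Import all_boot all_order all_algebra.
From mathcomp Require Import all_classical all_reals all_analysis.
Set Implicit Arguments. Unset Strict Implicit. Unset Printing Implicit Defensive.
Import Order.TTheory GRing.Theory Num.Theory.
Local Open Scope classical_set_scope.
Local Open Scope ring_scope.

Section defs.
Variable R : realType.

(* a point of R^d, represented as a d-tuple (measurable for the product
   sigma-algebra), viewed as a column vector *)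
Definition tcol d (x : d.-tuple R) : 'cV[R]_d := \col_i tnth x i.

Definition Obs (p m : nat) := (p.-tuple R * m.-tuple R)%type.

Definition gauss1 (mu s2 : R) : set R -> \bar R :=
  if s2 == 0 then (fun A => \d_mu A) else normal_prob mu (Num.sqrt s2).

(* multivariate normal law N(mean, S) on R^d (Cramer-Wold definition:
   every linear functional v^T x is univariate N(v^T mean, v^T S v)) *)
Definition gauss_law d (mean : 'cV[R]_d) (S : 'M[R]_d)
    (mu : set (d.-tuple R) -> \bar R) : Prop :=
  forall (v : 'cV[R]_d) (A : set R), measurable A ->
    mu [set x | A ((v^T *m tcol x) 0 0)] =
    gauss1 ((v^T *m mean) 0 0) ((v^T *m S *m v) 0 0) A.

Definition covariance_matrix p (S : 'M[R]_p) : Prop :=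
  S^T = S /\ forall v : 'cV[R]_p, 0 <= (v^T *m S *m v) 0 0.

Definition resid p m (B : 'M[R]_(p, m)) (z : Obs p m) : m.-tuple R :=
  [tuple (tcol z.2 - B^T *m tcol z.1) k 0 | k < m].

(* P_B : X ~ N(0, S) and Y | X ~ N(B^T X, s^2 I_m), i.e. the noise Y - B^T X
   is N(0, s^2 I_m) and independent of X *)
Definition is_PB p m (S : 'M[R]_p) (B : 'M[R]_(p, m)) (s : R)
    (PB : probability (Obs p m) R) : Prop :=
  [/\ gauss_law 0 S (fun A => PB [set z | A z.1]),
      gauss_law 0 (s ^+ 2)%:M (fun C => PB [set z | C (resid B z)]) &
      forall (A : set (p.-tuple R)) (C : set (m.-tuple R)),
        measurable A -> measurable C ->
        PB [set z | A z.1 /\ C (resid B z)] =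
        (PB [set z | A z.1] * PB [set z | C (resid B z)])%E].

Definition score p m (U B : 'M[R]_(p, m)) (z : Obs p m) : R :=
  \sum_(k < m) (U^T *m tcol z.1) k 0 * (tcol z.2 - B^T *m tcol z.1) k 0.

Definition emp_depth p m n (B : 'M[R]_(p, m)) (z : 'I_n -> Obs p m) : R :=
  inf [set r : R | exists U : 'M[R]_(p, m), U != 0 /\
        r = (\sum_(i < n) (if 0 <= score U B (z i) then 1 else 0)) / n%:R].

Definition frob2 p m (A : 'M[R]_(p, m)) : R := \sum_i \sum_j A i j ^+ 2.

(* kappa = inf_{v <> 0} ||S^{1/2} v|| / ||v||, with ||S^{1/2} v||^2 = v^T S v *)
Definition kappa p (S : 'M[R]_p) : R :=
  inf [set r : R | exists v : 'cV[R]_p, v != 0 /\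
        r = Num.sqrt ((v^T *m S *m v) 0 0) / Num.sqrt ((v^T *m v) 0 0)].

End defs.

(* Main.v *)
Require Import Defs.
From HB Require Import structures.
From mathcomp Require Import all_boot all_order all_algebra.
From mathcomp Require Import all_classical all_reals all_analysis.
From mathcomp Require Import measurable_realfun ring lra.
Import Order.TTheory GRing.Theory Num.Theory.
Import HBNNSimple.
Local Open Scope classical_set_scope.
Local Open Scope ring_scope.

(** For a direction [V] with [tr (V^T Sigma V) = 1] let [bl V] be the score of
    [V] at the true matrix, divided by [sigma], and let [rho ^ 2] be the maximum
    of [p m / n] and [eps ^ 2].  Each halfspace [{bl V > 0}] has probability 1/2
    under [P_B]; if all the empirical frequencies are within [O(rho)] of 1/2, the
    empirical depth of [B] is at least [1/2 - O(rho)].  If [Bh - B] is longer than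
    [tau sigma], then in its own direction the score of [Bh] is nonnegative only
    where [bl V >= tau |V^T X|^2]; the excluded window
    [0 <= bl V < tau |V^T X|^2] has mass of order [tau], so for [tau] a large
    multiple of [rho] the depth of [Bh] is smaller than that of [B].

    The uniform deviation bound uses no VC theory: it is a chaining argument over
    finite nets of the unit sphere with Bernstein bounds on the increments, where
    the passage from the finest net to the sphere is paid for by a uniform bound
    on the empirical mean of [|bl V| + |V^T X|].

    The contamination [Q] is arbitrary, so every observation is weighted by the
    conditional probability [h] that it comes from [P_B].  Exponential moments of
    weighted sums are controlled under [P_B] alone, and the weight lost in total
    is [O(n rho)]. *)

(** * Exponential inequalities for independent samples *)

(** The scales of the chain fit the signs of [bl], not [bl] itself. With [q = 4 ^- k], directions at
    distance of order [q ^ 6] have half-spaces that differ with probability O(q): [|bl| <= q ^ 3]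
    has probability at most [3 q], and a change of [bl] beyond [q ^ 3] has probability O(q ^ 3). A
    tilt [rho 2 ^ k] then has log-moment O(rho ^ 2) at every level, and the deviations, of order
    [n rho (k + 1) / 2 ^ k], are summable, without the logarithm that a single fine net would cost.
    The chain stops at a scale of order [rho ^ 4], where the tilt is still small and a change of
    [bl] beyond [rho ^ 3] affects only O(n rho) of the weight.

    Three obstacles shape the rest. [Omega] carries no labels of clean observations, so the weight
    is a function of the observation, which keeps the weighted terms i.i.d. Suprema over matrices
    need not be measurable, so every event is defined through finite nets. [Sigma] may be singular,
    so the weights vanish outside its range, where the seminorm of [V] does not control the
    score. *)

Lemma ge0_integral_comp_weight (R : realType) (d d' : measure_display)
    (Omega : measurableType d) (T : measurableType d')
    (P : {measure set Omega -> \bar R}) (mu : {measure set T -> \bar R})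
    (phi : Omega -> T) (G : Omega -> R) (c : R) (f : T -> R) :
  measurable_fun setT phi -> measurable_fun setT G -> (forall w, 0 <= G w) ->
  0 <= c ->
  (forall A, measurable A ->
     (\int[P]_(w in phi @^-1` A) (G w)%:E = c%:E * mu A)%E) ->
  measurable_fun setT f -> (forall x, 0 <= f x) ->
  (\int[P]_w (f (phi w) * G w)%:E = c%:E * \int[mu]_x (f x)%:E)%E.
Proof.
move=> mphi mG G0 c0 H mf f0.
have mEf : measurable_fun setT (EFin \o f) by exact/measurable_EFinP.
have f0' : forall x, setT x -> (0 <= (EFin \o f) x)%E.
  by move=> x _; rewrite lee_fin.
(* Both sides are monotone limits along simple functions, where linearity reduces the identity to
   level sets. *)
pose h := nnsfun_approx measurableT mEf.
have cvgh x : (EFin \o h n) x @[n --> \oo] --> (f x)%:E.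
  exact: (cvg_nnsfun_approx measurableT mEf f0').
have mh n : measurable_fun setT (EFin \o h n).
  by apply/measurable_EFinP; exact/measurable_funP.
have mhphi n : measurable_fun setT (fun w => h n (phi w)).
  by apply: (measurableT_comp _ mphi); exact/measurable_funP.
have hnd x a b : (a <= b)%N -> h a x <= h b x.
  by move=> ab; exact/lefP/nd_nnsfun_approx.
have -> : (\int[mu]_x (f x)%:E = lim (\int[mu]_x (EFin \o h n) x @[n --> \oo]))%E.
  have fE x : (f x)%:E = lim ((EFin \o h n) x @[n --> \oo]).
    by apply/esym/cvg_lim => //.
  under eq_integral do rewrite fE.
  apply: monotone_convergence => //.
  - by move=> n x _ /=; rewrite lee_fin.
  - by move=> x _ a b ab; rewrite lee_fin hnd.
have -> : (\int[P]_w (f (phi w) * G w)%:E =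
    lim (\int[P]_w ((h n (phi w) * G w)%:E) @[n --> \oo]))%E.
  have fE w : ((f (phi w) * G w)%:E = lim ((h n (phi w) * G w)%:E @[n --> \oo]))%E.
    apply/esym/cvg_lim => //.
    under eq_fun do rewrite EFinM.
    by rewrite EFinM; apply: cvgeZr => //; exact: cvgh.
  under eq_integral do rewrite fE.
  apply: monotone_convergence => //.
  - by move=> n; apply/measurable_EFinP; exact: measurable_funM.
  - by move=> n w _; rewrite lee_fin mulr_ge0.
  - by move=> w _ a b ab; rewrite lee_fin ler_wpM2r// hnd.
rewrite -limeMl//; last first.
  apply: ereal_nondecreasing_is_cvgn => a b ab.
  apply: ge0_le_integral => //.
  - by move=> x _ /=; rewrite lee_fin.
  - by move=> x _ /=; rewrite lee_fin; exact: hnd.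
congr (lim _); congr (_ @ \oo); apply/funext => n.
transitivity (\int[P]_w (\sum_(y \in range (h n))
    ((y * \1_(h n @^-1` [set y]) (phi w)) * G w)%:E))%E.
  apply: eq_integral => w _; rewrite fsumEFin//; congr (_%:E).
  by rewrite -mulr_fsuml [in LHS](fimfunE (h n)).
have mind y : measurable_fun setT (fun w => \1_(h n @^-1` [set y]) (phi w) : R).
  by apply: measurableT_comp mphi; exact: measurable_indic.
have ind_ge0 y x : 0 <= y * \1_(h n @^-1` [set y]) x :> R.
  by have := nnfun_muleindic_ge0 (h n) y x; rewrite lee_fin.
rewrite ge0_integral_fsum//; last 2 first.
- move=> y; apply/measurable_EFinP; apply: measurable_funM => //.
  by apply: measurable_funM => //; exact: mind.
- by move=> y w _; rewrite lee_fin mulr_ge0.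
under [in RHS]eq_integral do rewrite /= fimfunE -fsumEFin//.
rewrite ge0_integral_fsum//; last 2 first.
- by move=> y; exact/measurable_EFinP/measurable_funM.
- by move=> y x _; rewrite lee_fin.
rewrite ge0_mule_fsumr; last first.
  by move=> y; apply: integral_ge0 => x _; rewrite lee_fin.
apply: eq_fsbigr => y; rewrite inE => -[t _ yE].
have y0 : 0 <= y by rewrite -yE.
under eq_integral do rewrite -mulrA EFinM.
rewrite ge0_integralZl//; last 2 first.
- by apply/measurable_EFinP; apply: measurable_funM => //; exact: mind.
- by move=> w _; rewrite lee_fin mulr_ge0.
under [in RHS]eq_integral do rewrite EFinM.
rewrite ge0_integralZl//; last first.
  by apply/measurable_EFinP; exact: measurable_indic.
rewrite integral_indic// setIT muleCA -H//; congr (_ * _)%E.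
rewrite [RHS]integral_mkcond; apply: eq_integral => w _.
rewrite patchE indicE.
have -> : (w \in phi @^-1` (h n @^-1` [set y])) = (phi w \in h n @^-1` [set y]).
  by apply/idP/idP; rewrite !inE.
by case: ifP; rewrite ?mul1r ?mul0r.
Qed.

Section independent_sample.
Context {R : realType} {dO dT : measure_display} {Omega : measurableType dO}
  {T : measurableType dT}.
Variables (P : probability Omega R) (n : nat) (Z : 'I_n -> Omega -> T)
  (mu : probability T R).
Hypothesis mZ : forall i, measurable_fun setT (Z i).
Hypothesis lawZ : forall i (A : set T), measurable A -> P (Z i @^-1` A) = mu A.
Hypothesis indepZ : forall A : 'I_n -> set T, (forall i, measurable (A i)) ->
  P (\bigcap_(i in [set: 'I_n]) (Z i @^-1` A i)) =
  (\prod_(i < n) P (Z i @^-1` A i))%E.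

Let mpre i A : measurable A -> measurable (Z i @^-1` A).
Proof. by move=> mA; rewrite -[X in measurable X]setTI; exact: mZ. Qed.

(** Independence is assumed for events only. Functions replace indicators one coordinate at a time:
    the first [k] factors are arbitrary, the others are still indicators, and [k = 0] is the
    assumption itself. *)
Let prod_integral_indic (k : nat) (g : 'I_n -> T -> R) (a : 'I_n -> R) :
  (forall i, measurable_fun setT (g i)) -> (forall i x, 0 <= g i x) ->
  (forall i, (\int[mu]_x (g i x)%:E = (a i)%:E)%E) ->
  (forall i : 'I_n, (k <= i)%N -> exists2 A, measurable A & g i = \1_A) ->
  (\int[P]_w (\prod_(i < n) g i (Z i w))%:E = (\prod_(i < n) a i)%:E)%E.
Proof.
elim: k g a => [|k IH] g a mg g0 ga gind.
  have /choice[A HA] : forall i : 'I_n, exists A, measurable A /\ g i = \1_A.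
    by move=> i; have [//|A mA gA] := gind i; exists A.
  have -> : (\int[P]_w (\prod_(i < n) g i (Z i w))%:E =
      \int[P]_w (\1_(\bigcap_(i in [set: 'I_n]) (Z i @^-1` A i)) w)%:E)%E.
    apply: eq_integral => w _; congr (_%:E).
    rewrite indicE; case: (boolP (w \in _)) => [|H].
      rewrite inE => H; rewrite big1// => i _.
      by rewrite (HA i).2 indicE mem_set//; exact: H.
    have [i /eqP gi0] : exists i, g i (Z i w) == 0.
      apply: contrapT => Hn; move/negP: H; apply; rewrite inE => i _.
      apply: contrapT => nA; apply: Hn; exists i.
      by rewrite (HA i).2 indicE memNset.
    by rewrite (bigD1 i)//= gi0 mul0r.
  rewrite integral_indic//; last first.
    by apply: fin_bigcap_measurable => [|i _]; [exact: finite_finset|exact: mpre (HA i).1].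
  rewrite setIT [LHS]indepZ; last by move=> i; exact: (HA i).1.
  rewrite -prodEFin; apply: eq_bigr => i _; rewrite lawZ; last exact: (HA i).1.
  by rewrite -ga (HA i).2 integral_indic ?setIT//; exact: (HA i).1.
case: (ltnP k n) => [kn|nk]; last first.
  by apply: IH => // i ki; have := leq_trans nk ki; rewrite leqNgt ltn_ord.
pose j := Ordinal kn.
rewrite (bigD1 j)//= mulrC EFinM -ga.
under eq_integral do rewrite (bigD1 j)//=.
(* The product of the other factors is the weight on coordinate [j]. *)
apply: (@ge0_integral_comp_weight _ _ _ _ _ P mu (Z j)
  (fun w => \prod_(i < n | i != j) g i (Z i w))) => //.
- under eq_fun do rewrite big_mkcond/=.
  apply: measurable_prod => i _; case: (i != j) => //.
  exact: measurableT_comp (mg i) (mZ i).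
- by move=> w; apply: prodr_ge0.
- apply: prodr_ge0 => i _; rewrite -lee_fin -ga.
  by apply: integral_ge0 => x _; rewrite lee_fin.
move=> A mA.
(* Restricting to [A] puts an indicator at [j], so the induction hypothesis applies. *)
pose g' i := if i == j then \1_A else g i.
pose a' i := if i == j then fine (mu A) else a i.
have g'E i : g' i = if i == j then \1_A else g i by [].
rewrite integral_mkcond.
have -> : (\int[P]_w ((fun w => (\prod_(i < n | i != j) g i (Z i w))%:E) \_
    (Z j @^-1` A)) w = \int[P]_w (\prod_(i < n) g' i (Z i w))%:E)%E.
  apply: eq_integral => w _; rewrite patchE [in RHS](bigD1 j)//= {1}/g' eqxx indicE.
  have -> : (w \in Z j @^-1` A) = (Z j w \in A) by apply/idP/idP; rewrite !inE.
  case: ifP => _; rewrite ?mul1r ?mul0r//; congr (_%:E).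
  by apply: eq_bigr => i /negPf ij; rewrite /g' ij.
rewrite (IH g' a').
- rewrite (bigD1 j)//= {1}/a' eqxx mulrC EFinM fineK ?fin_num_measure//.
  by congr (_%:E * _)%E; apply: eq_bigr => i /negPf ij; rewrite /a' ij.
- by move=> i; rewrite /g'; case: ifP => _ //; exact: measurable_indic.
- by move=> i x; rewrite /g'; case: ifP => _ //.
- move=> i; rewrite /g' /a'; case: ifP => _ //.
  by rewrite integral_indic// setIT fineK// fin_num_measure.
- move=> i ki; rewrite /g'; case: eqP => [_|ij]; first by exists A.
  apply: gind; rewrite ltn_neqAle ki andbT; apply/eqP => kE; apply: ij.
  exact/val_inj.
Qed.

Lemma independent_prod_integral (f : T -> R) (a : R) :
  measurable_fun setT f -> (forall x, 0 <= f x) ->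
  (\int[mu]_x (f x)%:E = a%:E)%E ->
  (\int[P]_w (\prod_(i < n) f (Z i w))%:E = (a ^+ n)%:E)%E.
Proof.
move=> mf f0 fa.
rewrite (@prod_integral_indic n (fun=> f) (fun=> a))//.
  by rewrite big_const_ord iter_mulr_1.
by move=> i; rewrite leqNgt ltn_ord.
Qed.

(** Markov's inequality for the exponential of the sum, whose expectation factorizes. The tilt is
    absorbed in [F], so one statement serves upper and lower tails. *)
Lemma chernoff_sum (F : T -> R) (a b : R) :
  measurable_fun setT F ->
  (\int[mu]_x (expR (F x))%:E <= (expR b)%:E)%E ->
  measurable [set w | \sum_(i < n) F (Z i w) <= a] /\
  ((1 - expR (n%:R * b - a))%:E <=
    P [set w | (\sum_(i < n) F (Z i w) <= a)%R])%E.
Proof.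
move=> mF Fb.
have mS : measurable_fun setT (fun w => \sum_(i < n) F (Z i w)).
  by apply: measurable_sum => i; exact: measurableT_comp mF (mZ i).
have mE : measurable [set w | \sum_(i < n) F (Z i w) <= a].
  have -> : [set w | \sum_(i < n) F (Z i w) <= a] =
      setT `&` (fun w => \sum_(i < n) F (Z i w)) @^-1` `]-oo, a].
    by apply/seteqP; split => w /=; rewrite in_itv/= => // -[].
  exact: mS.
split=> //.
set E := [set w | _] in mE *.
have PC : P E = (1 - P (~` E))%E by rewrite probability_setC// oppeB ?fin_num_measure// addeA subee// add0e.
rewrite PC EFinB leeB//.
have mexp : measurable_fun setT (fun x => expR (F x)) by exact: measurableT_comp.
have I0 : (0 <= \int[mu]_x (expR (F x))%:E)%E.
  by apply: integral_ge0 => x _; rewrite lee_fin expR_ge0.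
have [c cE] : exists c, (\int[mu]_x (expR (F x))%:E = c%:E)%E.
  exists (fine (\int[mu]_x (expR (F x))%:E)%E); rewrite fineK// ge0_fin_numE//.
  by apply: le_lt_trans Fb _; rewrite ltry.
have c0 : 0 <= c by rewrite -lee_fin -cE.
have prodE w : \prod_(i < n) expR (F (Z i w)) = expR (\sum_(i < n) F (Z i w)).
  by rewrite expR_sum.
have := independent_prod_integral _ _ mexp (fun x => expR_ge0 _) cE.
under eq_integral do rewrite prodE.
move=> intE.
apply: (@le_trans _ _ (\int[P]_w (expR (\sum_(i < n) F (Z i w)) * expR (- a))%:E)%E).
  rewrite -[X in (P X <= _)%E]setIT -integral_indic//; last exact: measurableC.
  apply: ge0_le_integral => //.
  - by apply/measurable_EFinP; apply: measurable_indic; exact: measurableC.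
  - by apply/measurable_EFinP; apply: measurable_funM => //; exact: measurableT_comp.
  - move=> w _; rewrite lee_fin indicE; case: (boolP (w \in _)) => [|_]; last first.
      by rewrite mulr_ge0 ?expR_ge0.
    rewrite inE /E /= => /negP; rewrite -ltNge => aS.
    by rewrite -expRD -expR0 ler_expR subr_ge0 ltW.
under eq_integral do rewrite EFinM.
rewrite ge0_integralZr//; last first.
  by apply/measurable_EFinP; exact: measurableT_comp.
rewrite intE -EFinM lee_fin expRD ler_wpM2r ?expR_ge0//.
rewrite expRM_natl; apply: lerXn2r; rewrite ?nnegrE ?expR_ge0//.
by rewrite -lee_fin -cE.
Qed.
End independent_sample.

(** * Weights of clean observations *)

Module RN := Radon_Nikodym_SigmaFinite.

(* Rao-Blackwellised labels: [h z] is the conditional probability that the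
   observation [z] from the contaminated law [mu] is a clean one. *)
Lemma clean_weight (R : realType) (d : measure_display) (T : measurableType d)
    (mu nu : probability T R) (eps : R) (D : set T) :
  0 <= eps < 1 ->
  (forall A, measurable A -> ((1 - eps)%:E * nu A <= mu A)%E) ->
  measurable D -> nu D = 1%E ->
  exists h : T -> R, [/\ measurable_fun setT h,
    forall x, 0 <= h x <= 1,
    forall x, h x != 0 -> D x,
    ((1 - eps)%:E <= \int[mu]_x (h x)%:E)%E &
    forall phi : T -> R, measurable_fun setT phi -> (forall x, 0 <= phi x) ->
      (\int[mu]_x (h x * phi x)%:E <= (1 - eps)%:E * \int[nu]_x (phi x)%:E)%E].
Proof.
move=> /andP[e0 e1] nu_le mD nuD.
have e1' : 0 <= 1 - eps by rewrite subr_ge0 ltW.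
have nu_mu : nu `<< mu.
  apply/null_content_dominatesP => A mA muA0.
  have := nu_le A mA; rewrite muA0 => H.
  have [c cE] : exists c, nu A = c%:E.
    by exists (fine (nu A)); rewrite fineK// fin_num_measure.
  move: H; rewrite cE -EFinM lee_fin pmulr_rle0 ?subr_gt0// => c0.
  congr (_%:E); apply/eqP; rewrite eq_le c0/=.
  by rewrite -lee_fin -cE measure_ge0.
pose f := fun x => fine (RN.f nu mu x).
have fE x : (f x)%:E = RN.f nu mu x by rewrite /f fineK// RN.f_fin_num.
have f0 x : 0 <= f x by rewrite -lee_fin fE RN.f_ge0.
have mf : measurable_fun setT f.
  apply/measurable_EFinP; rewrite (_ : EFin \o f = RN.f nu mu).
    exact: measurable_int (RN.f_integrable nu_mu).
  by apply/funext => x /=; rewrite fE.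
pose g x := (1 - eps) * f x.
have g0 x : 0 <= g x by rewrite mulr_ge0.
have mg : measurable_fun setT g by exact: measurable_funM.
have mg' A : measurable_fun A g by exact: measurable_funTS.
have intg A : measurable A -> (\int[mu]_(x in A) (g x)%:E = (1 - eps)%:E * nu A)%E.
  move=> mA; rewrite (RN.f_integral nu_mu)// -ge0_integralZl//.
  - by apply: eq_integral => x _; rewrite /g EFinM fE.
  - by apply: measurable_funTS; exact: measurable_int (RN.f_integrable nu_mu).
  - by move=> x _; rewrite -fE lee_fin.
(* The density [g] of the clean part is at most 1 only almost everywhere. Truncation makes this hold
   pointwise, and the cut to [D] below does the same for the support. *)
pose m x := Num.min (g x) 1.
have mm : measurable_fun setT m by exact: measurable_minr.
have m0 x : 0 <= m x by rewrite le_min g0 ler01.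
pose h x := m x * \1_D x.
have mh : measurable_fun setT h.
  by apply: measurable_funM => //; exact: measurable_indic.
have h01 x : 0 <= h x <= 1.
  rewrite /h indicE; case: (x \in D); rewrite ?mulr1 ?mulr0 ?lexx ?ler01//.
  by rewrite m0/= ge_min lexx orbT.
have hg x : h x <= g x.
  rewrite /h indicE; case: (x \in D); rewrite ?mulr1 ?mulr0//.
  by rewrite ge_min lexx.
exists h; split => //.
- move=> x; rewrite /h indicE; case: (boolP (x \in D)) => [|_].
    by rewrite inE.
  by rewrite mulr0 eqxx.
(* Truncation costs no mass: on [A] the truncated density is 1 and integrates to [mu], which
   dominates [(1 - eps) nu]. *)
- pose A := [set x | 1 < g x].
  have mA : measurable A.
    have -> : A = setT `&` g @^-1` `]1, +oo[.
      by apply/seteqP; split => x /=; rewrite in_itv/= andbT// => -[].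
    exact: mg.
  have mAD : measurable (A `&` D) by exact: measurableI.
  have mDA : measurable (D `\` A) by exact: measurableD.
  apply: (@le_trans _ _ (\int[mu]_(x in D) (m x)%:E)%E); last first.
    rewrite [leLHS]integral_mkcond; apply: ge0_le_integral => //.
    - by move=> x _; rewrite patchE; case: ifP; rewrite ?lee_fin.
    - apply/(measurable_restrictT _ mD).
      by apply: measurable_funTS; exact/measurable_EFinP.
    - exact/measurable_EFinP.
    - move=> x _; rewrite patchE /h indicE.
      by case: (x \in D); rewrite ?mulr1 ?mulr0.
  have mmE B : measurable_fun B (fun x => (m x)%:E).
    by apply: measurable_funTS; exact/measurable_EFinP.
  rewrite -(setDUK (@subIsetr _ A D)).
  rewrite ge0_integral_setU//=; last first.
  - by rewrite disj_set2E; apply/eqP/seteqP; split => x //= -[[? ?] [? []]].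
  - by move=> x _; rewrite lee_fin.
  - by apply: measurableD.
  rewrite setDIr setDv setU0.
  have -> : (\int[mu]_(x in A `&` D) (m x)%:E = mu (A `&` D))%E.
    rewrite -[RHS]mul1e -integral_cst//; apply: eq_integral => x.
    by rewrite inE => -[/= Ax _]; rewrite /m min_r// ltW.
  have -> : (\int[mu]_(x in D `\` A) (m x)%:E = (1 - eps)%:E * nu (D `\` A))%E.
    rewrite -intg//; apply: eq_integral => x.
    by rewrite inE => -[_ /= /negP]; rewrite -leNgt => Ax; rewrite /m min_l.
  apply: (@le_trans _ _ ((1 - eps)%:E * nu (A `&` D) + (1 - eps)%:E * nu (D `\` A)))%E.
    rewrite -muleDr//; last by rewrite ge0_adde_def// inE.
    rewrite -measureU//.
      have -> : A `&` D `|` D `\` A = D.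
        apply/seteqP; split => x /=; first by case=> -[].
        by move=> Dx; case: (pselect (A x)) => Ax; [left|right].
      by rewrite -[leLHS]mule1 -[X in (_ * X <= _)%E]nuD; exact: lexx.
    by apply/seteqP; split => x //= -[[? ?] [? []]].
  by rewrite leeD2r// nu_le.
- move=> phi mphi phi0.
  have -> : ((1 - eps)%:E * \int[nu]_x (phi x)%:E = \int[mu]_x (g x * phi x)%:E)%E.
    rewrite -(RN.change_of_variables nu_mu)//; last first.
    - exact/measurable_EFinP.
    rewrite -ge0_integralZl//.
    - by apply: eq_integral => x _; rewrite -fE -!EFinM; congr (_%:E); rewrite /g; ring.
    - apply: emeasurable_funM; first exact/measurable_EFinP.
      exact: measurable_int (RN.f_integrable nu_mu).
    - by move=> x _; rewrite -fE -EFinM lee_fin mulr_ge0.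
  apply: ge0_le_integral => //.
  - by move=> x _; rewrite lee_fin mulr_ge0//; case/andP: (h01 x).
  - by apply/measurable_EFinP; exact: measurable_funM.
  - by apply/measurable_EFinP; exact: measurable_funM.
  - by move=> x _; rewrite lee_fin ler_wpM2r.
Qed.

Lemma integral_cst_probability (R : realType) (d : measure_display)
    (T : measurableType d) (mu : probability T R) (c : R) :
  (\int[mu]_x c%:E = c%:E)%E.
Proof.
rewrite integral_cst// -[RHS]mule1; congr (_ * _)%E; exact: probability_setT.
Qed.

(** The tangent inequality at [t * x], taken at the points 0 and [x], is averaged with weights
    [1 - t] and [t]. *)
Lemma convex_expR01 (R : realType) (t x : R) : 0 <= t <= 1 ->
  expR (t * x) <= 1 - t + t * expR x.
Proof.
move=> /andP[t0 t1].
have H1 : expR (t * x) * (1 - t * x) <= 1.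
  have := expR_ge1Dx (- (t * x)); rewrite expRN => H.
  by rewrite -[leRHS](@mulfV _ (expR (t * x))) ?gt_eqF ?expR_gt0// ler_wpM2l ?expR_ge0.
have H2 : expR (t * x) * (1 + (x - t * x)) <= expR x.
  rewrite -[in leRHS](subrKC (t * x) x) expRD ler_wpM2l ?expR_ge0//.
  exact: expR_ge1Dx.
have := lerD (ler_wpM2l (_ : 0 <= 1 - t) H1) (ler_wpM2l t0 H2).
rewrite subr_ge0 mulr1 => /(_ t1); apply: le_trans.
by rewrite le_eqVlt; apply/orP; left; apply/eqP; ring.
Qed.

Lemma integral_cst_probabilitym_le (R : realType) (d : measure_display)
    (T : measurableType d) (mu : probability T R) (eps : R) (h : T -> R) :
  measurable_fun setT h -> (forall x, 0 <= h x <= 1) ->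
  ((1 - eps)%:E <= \int[mu]_x (h x)%:E)%E ->
  (\int[mu]_x (1 - h x)%:E <= eps%:E)%E.
Proof.
move=> mh h01 hge.
have [c cE] : exists c, (\int[mu]_x (h x)%:E = c%:E)%E.
  exists (fine (\int[mu]_x (h x)%:E)%E); rewrite fineK// ge0_fin_numE//; last first.
    by apply: integral_ge0 => x _; rewrite lee_fin; case/andP: (h01 x).
  apply: (@le_lt_trans _ _ (\int[mu]_x (cst 1%E x))%E); last first.
    by rewrite integral_cst_probability ltry.
  apply: ge0_le_integral => //.
  - by move=> x _; rewrite lee_fin; case/andP: (h01 x).
  - exact/measurable_EFinP.
  - by move=> x _; rewrite lee_fin; case/andP: (h01 x).
have int1h : (\int[mu]_x (1 - h x)%:E = (1 - c)%:E)%E.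
  have : (\int[mu]_x ((1 - h x)%:E + (h x)%:E) = 1)%E.
    under eq_integral do rewrite -EFinD subrK.
    exact: integral_cst_probability.
  rewrite ge0_integralD//; last 4 first.
  - by move=> x _; rewrite lee_fin subr_ge0; case/andP: (h01 x).
  - by apply/measurable_EFinP; exact: measurable_funB.
  - by move=> x _; rewrite lee_fin; case/andP: (h01 x).
  - exact/measurable_EFinP.
  by rewrite cE => /eqP; rewrite eq_sym -sube_eq// ?fin_num_adde_defl// => /eqP <-.
by rewrite int1h lee_fin; move: hge; rewrite cE lee_fin; lra.
Qed.

(** By convexity [expR (h g) <= 1 - h + h expR g]. The mean of [1 - h] is at most [eps] and the
    other term is bounded under [nu], so arbitrary contamination leaves only a factor [1 - eps] on
    [b], which may have either sign. *)
Lemma weighted_mgf (R : realType) (d : measure_display) (T : measurableType d)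
    (mu nu : probability T R) (eps b : R) (h g : T -> R) :
  measurable_fun setT h -> (forall x, 0 <= h x <= 1) ->
  ((1 - eps)%:E <= \int[mu]_x (h x)%:E)%E ->
  (forall phi : T -> R, measurable_fun setT phi -> (forall x, 0 <= phi x) ->
      (\int[mu]_x (h x * phi x)%:E <= (1 - eps)%:E * \int[nu]_x (phi x)%:E)%E) ->
  eps < 1 -> measurable_fun setT g ->
  (\int[nu]_x (expR (g x))%:E <= (1 + b)%:E)%E ->
  (\int[mu]_x (expR (h x * g x))%:E <= (expR ((1 - eps) * b))%:E)%E.
Proof.
move=> mh h01 hge hphi e1 mg gb.
have me : measurable_fun setT (fun x => expR (g x)) by exact: measurableT_comp.
apply: (@le_trans _ _ (\int[mu]_x ((1 - h x)%:E + (h x * expR (g x))%:E))%E).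
  apply: ge0_le_integral => //.
  - by apply/measurable_EFinP; apply: measurableT_comp => //; exact: measurable_funM.
  - apply/measurable_EFinP; apply: measurable_funD; last exact: measurable_funM.
    exact: measurable_funB.
  - by move=> x _; rewrite -EFinD lee_fin convex_expR01.
rewrite ge0_integralD//; last 4 first.
- by move=> x _; rewrite lee_fin subr_ge0; case/andP: (h01 x).
- by apply/measurable_EFinP; exact: measurable_funB.
- by move=> x _; rewrite lee_fin mulr_ge0 ?expR_ge0//; case/andP: (h01 x).
- by apply/measurable_EFinP; exact: measurable_funM.
apply: (@le_trans _ _ (eps%:E + (1 - eps)%:E * (1 + b)%:E)%E).
  apply: leeD.
    exact: integral_cst_probabilitym_le.
  apply: le_trans (hphi _ me (fun x => expR_ge0 _)) _.
  by apply: lee_wpmul2l => //; rewrite lee_fin; lra.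
rewrite -EFinM -EFinD lee_fin.
apply: le_trans (expR_ge1Dx _); lra.
Qed.

(** * Events of high probability *)

Section likely.
Context {R : realType} {dO : measure_display} {Omega : measurableType dO}.
Variable P : probability Omega R.

(** A statement about all matrices at once need not define a measurable event, so [Phi] is asked to
    hold on some measurable set of large probability. *)
Definition likely (delta : R) (Phi : Omega -> Prop) : Prop :=
  exists E : set Omega,
    [/\ measurable E, ((1 - delta)%:E <= P E)%E & forall w, E w -> Phi w].

Lemma likely_weaken delta delta' Phi :
  likely delta Phi -> delta <= delta' -> likely delta' Phi.
Proof.
move=> [E [mE PE EPhi]] dd; exists E; split => //.
by apply: le_trans PE; rewrite lee_fin lerB.
Qed.

Lemma likely_impl delta (Phi Psi : Omega -> Prop) :
  likely delta Phi -> (forall w, Phi w -> Psi w) -> likely delta Psi.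
Proof.
by move=> [E [mE PE EPhi]] H; exists E; split => // w /EPhi/H.
Qed.

Lemma likely_true : likely 0 (fun=> True).
Proof.
exists setT; split => //; rewrite subr0.
by rewrite le_eqVlt; apply/orP; left; apply/eqP/esym; exact: probability_setT.
Qed.

Lemma likely_and delta delta' (Phi Psi : Omega -> Prop) :
  likely delta Phi -> likely delta' Psi ->
  likely (delta + delta') (fun w => Phi w /\ Psi w).
Proof.
move=> [E [mE PE EPhi]] [F [mF PF FPsi]]; exists (E `&` F); split.
- exact: measurableI.
- have PC A : measurable A -> P (~` A) = (1 - P A)%E by exact: probability_setC.
  have H A a : measurable A -> ((1 - a)%:E <= P A)%E -> (P (~` A) <= a%:E)%E.
    move=> mA; rewrite PC//.
    have [c ->] : exists c, P A = c%:E.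
      by exists (fine (P A)); rewrite fineK// fin_num_measure.
    by rewrite -EFinB !lee_fin; lra.
  have : (P (~` (E `&` F)) <= (delta + delta')%:E)%E.
    rewrite setCI EFinD; apply: le_trans (leeD (H _ _ mE PE) (H _ _ mF PF)).
    by apply: measureU2; exact: measurableC.
  rewrite PC; last exact: measurableI.
  have [c ->] : exists c, P (E `&` F) = c%:E.
    exists (fine (P (E `&` F))); rewrite fineK// fin_num_measure//.
    exact: measurableI.
  by rewrite -EFinB !lee_fin; lra.
- by move=> w [/EPhi ? /FPsi].
Qed.

Lemma likely_seq (I : eqType) (s : seq I) delta (Phi : I -> Omega -> Prop) :
  (forall i, i \in s -> likely delta (Phi i)) ->
  likely ((size s)%:R * delta) (fun w => forall i, i \in s -> Phi i w).
Proof.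
elim: s => [_|j s IH H].
  rewrite mul0r; apply: likely_impl likely_true _ => w _ i.
  by rewrite in_nil.
have H1 := H j (mem_head _ _).
have H2 : likely ((size s)%:R * delta) (fun w => forall i, i \in s -> Phi i w).
  by apply: IH => i si; apply: H; rewrite inE si orbT.
have -> : (size (j :: s))%:R * delta = delta + (size s)%:R * delta.
  by rewrite /= -natr1; ring.
apply: likely_impl (likely_and _ _ _ _ H1 H2) _ => w [Pj Ps] i.
by rewrite inE => /orP[/eqP ->|/Ps].
Qed.

Lemma likely_lt (K : nat) (delta : nat -> R) (Phi : nat -> Omega -> Prop) :
  (forall k, (k < K)%N -> likely (delta k) (Phi k)) ->
  likely (\sum_(k < K) delta k) (fun w => forall k, (k < K)%N -> Phi k w).
Proof.
elim: K => [_|K IH H].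
  by rewrite big_ord0; apply: likely_impl likely_true _.
rewrite big_ord_recr/=.
have H2 := IH (fun k kK => H k (ltnW kK)).
apply: likely_impl (likely_and _ _ _ _ H2 (H K (ltnSn K))) _ => w [Ps PK] k.
by rewrite ltnS leq_eqVlt => /orP[/eqP ->|/Ps].
Qed.

End likely.

(** * Finite nets and Gram matrices *)

(** A generating function replaces a volume argument: every admissible code contributes at least 1
    to the sum of [y ^+ (M * #|I|) * \prod_i y ^- (c i).1], and this sum over all codes factorizes
    over the coordinates. *)
Lemma card_lattice_simplex (R : realType) (I : finType) (M T : nat) :
  (0 < M)%N ->
  (#|[pred c : {ffun I -> 'I_T.+1 * bool} | (\sum_i (c i).1 <= M * #|I|)%N]|)%:R
    <= (expR 1 * (2 * M.+1%:R)) ^+ #|I| :> R.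
Proof.
move=> M0; set C := [pred c : {ffun I -> 'I_T.+1 * bool} | _].
have M0' : 0 < M%:R :> R by rewrite ltr0n.
(* This value balances two bounds: [y ^+ M <= expR 1], and the geometric series in [y^-1] is at most
   [M + 1], doubled by the sign bit. *)
pose y : R := 1 + M%:R^-1.
have y1 : 1 <= y by rewrite lerDl invr_ge0 ltW.
have y0 : 0 < y by apply: lt_le_trans y1.
have yq k : y ^- k = (y^-1) ^+ k by rewrite exprVn.
apply: (@le_trans _ _ (\sum_(c : {ffun I -> 'I_T.+1 * bool})
    y ^+ (M * #|I|) * \prod_i y ^- (c i).1)).
  rewrite -sum1_card natr_sum [leRHS](bigID (mem C))/=.
  rewrite -[leLHS]addr0; apply: lerD; last first.
    apply: sumr_ge0 => c _; apply: mulr_ge0; first by rewrite exprn_ge0 ?ltW.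
    by apply: prodr_ge0 => i _; rewrite invr_ge0 exprn_ge0 ?ltW.
  apply: ler_sum => c; rewrite inE => cM.
  under eq_bigr do rewrite yq.
  rewrite prodrXr exprVn ler_pdivlMr ?exprn_gt0// mul1r.
  exact: ler_weXn2l.
have M0n : M%:R != 0 :> R by rewrite gt_eqF.
have M1n : M%:R + 1 != 0 :> R by rewrite gt_eqF// addr_gt0.
have yn N : y ^+ N != 0 by rewrite gt_eqF// exprn_gt0.
have sumq N : \sum_(k < N) y ^- k = M.+1%:R * (1 - y ^- N).
  elim: N => [|N IH]; first by rewrite big_ord0 expr0 invr1 subrr mulr0.
  rewrite big_ord_recr/= IH exprSr invfM -natr1.
  have -> : y^-1 = M%:R / (M%:R + 1) by rewrite /y; field; rewrite ?M0n ?M1n.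
  by field; rewrite ?yn ?M1n.
have bound : \sum_(j : 'I_T.+1 * bool) y ^- j.1 <= 2 * M.+1%:R.
  rewrite -(pair_bigA _ (fun (k : 'I_T.+1) (b : bool) => y ^- k))/=.
  under eq_bigr do rewrite sumr_const card_bool -mulr_natl.
  rewrite -mulr_sumr sumq ler_wpM2l// ler_piMr// gerBl.
  by rewrite invr_ge0 exprn_ge0 ?ltW.
rewrite -mulr_sumr -(bigA_distr_bigA (fun (i : I) (j : 'I_T.+1 * bool) => y ^- j.1)).
rewrite exprM prodr_const exprMn; apply: ler_pM.
- by rewrite !exprn_ge0 ?ltW.
- by rewrite exprn_ge0// sumr_ge0// => j _; rewrite invr_ge0 exprn_ge0 ?ltW.
- apply: lerXn2r; rewrite ?nnegrE ?expR_ge0 ?exprn_ge0 ?(ltW y0)//.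
  apply: (@le_trans _ _ (expR (M%:R^-1) ^+ M)).
    by apply: lerXn2r; rewrite ?nnegrE ?expR_ge0 ?(ltW y0)// expR_ge1Dx.
  by rewrite -expRM_natl mulfV ?gt_eqF.
- apply: lerXn2r => //; rewrite ?nnegrE ?mulr_ge0//.
  by rewrite sumr_ge0// => j _; rewrite invr_ge0 exprn_ge0 ?ltW.
Qed.

(** Each coordinate is coded by its sign and the integer part of [|W V i| M sqrt d]; equal codes
    mean coordinates within [1 / (M sqrt d)]. One point of [S] is picked per code that occurs, so a
    net of the sphere stays on the sphere. *)
Lemma finite_net (R : realType) (I : finType) (T : eqType) (W : T -> I -> R)
    (S : set T) (M : nat) :
  (0 < M)%N -> (forall V, S V -> \sum_i W V i ^+ 2 <= 1) ->
  exists s : seq T, [/\ forall V, V \in s -> S V,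
    forall V, S V -> exists2 V', V' \in s &
      \sum_i (W V i - W V' i) ^+ 2 <= (M%:R ^+ 2)^-1 &
    (size s)%:R <= (expR 1 * (2 * M.+1%:R)) ^+ #|I| :> R].
Proof.
move=> M0 S1.
have M0' : 0 < M%:R :> R by rewrite ltr0n.
set d := #|I|; pose r : R := Num.sqrt d%:R.
have r0 : 0 <= r by exact: sqrtr_ge0.
have r2 : r ^+ 2 = d%:R by rewrite sqr_sqrtr ?ler0n.
pose z V i := Num.truncn (`|W V i| * (M%:R * r)).
have zP V i : (z V i)%:R <= `|W V i| * (M%:R * r) < (z V i).+1%:R.
  by apply: truncn_itv; rewrite mulr_ge0// mulr_ge0// ltW.
have zsum V : S V -> (\sum_i z V i <= M * d)%N.
  move=> SV; rewrite -(ler_nat R) natr_sum natrM.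
  (* As [r ^+ 2 = d], the inequality [|w| r <= (d w^2 + 1) / 2] bounds the sum of the integer parts
     by [M d]. *)
  apply: (@le_trans _ _ (\sum_i M%:R * ((d%:R * W V i ^+ 2 + 1) / 2))).
    apply: ler_sum => i _; have /andP[+ _] := zP V i; move/le_trans; apply.
    rewrite mulrCA ler_wpM2l// ?(ltW M0')// -r2.
    have : 0 <= (`|W V i| * r - 1) ^+ 2 by exact: sqr_ge0.
    rewrite -(real_normK (num_real (W V i))) => H; lra.
  rewrite -mulr_sumr ler_wpM2l ?(ltW M0')// -mulr_suml big_split/= -mulr_sumr.
  rewrite sumr_const -/d; have := ler_wpM2l (ler0n R d) (S1 V SV); lra.
pose code V : {ffun I -> 'I_(M * d).+1 * bool} :=
  [ffun i => (inord (z V i), 0 <= W V i)].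
have codeC V : S V -> code V \in
   [pred c : {ffun I -> 'I_(M * d).+1 * bool} | (\sum_i (c i).1 <= M * d)%N].
  move=> SV; rewrite inE; apply: leq_trans (zsum V SV); apply: leq_sum => i _.
  rewrite ffunE/= inordK// ltnS; apply: leq_trans (zsum V SV).
  by rewrite (bigD1 i)//= leq_addr.
pose pk c : option T := match pselect (exists V, S V /\ code V = c) with
  | left H => Some (sval (cid H)) | right _ => None end.
pose s := pmap pk (enum [pred c : {ffun I -> 'I_(M * d).+1 * bool} |
   (\sum_i (c i).1 <= M * d)%N]).
exists s; split.
- move=> V; rewrite mem_pmap => /mapP[c _]; rewrite /pk.
  by case: pselect => // H [->]; case: (svalP (cid H)).
- move=> V SV.
  have [V' [pV' SV' cV']] : exists V', [/\ pk (code V) = Some V', S V' & code V' = code V].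
    rewrite /pk; case: pselect => [H|H]; last by exfalso; apply: H; exists V.
    by exists (sval (cid H)); case: (svalP (cid H)) => *; split.
  exists V'.
    by rewrite mem_pmap; apply/mapP; exists (code V); rewrite // mem_enum codeC.
  have [d0|d0] := posnP d.
    rewrite big1 ?invr_ge0 ?exprn_ge0// => i _.
    by have := fintype0 i d0.
  have dr0 : 0 < d%:R :> R by rewrite ltr0n.
  have rp : 0 < r by rewrite sqrtr_gt0.
  apply: (@le_trans _ _ (\sum_(i : I) ((M%:R * r) ^+ 2)^-1)); last first.
    rewrite sumr_const -/d exprMn r2 -mulr_natr le_eqVlt; apply/orP; left.
    by apply/eqP; field; rewrite !gt_eqF.
  apply: ler_sum => i _.
  have /ffunP/(_ i) := cV'; rewrite !ffunE => -[ze se].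
  have zV : z V' i = z V i.
    have zb U : S U -> (z U i < (M * d).+1)%N.
      move=> SU; rewrite ltnS; apply: leq_trans (zsum U SU).
      by rewrite (bigD1 i)//= leq_addr.
    by rewrite -(inordK (zb _ SV')) -(inordK (zb _ SV)) ze.
  have := zP V i; have := zP V' i; rewrite zV -!natr1 => /andP[a1 a2] /andP[b1 b2].
  have Mr0 : 0 < M%:R * r by rewrite mulr_gt0.
  have H : `| (W V i - W V' i) * (M%:R * r) | <= 1.
    have eqn U : `|W U i| = if 0 <= W U i then W U i else - W U i.
      by case: ifPn => [/ger0_norm//|]; rewrite -ltNge => /ltr0_norm.
    move: a1 a2 b1 b2; rewrite !eqn se; case: ifP => _; rewrite mulrBl ler_norml; lra.
  rewrite -[leRHS]mul1r ler_pdivlMr ?exprn_gt0// -exprMn -real_normK ?num_real//.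
  by rewrite exprn_ile1.
- apply: le_trans (card_lattice_simplex _ _ _ (M * d) M0).
  rewrite ler_nat size_pmap; apply: leq_trans (count_size _ _) _.
  by rewrite -cardE.
Qed.

(** Elimination of the first coordinate, the Schur complement being again positive semidefinite. A
    factor [L] turns the form of a possibly singular [Sigma] into the Euclidean norm of [L^T V], to
    which [finite_net] applies. *)
Lemma psd_cholesky (R : rcfType) (p : nat) (A : 'M[R]_p) :
  A^T = A -> (forall v : 'cV[R]_p, 0 <= (v^T *m A *m v) 0 0) ->
  exists L : 'M[R]_p, A = L *m L^T.
Proof.
elim: p A => [|p IH] A Asym Apos.
  by exists 0; apply/matrixP => -[].
move: A Asym Apos; rewrite -[p.+1]/(1 + p)%N => A Asym Apos.
pose a := A 0 0; pose b : 'cV[R]_p := @dlsubmx R 1 p 1 p A.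
pose D : 'M[R]_p := @drsubmx R 1 p 1 p A.
have bl : A = @block_mx R 1 p 1 p a%:M b^T b D.
  rewrite -[LHS](@submxK R 1 p 1 p); congr block_mx.
    by rewrite [LHS]mx11_scalar !mxE; congr (A _ _)%:M; exact/val_inj.
  by rewrite /b -[in RHS]Asym; apply/matrixP => i j; rewrite !mxE.
have Dsym : D^T = D.
  by rewrite /D -[in RHS]Asym; apply/matrixP => i j; rewrite !mxE.
have q (x : R) (w : 'cV[R]_p) :
    0 <= a * x ^+ 2 + 2 * x * (b^T *m w) 0 0 + (w^T *m D *m w) 0 0.
  have := Apos (@col_mx R 1 p 1 x%:M w); rewrite bl.
  rewrite tr_col_mx mul_row_block mul_row_col !mulmxDl.
  have add00 (X Y : 'M[R]_1) : (X + Y) 0 0 = X 0 0 + Y 0 0 by rewrite mxE.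
  rewrite !add00 tr_scalar_mx -!scalar_mxM.
  have -> : (w^T *m b *m x%:M) 0 0 = x * (b^T *m w) 0 0.
    rewrite mul_mx_scalar !mxE; congr (_ * _).
    by apply: eq_bigr => i _; rewrite !mxE mulrC.
  have -> : (x%:M *m b^T *m w) 0 0 = x * (b^T *m w) 0 0.
    by rewrite mul_scalar_mx -scalemxAl mxE.
  rewrite [X in X + _ + _]mxE eqxx mulr1n; lra.
have a0 : 0 <= a.
  by have := q 1 0; rewrite !mulmx0 !mxE; lra.
(* For a zero pivot this is 0, the inverse of 0 being 0. *)
pose c : 'cV[R]_p := (Num.sqrt a)^-1 *: b.
have bc : b = Num.sqrt a *: c.
  have [a00|an0] := eqVneq a 0; last first.
    rewrite scalerA mulfV ?scale1r// gt_eqF// sqrtr_gt0 lt_def an0//.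
  rewrite a00 sqrtr0 scale0r.
  have bb : (b^T *m b) 0 0 = 0.
    apply/eqP/negPn/negP => bb0.
    (* For [a = 0] the form is affine in [x], and this [x] gives it the value -1. *)
    have := q (- ((b^T *m D *m b) 0 0 + 1) / (2 * (b^T *m b) 0 0)) b.
    rewrite a00 mul0r add0r.
    have -> : 2 * (- ((b^T *m D *m b) 0 0 + 1) / (2 * (b^T *m b) 0 0)) *
      (b^T *m b) 0 0 = - ((b^T *m D *m b) 0 0 + 1) by field.
    by rewrite opprD addrAC addNr add0r lerNr oppr0 ler10.
  have bi i : b i 0 = 0.
    move: bb; rewrite mxE => /eqP; rewrite psumr_eq0; last first.
      by move=> k _; rewrite [b^T _ _]mxE -expr2 sqr_ge0.
    move=> /allP/(_ i (mem_index_enum _)); rewrite [b^T _ _]mxE mulf_eq0 orbb.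
    by move/eqP.
  by apply/matrixP => i j; rewrite ord1 bi !mxE.
have [|w|L' DL] := IH (D - c *m c^T).
- by rewrite linearB/= Dsym trmx_mul trmxK.
- have sub00 (X Y : 'M[R]_1) : (X - Y) 0 0 = X 0 0 - Y 0 0 by rewrite !mxE.
  rewrite mulmxBr mulmxBl sub00.
  have -> : (w^T *m (c *m c^T) *m w) 0 0 = ((c^T *m w) 0 0) ^+ 2.
    rewrite mulmxA -mulmxA mxE big_ord1 expr2; congr (_ * _).
    by rewrite !mxE; apply: eq_bigr => i _; rewrite !mxE mulrC.
  have [a00|an0] := eqVneq a 0.
    by have := q 0 w; rewrite /c a00 sqrtr0 invr0 scale0r trmx0 mul0mx !mxE; lra.
  have sa : Num.sqrt a ^+ 2 = a by rewrite sqr_sqrtr.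
  have sa0 : Num.sqrt a != 0.
    by apply: contra_neq an0 => H; rewrite -sa H expr0n.
  (* At the minimizer in [x] the form equals the Schur complement. *)
  have := q (- (c^T *m w) 0 0 / Num.sqrt a) w.
  have -> : (b^T *m w) 0 0 = Num.sqrt a * (c^T *m w) 0 0.
    by rewrite {1}bc linearZ/= -scalemxAl mxE.
  rewrite -{1}sa; congr (_ <= _); field.
  exact: sa0.
exists (@block_mx R 1 p 1 p (Num.sqrt a)%:M 0 c L').
rewrite (@tr_block_mx R 1 p 1 p) (@mulmx_block R 1 p 1 p 1 p) [LHS]bl.
rewrite trmx0 !mul0mx !mulmx0 !addr0 tr_scalar_mx -scalar_mxM -expr2 sqr_sqrtr//.
congr block_mx.
- by rewrite mul_scalar_mx {1}bc linearZ.
- by rewrite mul_mx_scalar.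
- by rewrite -DL addrC subrK.
Qed.

(** * The regression model *)

Section normal_facts.
Context {R : realType}.

(** From [2 <= pi < 4], the number [sqrt (2 pi)] lies between 2 and 3. *)
Lemma normal_peak_bounds (s : R) : 0 < s ->
  (3 * s)^-1 <= normal_peak s <= (2 * s)^-1.
Proof.
move=> s0; have pi4 : pi < 4 :> R by have := @pihalf_lt2 R; lra.
have s20 : 0 < s ^+ 2 by rewrite exprn_gt0.
have sp0 : 0 < s ^+ 2 * pi *+ 2 by rewrite mulrn_wgt0// mulr_gt0// pi_gt0.
rewrite /normal_peak; apply/andP; split; rewrite lef_pV2 ?posrE ?sqrtr_gt0 ?mulr_gt0//.
  rewrite -[leRHS](@ger0_norm _ (3 * s)) ?mulr_ge0 ?(ltW s0)// -sqrtr_sqr ler_wsqrtr//.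
  have : s ^+ 2 * pi <= s ^+ 2 * 4 by rewrite ler_wpM2l ?(ltW s20)// ltW.
  rewrite exprMn -mulr_natr; lra.
rewrite -[leLHS](@ger0_norm _ (2 * s)) ?mulr_ge0 ?(ltW s0)// -sqrtr_sqr ler_wsqrtr//.
have : s ^+ 2 * 2 <= s ^+ 2 * pi by rewrite ler_wpM2l ?(ltW s20)// pi_ge2.
rewrite exprMn -mulr_natr; lra.
Qed.

Lemma normal_prob_itv_le (s u : R) : 0 < s -> 0 <= u ->
  (normal_prob 0 s `[(- u)%R, u]%classic <= (u / s)%:E)%E.
Proof.
move=> s0 u0; rewrite /normal_prob.
have /andP[_ pk] := normal_peak_bounds _ s0.
apply: (@le_trans _ _ (\int[lebesgue_measure]_(x in `[(- u)%R, u]%classic) (cst ((2 * s)^-1)%:E x))%E).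
  apply: ge0_le_integral => //.
  - by move=> x _; rewrite lee_fin normal_pdf_ge0.
  - by apply: measurable_funTS; apply/measurable_EFinP; exact: measurable_normal_pdf.
  - move=> x _; rewrite lee_fin; apply: le_trans pk; apply: normal_pdf_ub.
    by rewrite gt_eqF.
rewrite integral_cst//= lebesgue_measure_itv/= lte_fin.
case: ifPn => [_|_]; last by rewrite mule0 lee_fin divr_ge0// ltW.
rewrite -EFinB -EFinM lee_fin le_eqVlt; apply/orP; left; apply/eqP.
by field; rewrite gt_eqF.
Qed.

Lemma normal_prob_itv_ge (s x1 x2 : R) : 0 < s -> 0 <= x1 -> x1 < x2 -> x2 <= s ->
  (((x2 - x1) / (6 * s))%:E <= normal_prob 0 s `[x1, x2]%classic)%E.
Proof.
move=> s0 x10 x12 x2s; rewrite /normal_prob.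
have /andP[pk _] := normal_peak_bounds _ s0.
apply: (@le_trans _ _ (\int[lebesgue_measure]_(x in `[x1, x2]%classic) (cst ((6 * s)^-1)%:E x))%E).
  rewrite integral_cst//= lebesgue_measure_itv/= lte_fin x12.
  by rewrite -EFinB -EFinM mulrC.
apply: ge0_le_integral => //.
- by move=> x _ /=; rewrite lee_fin invr_ge0 mulr_ge0// ltW.
- by apply: measurable_funTS; apply/measurable_EFinP; exact: measurable_normal_pdf.
- move=> x /=; rewrite in_itv/= => /andP[xx1 xx2]; rewrite lee_fin normal_pdfE ?gt_eqF//.
  have -> : (6 * s)^-1 = (3 * s)^-1 * 2^-1 by field; rewrite gt_eqF.
  apply: ler_pM => //; rewrite ?invr_ge0 ?mulr_ge0 ?(ltW s0)//.
  rewrite /normal_fun subr0.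
  (* On [[0, s]] the exponent is at least -1/2, so the density keeps half of its peak. *)
  apply: (@le_trans _ _ (1 - 2^-1)); first lra.
  apply: le_trans (expR_ge1Dx _); rewrite lerD2l mulNr lerN2.
  rewrite ler_pdivrMr ?mulrn_wgt0 ?exprn_gt0// -[_ *+ 2]mulr_natr.
  have : x ^+ 2 <= s ^+ 2 by rewrite ler_pXn2r ?nnegrE ?(ltW s0)//; lra.
  lra.
Qed.

Lemma integral_normal_prob_density (s : R) (f : R -> R) :
  measurable_fun setT f -> (forall x, 0 <= f x) ->
  (\int[normal_prob 0 s]_x (f x)%:E =
   \int[lebesgue_measure]_x (f x * normal_pdf 0 s x)%:E)%E.
Proof.
move=> mf f0.
rewrite (@ge0_integral_comp_weight _ _ _ _ _ lebesgue_measure (normal_prob 0 s)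
  id (normal_pdf 0 s) 1)//.
- by rewrite mul1e.
- exact: measurable_normal_pdf.
- by move=> x; exact: normal_pdf_ge0.
- by move=> A mA; rewrite mul1e.
Qed.

(** The integrand times the density of variance [s ^+ 2] is at most [sqrt 2] times the density of
    variance [2 s ^+ 2]; the factor is rounded up to 2. *)
Lemma normal_expR_sqr (s w : R) : 0 < s -> s ^+ 2 <= w ->
  (\int[normal_prob 0 s]_x (expR (x ^+ 2 / (4 * w)))%:E <= 2%:E)%E.
Proof.
move=> s0 sw.
have s20 : 0 < s ^+ 2 by rewrite exprn_gt0.
have w0 : 0 < w by apply: lt_le_trans sw.
have mexp : measurable_fun setT (fun x : R => expR (x ^+ 2 / (4 * w))).
  by apply: measurableT_comp => //; apply: measurable_funM => //; exact: measurable_funX.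
rewrite integral_normal_prob_density//.
pose t := Num.sqrt 2 * s.
have t0 : 0 < t by rewrite mulr_gt0// sqrtr_gt0.
have t2 : t ^+ 2 = 2 * s ^+ 2 by rewrite exprMn sqr_sqrtr.
have peak : normal_peak s <= 2 * normal_peak t.
  rewrite /normal_peak t2 -[leLHS]mulr1 -[X in _ * X](@mulfV _ (2 : R))//.
  rewrite [leLHS]mulrCA ler_wpM2l// -invfM lef_pV2.
  - rewrite -{2}(@ger0_norm _ (2 : R))// -sqrtr_sqr -sqrtrM; last first.
      by rewrite mulrn_wge0// mulr_ge0 ?pi_ge0// ltW.
    rewrite ler_wsqrtr//.
    have : 0 < s ^+ 2 * pi by rewrite mulr_gt0// pi_gt0.
    lra.
  - by rewrite posrE mulr_gt0// sqrtr_gt0 mulrn_wgt0// mulr_gt0 ?pi_gt0.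
  - by rewrite posrE sqrtr_gt0 mulrn_wgt0// mulr_gt0 ?pi_gt0// mulr_gt0.
apply: (@le_trans _ _ (\int[lebesgue_measure]_x (2%:E * (normal_pdf 0 t x)%:E))%E).
  apply: ge0_le_integral => //.
  - by move=> x _; rewrite lee_fin mulr_ge0 ?expR_ge0 ?normal_pdf_ge0.
  - apply/measurable_EFinP; apply: measurable_funM => //.
    exact: measurable_normal_pdf.
  - apply: measurable_funeM; apply/measurable_EFinP; exact: measurable_normal_pdf.
  - move=> x _; rewrite -EFinM lee_fin !normal_pdfE ?gt_eqF// mulrCA [leRHS]mulrA.
    apply: ler_pM; rewrite ?expR_ge0 ?normal_peak_ge0 ?mulr_ge0 ?expR_ge0//.
    rewrite /normal_fun -expRD ler_expR !subr0 t2 !mulNr.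
    have : x ^+ 2 / (4 * w) <= x ^+ 2 / (4 * s ^+ 2).
      by rewrite ler_wpM2l ?sqr_ge0// lef_pV2 ?posrE ?mulr_gt0// ler_wpM2l.
    have -> : x ^+ 2 / (s ^+ 2 *+ 2) = 2 * (x ^+ 2 / (4 * s ^+ 2)).
      by rewrite -mulr_natr; field; rewrite gt_eqF.
    have -> : x ^+ 2 / (2 * s ^+ 2 *+ 2) = x ^+ 2 / (4 * s ^+ 2).
      by rewrite -mulr_natr; field; rewrite gt_eqF.
    lra.
rewrite ge0_integralZl//.
- by rewrite integral_normal_pdf mule1.
- by apply/measurable_EFinP; exact: measurable_normal_pdf.
- by move=> x _; rewrite lee_fin normal_pdf_ge0.
Qed.

End normal_facts.

(** * Score functions of a direction *)

Section score_functions.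
Context {R : realType} {p m : nat}.
Implicit Types (V : 'M[R]_(p, m)) (x : p.-tuple R) (y : m.-tuple R).

Definition cx V x (k : 'I_m) : R := (V^T *m tcol x) k 0.
Definition sqx V x : R := \sum_k cx V x k ^+ 2.
Definition nrx V x : R := Num.sqrt (sqx V x).
(** [y] stands for the residual. Dividing by [sigma] makes this, for fixed [x], a centred normal
    variable of standard deviation [nrx V x]. *)
Definition blx (sigma : R) V x y : R := (\sum_k cx V x k * tnth y k) / sigma.
(** A seminorm in [V] that dominates both [|blx|] and [nrx], so that one quantity controls the
    passage to a nearby direction. *)
Definition scx (sigma : R) V x y : R := `|blx sigma V x y| + nrx V x.

Lemma cxE V x k : cx V x k = \sum_j V j k * tnth x j.
Proof. by rewrite /cx mxE; apply: eq_bigr => j _; rewrite !mxE. Qed.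

Lemma cx_col V x k : cx V x k = ((col k V)^T *m tcol x) 0 0.
Proof. by rewrite cxE mxE; apply: eq_bigr => j _; rewrite !mxE. Qed.

Lemma measurable_lin (v : 'cV[R]_p) :
  measurable_fun setT (fun x : p.-tuple R => (v^T *m tcol x) 0 0).
Proof.
under eq_fun do rewrite mxE.
apply: measurable_sum => j; under eq_fun do rewrite [tcol _ _ _]mxE.
by apply: measurable_funM => //; exact: measurable_tnth.
Qed.

Lemma measurable_cx V k : measurable_fun setT (fun x => cx V x k).
Proof.
under eq_fun do rewrite cx_col.
exact: measurable_lin.
Qed.

Lemma measurable_sqx V : measurable_fun setT (sqx V).
Proof.
by apply: measurable_sum => k; apply: measurable_funX; exact: measurable_cx.
Qed.

Lemma sqx_ge0 V x : 0 <= sqx V x.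
Proof. by apply: sumr_ge0 => k _; exact: sqr_ge0. Qed.

Lemma nrx_ge0 V x : 0 <= nrx V x.
Proof. exact: sqrtr_ge0. Qed.

Lemma nrx_sqr V x : nrx V x ^+ 2 = sqx V x.
Proof. by rewrite sqr_sqrtr// sqx_ge0. Qed.

Lemma measurable_nrx V : measurable_fun setT (nrx V).
Proof.
apply: measurableT_comp (measurable_sqx V).
exact: continuous_measurable_fun (@sqrt_continuous R).
Qed.

Lemma measurable_blx sigma V :
  measurable_fun setT (fun z : p.-tuple R * m.-tuple R => blx sigma V z.1 z.2).
Proof.
apply: measurable_funM => //; apply: measurable_sum => k.
apply: measurable_funM; first exact: measurableT_comp (measurable_cx V k) _.
exact: measurableT_comp (measurable_tnth _) _.
Qed.

Lemma measurable_scx sigma V :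
  measurable_fun setT (fun z : p.-tuple R * m.-tuple R => scx sigma V z.1 z.2).
Proof.
apply: measurable_funD; last exact: measurableT_comp (measurable_nrx V) _.
apply: measurableT_comp; first exact: normr_measurable.
exact: measurable_blx.
Qed.

Lemma cxD V W x k : cx (V + W) x k = cx V x k + cx W x k.
Proof. by rewrite /cx linearD/= mulmxDl mxE. Qed.

Lemma cxZ (a : R) V x k : cx (a *: V) x k = a * cx V x k.
Proof. by rewrite /cx linearZ/= -scalemxAl mxE. Qed.

Lemma blxD sigma V W x y : blx sigma (V + W) x y = blx sigma V x y + blx sigma W x y.
Proof.
rewrite /blx -mulrDl -big_split/=; congr (_ / _).
by apply: eq_bigr => k _; rewrite cxD mulrDl.
Qed.

Lemma blxZ sigma a V x y : blx sigma (a *: V) x y = a * blx sigma V x y.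
Proof.
rewrite /blx mulrA mulr_sumr; congr (_ / _).
by apply: eq_bigr => k _; rewrite cxZ mulrA.
Qed.

Lemma blxN sigma V x y : blx sigma (- V) x y = - blx sigma V x y.
Proof. by rewrite -scaleN1r blxZ mulN1r. Qed.

Lemma blxB sigma V W x y : blx sigma (V - W) x y = blx sigma V x y - blx sigma W x y.
Proof. by rewrite blxD blxN. Qed.

Lemma sqxZ a V x : sqx (a *: V) x = a ^+ 2 * sqx V x.
Proof.
by rewrite /sqx mulr_sumr; apply: eq_bigr => k _; rewrite cxZ exprMn.
Qed.

Lemma nrxZ a V x : nrx (a *: V) x = `|a| * nrx V x.
Proof. by rewrite /nrx sqxZ sqrtrM ?sqr_ge0// sqrtr_sqr. Qed.

Lemma nrxN V x : nrx (- V) x = nrx V x.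
Proof. by rewrite -scaleN1r nrxZ normrN1 mul1r. Qed.

Lemma sum_cauchy_schwarz (I : finType) (a b : I -> R) :
  (\sum_i a i * b i) ^+ 2 <= (\sum_i a i ^+ 2) * (\sum_i b i ^+ 2).
Proof.
set A := \sum_i a i ^+ 2; set C := \sum_i b i ^+ 2; set S := \sum_i a i * b i.
have A0 : 0 <= A by apply: sumr_ge0 => i _; exact: sqr_ge0.
have q t : 0 <= A * t ^+ 2 - 2 * t * S + C.
  have : 0 <= \sum_i (a i * t - b i) ^+ 2 by apply: sumr_ge0 => i _; exact: sqr_ge0.
  suff -> : \sum_i (a i * t - b i) ^+ 2 = A * t ^+ 2 - 2 * t * S + C by [].
  rewrite /A /C /S mulr_suml mulr_sumr -sumrB -big_split/=.
  by apply: eq_bigr => i _; ring.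
have [A00|An0] := eqVneq A 0.
  have a0 i : a i = 0.
    move: A00 => /eqP; rewrite psumr_eq0; last by move=> j _; exact: sqr_ge0.
    by move=> /allP/(_ i (mem_index_enum _)); rewrite sqrf_eq0 => /eqP.
  have -> : S = 0 by rewrite /S big1// => i _; rewrite a0 mul0r.
  by rewrite A00 mul0r expr0n.
have := q (S / A); have Ap : 0 < A by rewrite lt_def An0.
have -> : A * (S / A) ^+ 2 - 2 * (S / A) * S + C = (A * C - S ^+ 2) / A by field.
by rewrite pmulr_lge0 ?invr_gt0// subr_ge0.
Qed.

Lemma nrxD V W x : nrx (V + W) x <= nrx V x + nrx W x.
Proof.
rewrite -(ler_pXn2r (_ : 0 < 2)%N)// ?nnegrE ?addr_ge0 ?nrx_ge0//.
rewrite sqrrD !nrx_sqr.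
have -> : sqx (V + W) x = sqx V x + 2 * (\sum_k cx V x k * cx W x k) + sqx W x.
  rewrite /sqx mulr_sumr -!big_split/=; apply: eq_bigr => k _.
  by rewrite cxD; ring.
rewrite lerD2r lerD2l -[(_ * _) *+ 2]mulr_natl ler_wpM2l//.
apply: le_trans (ler_norm _) _; rewrite -sqrtr_sqr /nrx -sqrtrM ?sqx_ge0//.
by rewrite ler_wsqrtr// sum_cauchy_schwarz.
Qed.

Lemma blx_nrx0 sigma V x y : nrx V x = 0 -> blx sigma V x y = 0.
Proof.
move=> n0; have : sqx V x = 0 by rewrite -nrx_sqr n0 expr0n.
move=> /eqP; rewrite psumr_eq0; last by move=> k _; exact: sqr_ge0.
move=> /allP H; rewrite /blx big1 ?mul0r// => k _.
by have := H k (mem_index_enum _); rewrite sqrf_eq0 => /eqP ->; rewrite mul0r.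
Qed.

Lemma scx_ge0 sigma V x y : 0 <= scx sigma V x y.
Proof. by rewrite addr_ge0 ?nrx_ge0. Qed.

Lemma scxD sigma V W x y : scx sigma (V + W) x y <= scx sigma V x y + scx sigma W x y.
Proof.
by rewrite /scx addrACA lerD ?nrxD// blxD ler_normD.
Qed.

Lemma scxZ sigma a V x y : scx sigma (a *: V) x y = `|a| * scx sigma V x y.
Proof. by rewrite /scx blxZ nrxZ normrM mulrDr. Qed.

End score_functions.

Lemma integral_law (R : realType) (d d' : measure_display)
    (Omega : measurableType d) (T : measurableType d')
    (P : {measure set Omega -> \bar R}) (mu : {measure set T -> \bar R})
    (phi : Omega -> T) (f : T -> R) :
  measurable_fun setT phi ->
  (forall A, measurable A -> P (phi @^-1` A) = mu A) ->
  measurable_fun setT f -> (forall x, 0 <= f x) ->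
  (\int[P]_w (f (phi w))%:E = \int[mu]_x (f x)%:E)%E.
Proof.
move=> mphi H mf f0.
have mpre A : measurable A -> measurable (phi @^-1` A).
  by move=> mA; rewrite -[X in measurable X]setTI; exact: mphi.
rewrite -[RHS]mul1e.
rewrite -(@ge0_integral_comp_weight _ _ _ _ _ P mu phi (cst 1) 1)//.
  by apply: eq_integral => w _; rewrite mulr1.
move=> A mA; transitivity (\int[P]_(w in phi @^-1` A) (cst 1%E w))%E.
  exact: eq_integral.
by rewrite integral_cst ?mul1e; [exact: H|exact: mpre].
Qed.

Section quadratic_form.
Context {R : realType} {p m : nat}.
Implicit Types (V : 'M[R]_(p, m)).

(** The second moment of [|V^T X|], and the loss of the theorem at [V = Bh - B]. It is a squared
    seminorm, degenerate for singular [Sigma]. *)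
Definition qn (Sigma : 'M[R]_p) V : R := \tr (V^T *m Sigma *m V).

Lemma qn_col Sigma V :
  qn Sigma V = \sum_k ((col k V)^T *m Sigma *m col k V) 0 0.
Proof.
apply: eq_bigr => k _; rewrite !mxE; apply: eq_bigr => j _.
rewrite [in RHS]mxE; congr (_ * _); rewrite !mxE//.
by apply: eq_bigr => i _; rewrite !mxE.
Qed.

Lemma qnZ Sigma a V : qn Sigma (a *: V) = a ^+ 2 * qn Sigma V.
Proof.
rewrite /qn (_ : (a *: V)^T = a *: V^T); last by apply/matrixP => i j; rewrite !mxE.
by rewrite -scalemxAr -!scalemxAl scalerA mxtraceZ expr2.
Qed.

Lemma qn_gram (L : 'M[R]_p) V :
  qn (L *m L^T) V = \sum_(i : 'I_p * 'I_m) (L^T *m V) i.1 i.2 ^+ 2.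
Proof.
rewrite /qn (_ : V^T *m (L *m L^T) *m V = (L^T *m V)^T *m (L^T *m V)); last first.
  by rewrite trmx_mul trmxK !mulmxA.
rewrite -(pair_bigA _ (fun i j => (L^T *m V) i j ^+ 2))/= exchange_big/=.
apply: eq_bigr => k _; rewrite mxE; apply: eq_bigr => i _.
by rewrite [in LHS]mxE expr2.
Qed.

End quadratic_form.

Section model.
Context {R : realType} {p m : nat}.
Variables (Sigma : 'M[R]_p) (B : 'M[R]_(p, m)) (sigma : R)
  (PB : probability (Obs R p m) R).
Hypotheses (sigma0 : 0 < sigma) (covS : covariance_matrix Sigma)
  (HPB : is_PB Sigma B sigma PB).
Implicit Types (V : 'M[R]_(p, m)) (z : Obs R p m).

Lemma measurable_resid : measurable_fun setT (fun z : Obs R p m => resid B z).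
Proof.
apply/measurable_fun_tnthP => k.
rewrite (_ : _ \o _ = fun z => tnth z.2 k - cx B z.1 k).
  apply: measurable_funB; first exact: measurableT_comp (measurable_tnth _) _.
  exact: measurableT_comp (measurable_cx _ _) _.
by apply/funext => z; rewrite /= /resid /cx tnth_mktuple !mxE.
Qed.

Lemma measurable_decoupled_pair :
  measurable_fun setT (fun z : Obs R p m => (z.1, resid B z)).
Proof. by apply: measurable_fun_pair => //; exact: measurable_resid. Qed.

(* The noise is independent of the design, so it may be drawn from a fresh copy
   of the observation. *)
Lemma decouple (F : p.-tuple R * m.-tuple R -> R) :
  measurable_fun setT F -> (forall u, 0 <= F u) ->
  (\int[PB]_z (F (z.1, resid B z))%:E =
   \int[PB]_z \int[PB]_z' (F (z.1, resid B z'))%:E)%E.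
Proof.
move=> mF F0; have [_ _ ind] := HPB.
pose fX : {mfun Obs R p m >-> p.-tuple R} :=
  mfun_Sub (mem_set (measurable_fst : measurable_fun setT (fst : Obs R p m -> _))).
pose fY : {mfun Obs R p m >-> m.-tuple R} := mfun_Sub (mem_set measurable_resid).
pose fXY : {mfun Obs R p m >-> (p.-tuple R * m.-tuple R)%type} :=
  mfun_Sub (mem_set measurable_decoupled_pair).
pose muX := distribution PB fX; pose muY := distribution PB fY.
have joint A : measurable A ->
    PB ((fun z : Obs R p m => (z.1, resid B z)) @^-1` A) = (muX \x muY)%E A.
  (* A finite measure on the product is determined by rectangles, where the independence clause of
     [is_PB] factorizes it. *)
  move=> mA; rewrite (@product_measure_unique _ _ _ _ _ muX muY (distribution PB fXY))//.
rewrite (integral_law _ _ _ _ _ _ (muX \x muY)%E _ _ measurable_decoupled_pair joint mF F0).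
have mEF : measurable_fun setT (EFin \o F) by exact/measurable_EFinP.
have EF0 : forall u, (0 <= (EFin \o F) u)%E by move=> u; rewrite lee_fin.
rewrite (@fubini_tonelli1 _ _ _ _ _ muX muY _ mEF EF0).
rewrite /muX /distribution ge0_integral_pushforward//; last 2 first.
- exact: measurable_fun_fubini_tonelli_F.
- by move=> x _; apply: integral_ge0 => y _; exact: EF0.
rewrite preimage_setT; apply: eq_integral => z _ /=.
rewrite /fubini_F; apply/esym.
apply: (integral_law _ _ _ _ _ PB muY _ (fun y => F (z.1, y)) measurable_resid) => //.
exact: measurableT_comp mF (measurable_pair1 _).
Qed.

End model.

Lemma measure_le_integral (R : realType) (d : measure_display)
    (T : measurableType d) (P : probability T R) (A : set T) (f : T -> R) :
  measurable A -> measurable_fun setT f -> (forall x, \1_A x <= f x) ->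
  (P A <= \int[P]_x (f x)%:E)%E.
Proof.
move=> mA mf Af; rewrite -[X in (P X <= _)%E]setIT -integral_indic//.
apply: ge0_le_integral => //.
- by apply/measurable_EFinP; exact: measurable_indic.
- exact/measurable_EFinP.
- by move=> x _; rewrite lee_fin.
Qed.

Section model_laws.
Context {R : realType} {p m : nat}.
Variables (Sigma : 'M[R]_p) (B : 'M[R]_(p, m)) (sigma : R)
  (PB : probability (Obs R p m) R).
Hypotheses (sigma0 : 0 < sigma) (covS : covariance_matrix Sigma)
  (HPB : is_PB Sigma B sigma PB).
Implicit Types (V : 'M[R]_(p, m)) (z : Obs R p m).

Lemma law_design (v : 'cV[R]_p) (A : set R) : measurable A ->
  PB ((fun z => (v^T *m tcol z.1) 0 0) @^-1` A) =
  gauss1 0 ((v^T *m Sigma *m v) 0 0) A.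
Proof. by move=> mA; have [+ _ _] := HPB => /(_ v A mA); rewrite mulmx0 mxE. Qed.

Lemma measurable_design (v : 'cV[R]_p) :
  measurable_fun setT (fun z : Obs R p m => (v^T *m tcol z.1) 0 0).
Proof. exact: measurableT_comp (measurable_lin v) _. Qed.

Lemma abs_le_preimage (T : Type) (f : T -> R) (u : R) :
  [set z | `|f z| <= u] = f @^-1` `[- u, u].
Proof. by apply/seteqP; split => z /=; rewrite in_itv/= ler_norml. Qed.

Lemma design_small_ball (v : 'cV[R]_p) (u : R) :
  0 < (v^T *m Sigma *m v) 0 0 -> 0 <= u ->
  (PB [set z | (`|(v^T *m tcol z.1) 0 0| <= u)%R]
    <= (u / Num.sqrt ((v^T *m Sigma *m v) 0 0))%:E)%E.
Proof.
move=> w0 u0; rewrite abs_le_preimage law_design// /gauss1 gt_eqF//.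
by apply: normal_prob_itv_le => //; rewrite sqrtr_gt0.
Qed.

(** The level [w] is only an upper bound for the variance, so that a column of zero variance, whose
    law is a Dirac mass, can be given a positive level. *)
Lemma design_expR_sqr (v : 'cV[R]_p) (w : R) :
  (v^T *m Sigma *m v) 0 0 <= w -> 0 < w ->
  (\int[PB]_z (expR ((v^T *m tcol z.1) 0 0 ^+ 2 / (4 * w)))%:E <= 2%:E)%E.
Proof.
move=> vw w0; have vv0 := covS.2 v.
have mexp : measurable_fun setT (fun x : R => expR (x ^+ 2 / (4 * w))).
  by apply: measurableT_comp => //; apply: measurable_funM => //; exact: measurable_funX.
have [v0|vn0] := eqVneq ((v^T *m Sigma *m v) 0 0) 0.
  rewrite (integral_law _ _ _ _ _ PB (\d_(0 : R)) _ (fun x => expR (x ^+ 2 / (4 * w)))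
    (measurable_design v))//.
    rewrite integral_dirac//; last exact/measurable_EFinP.
    by rewrite diracT mul1e expr0n/= mul0r expR0 lee_fin; lra.
  by move=> A mA; apply: etrans (law_design v A mA) _; rewrite /gauss1 v0 eqxx.
rewrite (integral_law _ _ _ _ _ PB
    (normal_prob 0 (Num.sqrt ((v^T *m Sigma *m v) 0 0))) _
    (fun x => expR (x ^+ 2 / (4 * w))) (measurable_design v))//.
  apply: normal_expR_sqr; first by rewrite sqrtr_gt0 lt_def vn0.
  by rewrite sqr_sqrtr.
move=> A mA; apply: etrans (law_design v A mA) _.
by rewrite /gauss1 (negPf vn0).
Qed.

Lemma measurable_blx_resid V x :
  measurable_fun setT (fun z => blx sigma V x (resid B z)).
Proof.
have H := measurableT_comp (measurable_blx sigma V)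
  (measurableT_comp (measurable_pair1 x) (measurable_resid B)).
exact: H.
Qed.

(** For a frozen design the score is the linear functional of the noise with coefficients
    [cx V x k / sigma]. *)
Lemma law_blx V (x : p.-tuple R) (A : set R) : nrx V x != 0 -> measurable A ->
  PB ((fun z => blx sigma V x (resid B z)) @^-1` A) = normal_prob 0 (nrx V x) A.
Proof.
move=> n0 mA; have [_ + _] := HPB.
move=> /(_ (sigma^-1 *: (\col_k cx V x k)) A mA).
have sn0 : sigma != 0 by rewrite gt_eqF.
have -> : ((sigma^-1 *: (\col_k cx V x k))^T *m (sigma ^+ 2)%:M *m
    (sigma^-1 *: (\col_k cx V x k))) 0 0 = nrx V x ^+ 2.
  rewrite mul_mx_scalar -scalemxAl !mxE nrx_sqr mulr_sumr; apply: eq_bigr => k _.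
  by rewrite !mxE; field.
rewrite mulmx0 mxE /gauss1 sqrf_eq0 (negPf n0) sqrtr_sqr ger0_norm ?nrx_ge0// => <-.
congr (PB _); apply/seteqP; split => z /=; congr A.
  rewrite /blx mxE mulr_suml; apply: eq_bigr => k _; rewrite !mxE; ring.
rewrite /blx mxE mulr_suml; apply: eq_bigr => k _; rewrite !mxE; ring.
Qed.

Lemma decouple_set (E : set (p.-tuple R * m.-tuple R)) : measurable E ->
  (PB ((fun z => (z.1, resid B z)) @^-1` E) =
   \int[PB]_z PB [set z' | E (z.1, resid B z')])%E.
Proof.
move=> mE.
have mpre : measurable ((fun z : Obs R p m => (z.1, resid B z)) @^-1` E).
  rewrite -[X in measurable X]setTI; exact: (measurable_decoupled_pair B).
rewrite -[X in PB X]setIT -[LHS]integral_indic//.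
transitivity (\int[PB]_z (\1_E (z.1, resid B z))%:E)%E.
  apply: eq_integral => z _; rewrite !indicE; congr (_%:R%:E).
have := @decouple _ _ _ Sigma B sigma PB HPB (\1_E) (measurable_indic mE) _.
move=> ->; last by move=> u; rewrite indicE.
apply: eq_integral => z _.
have mz : measurable [set z' | E (z.1, resid B z')].
  rewrite -[X in measurable X]setTI.
  have H := measurableT_comp (measurable_pair1 z.1) (measurable_resid B).
  exact: H.
rewrite -[X in PB X]setIT -[RHS]integral_indic//.
Qed.
End model_laws.

Lemma measurable_preimage_itv (R : realType) (d : measure_display)
    (T : measurableType d) (f : T -> R) (i : interval R) :
  measurable_fun setT f -> measurable (f @^-1` [set` i]).
Proof.
by move=> mf; rewrite -[X in measurable X]setTI; apply: mf => //; exact: measurable_itv.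
Qed.

Lemma measurable_le_cst (R : realType) (d : measure_display)
    (T : measurableType d) (f : T -> R) (c : R) :
  measurable_fun setT f -> measurable [set x | f x <= c].
Proof.
move=> mf; have -> : [set x | f x <= c] = f @^-1` `]-oo, c].
  by apply/seteqP; split => x /=; rewrite in_itv.
exact: measurable_preimage_itv.
Qed.

Lemma measurable_gt_cst (R : realType) (d : measure_display)
    (T : measurableType d) (f : T -> R) (c : R) :
  measurable_fun setT f -> measurable [set x | c < f x].
Proof.
move=> mf; have -> : [set x | c < f x] = f @^-1` `]c, +oo[.
  by apply/seteqP; split => x /=; rewrite in_itv/= andbT.
exact: measurable_preimage_itv.
Qed.

(** * Small balls and symmetry of the score *)

Section model_estimates.
Context {R : realType} {p m : nat}.
Variables (Sigma : 'M[R]_p) (B : 'M[R]_(p, m)) (sigma : R)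
  (PB : probability (Obs R p m) R).
Hypotheses (sigma0 : 0 < sigma) (covS : covariance_matrix Sigma)
  (HPB : is_PB Sigma B sigma PB).
Implicit Types (V : 'M[R]_(p, m)) (z : Obs R p m).

Definition bl V z := blx sigma V z.1 (resid B z).
Definition nr V z := nrx V z.1.
Definition sc V z := scx sigma V z.1 (resid B z).

Lemma measurable_bl V : measurable_fun setT (bl V).
Proof. exact: measurableT_comp (measurable_blx sigma V) (measurable_decoupled_pair B). Qed.

Lemma measurable_nr V : measurable_fun setT (nr V).
Proof. exact: measurableT_comp (measurable_nrx V) _. Qed.

Lemma measurable_sc V : measurable_fun setT (sc V).
Proof. exact: measurableT_comp (measurable_scx sigma V) (measurable_decoupled_pair B). Qed.

(* No rotation of the coordinates is needed: the columns [k] violating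
   [q^2 w_k < |V^T x|_k^2] carry variance at most [q^2]. *)
Lemma nr_small_ball V (q : R) : qn Sigma V = 1 -> 0 < q <= 1 ->
  (PB [set z | (nr V z <= q ^+ 2)%R] <= (2 * q)%:E)%E.
Proof.
move=> V1 /andP[q0 q1].
pose w k := ((col k V)^T *m Sigma *m col k V) 0 0.
have w0 k : 0 <= w k by exact: covS.2.
have w1 : \sum_k w k = 1 by rewrite -V1 qn_col.
pose A k := [set z : Obs R p m | `|((col k V)^T *m tcol z.1) 0 0| <= q * Num.sqrt (w k)].
have mA k : measurable (A k).
  apply: measurable_le_cst; apply: measurableT_comp; first exact: normr_measurable.
  exact: measurable_design.
have mI k : measurable_fun setT (fun z => w k * \1_(A k) z).
  by apply: measurable_funM => //; exact: measurable_indic.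
apply: (@le_trans _ _ (\int[PB]_z (q ^+ 2 + \sum_k w k * \1_(A k) z)%:E)%E).
  apply: measure_le_integral.
  - by apply: measurable_le_cst; exact: measurable_nr.
  - by apply: measurable_funD => //; exact: measurable_sum.
  - move=> z; rewrite indicE; case: (boolP (z \in _)) => [|_]; last first.
      by rewrite addr_ge0 ?sqr_ge0// sumr_ge0// => k _; rewrite mulr_ge0.
    rewrite inE/= => nq.
    have sq : sqx V z.1 <= q ^+ 4.
      rewrite -nrx_sqr (_ : 4 = 2 * 2)%N// exprM ler_pXn2r// nnegrE.
        exact: nrx_ge0.
      exact: sqr_ge0.
    (* If [nr V z <= q ^+ 2], the columns outside [A k], where the squared coordinate exceeds
       [q ^+ 2 * w k], have total variance at most [q ^+ 4 / q ^+ 2]. The rest is carried inside,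
       where the mean of the variance carried is at most [q]. *)
    suff : \sum_k w k - \sum_k w k * \1_(A k) z <= q ^+ 2 by rewrite w1; lra.
    rewrite -sumrB -(ler_pM2l (exprn_gt0 2 q0)) -exprD mulr_sumr.
    apply: le_trans sq; apply: ler_sum => k _; rewrite indicE.
    case: (boolP (z \in A k)) => [_|]; first by rewrite mulr1 subrr mulr0 sqr_ge0.
    move=> /negP; rewrite inE /A /= => /negP; rewrite -ltNge => H.
    rewrite mulr0 subr0 cx_col -[leRHS]real_normK ?num_real//.
    rewrite -[w k]sqr_sqrtr// -exprMn ler_pXn2r ?nnegrE ?mulr_ge0 ?sqrtr_ge0 ?(ltW q0)//.
    exact: ltW.
under eq_integral do rewrite EFinD -sumEFin.
rewrite ge0_integralD//; last 3 first.
- by move=> z _; rewrite lee_fin sqr_ge0.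
- by move=> z _; apply: sume_ge0 => k _; rewrite lee_fin mulr_ge0.
- by apply: emeasurable_sum => k; exact/measurable_EFinP.
rewrite integral_cst_probability ge0_integral_sum//; last first.
- by move=> k z _; rewrite lee_fin mulr_ge0.
- by move=> k; exact/measurable_EFinP.
apply: (@le_trans _ _ ((q ^+ 2)%:E + \sum_k (w k * q)%:E)%E).
  rewrite leeD2l//; apply: lee_sum => k _.
  under eq_integral do rewrite EFinM.
  rewrite ge0_integralZl//; last 2 first.
    by apply/measurable_EFinP; exact: measurable_indic.
    by rewrite lee_fin.
  rewrite integral_indic// setIT EFinM.
  have [->|wk0] := eqVneq (w k) 0; first by rewrite !mul0e.
  apply: lee_wpmul2l; first by rewrite lee_fin.
  apply: le_trans (design_small_ball _ _ _ _ HPB (col k V) _ _ _) _.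
  - by rewrite lt_def wk0 w0.
  - by rewrite mulr_ge0 ?sqrtr_ge0// ltW.
  - by rewrite lee_fin -mulrA divff ?mulr1// gt_eqF// sqrtr_gt0 lt_def wk0 w0.
rewrite sumEFin -EFinD lee_fin -mulr_suml w1 mul1r.
have : q ^+ 2 <= q by rewrite expr2 ler_piMr// ltW.
lra.
Qed.

Lemma measurable_decoupled_section (E : set (p.-tuple R * m.-tuple R)) :
  measurable E ->
  measurable_fun setT (fun z : Obs R p m => PB [set z' | E (z.1, resid B z')]).
Proof.
move=> mE.
pose fY : {mfun Obs R p m >-> m.-tuple R} := mfun_Sub (mem_set (measurable_resid B)).
have H := measurable_fun_xsection (distribution PB fY) mE.
have mfst : measurable_fun setT (fst : Obs R p m -> p.-tuple R) by [].
have := measurableT_comp H mfst.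
apply: eq_measurable_fun => z _ /=; congr (PB _).
by apply/seteqP; split => z' /=; rewrite /xsection/= inE.
Qed.

(** The exponent is 2 + 1: either the design norm is at most [q ^+ 2], with probability at most
    [2 q], or the conditional standard deviation exceeds [q ^+ 2] and the normal law gives the
    interval at most [q ^+ 3 / q ^+ 2]. *)
Lemma bl_small_ball V (q : R) : qn Sigma V = 1 -> 0 < q <= 1 ->
  (PB [set z | (`|bl V z| <= q ^+ 3)%R] <= (3 * q)%:E)%E.
Proof.
move=> V1 q01; have /andP[q0 q1] := q01.
have mE : measurable [set u : p.-tuple R * m.-tuple R | `|blx sigma V u.1 u.2| <= q ^+ 3].
  apply: measurable_le_cst; apply: measurableT_comp; first exact: normr_measurable.
  exact: measurable_blx.
have mN : measurable [set z : Obs R p m | nr V z <= q ^+ 2].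
  by apply: measurable_le_cst; exact: measurable_nr.
rewrite (_ : [set z | _] = (fun z : Obs R p m => (z.1, resid B z)) @^-1`
  [set u : p.-tuple R * m.-tuple R | `|blx sigma V u.1 u.2| <= q ^+ 3])//.
rewrite (decouple_set _ _ _ _ HPB)//.
apply: (@le_trans _ _ (\int[PB]_z (\1_[set z : Obs R p m | nr V z <= q ^+ 2] z + q)%:E)%E).
  apply: ge0_le_integral => //.
  - exact: measurable_decoupled_section.
  - apply/measurable_EFinP; apply: measurable_funD => //; exact: measurable_indic.
  - move=> z _ /=; rewrite indicE; case: (boolP (z \in _)) => [_|].
      apply: (@le_trans _ _ 1%E); last by rewrite lee_fin lerDl ltW.
      apply: probability_le1; apply: measurable_le_cst.
      apply: measurableT_comp; first exact: normr_measurable.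
      exact: measurable_blx_resid.
    move=> /negP; rewrite inE/= => /negP; rewrite -ltNge /nr => nq.
    have n0 : 0 < nrx V z.1 by apply: le_lt_trans nq; rewrite sqr_ge0.
    rewrite abs_le_preimage (law_blx _ _ _ _ sigma0 HPB) ?gt_eqF//.
    apply: le_trans (normal_prob_itv_le _ _ n0 _) _; first by rewrite exprn_ge0// ltW.
    rewrite lee_fin add0r ler_pdivrMr// exprS ler_wpM2l//; exact: ltW.
under eq_integral do rewrite EFinD.
rewrite ge0_integralD//; last 2 first.
- by apply/measurable_EFinP; exact: measurable_indic.
- by move=> z _; rewrite lee_fin ltW.
rewrite integral_cst_probability integral_indic// setIT.
apply: (@le_trans _ _ ((2 * q)%:E + q%:E)%E).
  by rewrite leeD2r// nr_small_ball.
by rewrite -EFinD lee_fin; lra.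
Qed.

Lemma bl_gt0_opp V : PB [set z | 0 < bl V z] = PB [set z | bl V z < 0].
Proof.
have mpos W : measurable [set u : p.-tuple R * m.-tuple R | 0 < blx sigma W u.1 u.2].
  by apply: measurable_gt_cst; exact: measurable_blx.
have H W : PB [set z | 0 < bl W z] = (\int[PB]_z
    PB [set z' | (0 < blx sigma W z.1 (resid B z'))%R])%E.
  by have := decouple_set _ _ _ _ HPB _ (mpos W).
have -> : [set z | bl V z < 0] = [set z | 0 < bl (- V) z].
  by apply/seteqP; split => z /=; rewrite /bl blxN oppr_gt0.
rewrite !H; apply: eq_integral => z _.
have [n0|n0] := eqVneq (nrx V z.1) 0.
  congr (PB _); apply/seteqP; split => z' /=; rewrite blx_nrx0 ?ltxx//.
  by rewrite nrxN.
have E W : nrx W z.1 != 0 -> PB [set z' | 0 < blx sigma W z.1 (resid B z')] =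
    normal_prob 0 (nrx W z.1) `]0, +oo[.
  move=> Wn; rewrite -(law_blx _ _ _ _ sigma0 HPB)//; congr (PB _).
  by apply/seteqP; split => z' /=; rewrite in_itv/= andbT.
by rewrite !E ?nrxN.
Qed.

(** Both signs have equal mass by symmetry of the noise, and no mass sits at zero because the
    small-ball bound holds for every [q]. *)
Lemma bl_half V : qn Sigma V = 1 -> PB [set z | 0 < bl V z] = (2^-1)%:E.
Proof.
move=> V1.
have mpos : measurable [set z | 0 < bl V z].
  by apply: measurable_gt_cst; exact: measurable_bl.
have mneg : measurable [set z | bl V z < 0].
  rewrite (_ : [set z | bl V z < 0] = [set z | 0 < bl (- V) z]); last first.
    by apply/seteqP; split => z /=; rewrite /bl blxN oppr_gt0.
  by apply: measurable_gt_cst; exact: measurable_bl.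
have mabs (r : R) : measurable [set z | `|bl V z| <= r].
  apply: measurable_le_cst; apply: measurableT_comp; first exact: normr_measurable.
  exact: measurable_bl.
have [a aE] : exists a, PB [set z | 0 < bl V z] = a%:E.
  by exists (fine (PB [set z | 0 < bl V z])); rewrite fineK// fin_num_measure.
have aE' : PB [set z | bl V z < 0] = a%:E by rewrite -bl_gt0_opp.
have dsj : [set z | 0 < bl V z] `&` [set z | bl V z < 0] = set0.
  by apply/seteqP; split => z //= -[h1 h2]; have := lt_trans h1 h2; rewrite ltxx.
have U : PB ([set z | 0 < bl V z] `|` [set z | bl V z < 0]) = (a + a)%:E.
  by rewrite EFinD -{1}aE -aE'; exact: measureU.
have up : a + a <= 1.
  by rewrite -lee_fin -U; apply: probability_le1; exact: measurableU.
have lo (q : R) : 0 < q <= 1 -> 1 <= a + a + 3 * q.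
  move=> q01; rewrite -lee_fin EFinD -U.
  apply: (@le_trans _ _ (PB (([set z | 0 < bl V z] `|` [set z | bl V z < 0]) `|`
      [set z | `|bl V z| <= q ^+ 3]))).
    rewrite (_ : _ `|` _ = setT).
      by rewrite le_eqVlt; apply/orP; left; apply/eqP/esym; exact: probability_setT.
    apply/seteqP; split => z //= _.
    have [h|h|h] := ltgtP 0 (bl V z); [by left; left|by left; right|right].
    rewrite /= -h normr0 exprn_ge0//; have /andP[] := q01; lra.
  apply: le_trans (measureU2 _ _ _) _ => //; first exact: measurableU.
  by rewrite leeD2l// bl_small_ball.
rewrite aE; congr (_%:E).
have : a + a >= 1.
  rewrite leNgt; apply/negP => lt1.
  (* If the two signs missed some mass, this [q] would account for only half of the deficit. *)
  have := lo ((1 - (a + a)) / 6); rewrite (_ : 0 < _ <= 1); first by move/(_ isT); lra.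
  have a0 : 0 <= a by rewrite -lee_fin -aE measure_ge0.
  apply/andP; split; lra.
lra.
Qed.

(** Jensen's inequality with the missing weight placed at 0, from the tangent at the mean [yb]. *)
Lemma expR_convex_sum (I : finType) (a y : I -> R) :
  (forall i, 0 <= a i) -> \sum_i a i <= 1 ->
  expR (\sum_i a i * y i) <= 1 - \sum_i a i + \sum_i a i * expR (y i).
Proof.
move=> a0 a1; set yb := \sum_i a i * y i; set A := \sum_i a i in a1 *.
have H i : a i * (expR yb * (1 + (y i - yb))) <= a i * expR (y i).
  rewrite ler_wpM2l// -[in leRHS](subrKC yb (y i)) expRD ler_wpM2l ?expR_ge0//.
  exact: expR_ge1Dx.
have H1 : expR yb * (1 - yb) <= 1.
  have := expR_ge1Dx (- yb); rewrite expRN => H2.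
  by rewrite -[leRHS](@mulfV _ (expR yb)) ?gt_eqF ?expR_gt0// ler_wpM2l ?expR_ge0.
have H2 : \sum_i a i * (expR yb * (1 + (y i - yb))) =
    expR yb * (A + yb - A * yb).
  have -> : A + yb - A * yb = \sum_i (a i + a i * y i - a i * yb).
    by rewrite sumrB big_split/= -mulr_suml.
  rewrite mulr_sumr.
  by apply: eq_bigr => i _; ring.
have H3 : expR yb * (A + yb - A * yb) <= \sum_i a i * expR (y i).
  by rewrite -H2; apply: ler_sum => i _; exact: H.
have : (1 - A) * (expR yb * (1 - yb)) <= (1 - A) * 1 by rewrite ler_wpM2l// subr_ge0.
move: H3; set S := \sum_i _; lra.
Qed.

(** The coordinates of [V^T X] are dependent; Jensen's inequality over the columns reduces the claim
    to their marginals. *)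
Lemma nr_expR_sqr V : (0 < m)%N -> qn Sigma V <= 1 ->
  (\int[PB]_z (expR (nr V z ^+ 2 / 8))%:E <= 2%:E)%E.
Proof.
move=> m0 V1.
have m0' : 0 < m%:R :> R by rewrite ltr0n.
(* Adding [1 / m] keeps every level positive and raises the sum by only 1, so the weights [w k / 2]
   sum to at most 1. *)
pose w k := ((col k V)^T *m Sigma *m col k V) 0 0 + m%:R^-1.
have w00 k : 0 <= ((col k V)^T *m Sigma *m col k V) 0 0 by exact: covS.2.
have w0 k : 0 < w k.
  rewrite ltr_wpDl ?invr_gt0//.
have sw : \sum_k w k / 2 <= 1.
  rewrite -mulr_suml ler_pdivrMr// mul1r big_split/= -qn_col sumr_const card_ord.
  by rewrite -(mulr_natr (m%:R^-1)) mulVf ?gt_eqF//; lra.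
pose g k z := expR (((col k V)^T *m tcol z.1) 0 0 ^+ 2 / (4 * w k)).
have mg k : measurable_fun setT (g k : Obs R p m -> R).
  apply: measurableT_comp => //; apply: measurable_funM => //.
  by apply: measurable_funX; exact: measurable_design.
have g0 k z : 0 <= g k z by exact: expR_ge0.
have mwg k : measurable_fun setT (fun z : Obs R p m => (w k / 2 * g k z)%:E).
  by apply/measurable_EFinP; exact: measurable_funM.
have wg0 k z : 0 <= w k / 2 * g k z by rewrite mulr_ge0// divr_ge0// ltW.
apply: (@le_trans _ _ (\int[PB]_z ((1 - \sum_k w k / 2)%:E +
    \sum_k (w k / 2 * g k z)%:E))%E).
  apply: ge0_le_integral => //.
  - apply/measurable_EFinP; apply: measurableT_comp => //.
    by apply: measurable_funM => //; apply: measurable_funX; exact: measurable_nr.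
  - apply: emeasurable_funD => //; exact: emeasurable_sum.
  - move=> z _; rewrite sumEFin -EFinD lee_fin.
    apply: le_trans (expR_convex_sum _ _ _ _ _) => //; last first.
      by move=> k; rewrite divr_ge0// ltW.
    rewrite ler_expR /nr nrx_sqr mulr_suml; apply: ler_sum => k _.
    rewrite cx_col le_eqVlt; apply/orP; left; apply/eqP; field.
    by rewrite gt_eqF.
rewrite ge0_integralD//; last 3 first.
- by move=> z _; rewrite lee_fin subr_ge0.
- by move=> z _; apply: sume_ge0 => k _; rewrite lee_fin.
- exact: emeasurable_sum.
rewrite integral_cst_probability ge0_integral_sum//; last first.
  by move=> k z _; rewrite lee_fin.
apply: (@le_trans _ _ ((1 - \sum_k w k / 2)%:E + \sum_k (w k / 2 * 2)%:E)%E).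
  rewrite leeD2l//; apply: lee_sum => k _.
  under eq_integral do rewrite EFinM.
  rewrite ge0_integralZl//; last 3 first.
  - exact/measurable_EFinP.
  - by move=> z _; rewrite lee_fin.
  - by rewrite lee_fin divr_ge0// ltW.
  rewrite [leRHS]EFinM lee_wpmul2l// ?lee_fin ?divr_ge0 ?(ltW (w0 k))//.
  by apply: (design_expR_sqr _ _ _ _ covS HPB) => //; rewrite lerDl invr_ge0 ltW.
rewrite sumEFin -EFinD lee_fin -[X in _ + X]mulr_suml; lra.
Qed.

End model_estimates.

Lemma expR_half_add (R : realType) (a b : R) :
  expR ((a + b) / 2) <= (expR a + expR b) / 2.
Proof.
have -> : (a + b) / 2 = a / 2 + b / 2 by lra.
have sq (x : R) : expR x = expR (x / 2) ^+ 2.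
  by rewrite -expRM_natl; congr expR; lra.
rewrite expRD (sq a) (sq b).
have : 0 <= (expR (a / 2) - expR (b / 2)) ^+ 2 by exact: sqr_ge0.
lra.
Qed.

(** * Exponential moments and windows *)

Section model_tails.
Context {R : realType} {p m : nat}.
Variables (Sigma : 'M[R]_p) (B : 'M[R]_(p, m)) (sigma : R)
  (PB : probability (Obs R p m) R).
Hypotheses (sigma0 : 0 < sigma) (covS : covariance_matrix Sigma)
  (HPB : is_PB Sigma B sigma PB) (m0 : (0 < m)%N).
Implicit Types (V : 'M[R]_(p, m)) (z : Obs R p m).
Local Notation bl := (bl B sigma).
Local Notation sc := (sc B sigma).

Lemma measurable_decoupled_integral (F : p.-tuple R * m.-tuple R -> R) :
  measurable_fun setT F -> (forall u, 0 <= F u) ->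
  measurable_fun setT (fun z : Obs R p m => \int[PB]_z' (F (z.1, resid B z'))%:E)%E.
Proof.
move=> mF F0.
pose fY : {mfun Obs R p m >-> m.-tuple R} := mfun_Sub (mem_set (measurable_resid B)).
have mEF : measurable_fun setT (EFin \o F) by exact/measurable_EFinP.
have EF0 : forall u, (0 <= (EFin \o F) u)%E by move=> u; rewrite lee_fin.
have H := @measurable_fun_fubini_tonelli_F _ _ _ _ _ (distribution PB fY) _ mEF EF0.
have mfst : measurable_fun setT (fst : Obs R p m -> p.-tuple R) by [].
have := measurableT_comp H mfst.
apply: eq_measurable_fun => z _ /=; rewrite /fubini_F; apply/esym.
apply: (integral_law _ _ _ _ _ PB (distribution PB fY) _ (fun y => F (z.1, y))
  (measurable_resid B)) => //.
exact: measurableT_comp mF (measurable_pair1 _).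
Qed.

(** For a design with [|V^T x| = s > 0] one has [|bl| = s |g|] with [g] standard normal. The product
    is split between [s ^ 2] and [g ^ 2], whose exponential moments are known. *)
Lemma sc_expR V : qn Sigma V <= 1 ->
  (\int[PB]_z (expR (sc V z / 16))%:E <= 3%:E)%E.
Proof.
move=> V1.
have mF : measurable_fun setT (fun u : p.-tuple R * m.-tuple R =>
    expR (scx sigma V u.1 u.2 / 16)).
  apply: measurableT_comp => //; apply: measurable_funM => //.
  exact: measurable_scx.
rewrite /sc (decouple _ _ _ _ HPB (fun u => expR (scx sigma V u.1 u.2 / 16)))//=.
have mnr8 : measurable_fun setT (fun z : Obs R p m => expR (nr V z ^+ 2 / 8)).
  apply: measurableT_comp => //; apply: measurable_funM => //.
  by apply: measurable_funX; exact: measurable_nr.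
apply: (@le_trans _ _ (\int[PB]_z (2^-1 * expR (nr V z ^+ 2 / 8) + 2)%:E)%E).
  apply: ge0_le_integral => //.
  - by move=> z _; apply: integral_ge0 => z' _; rewrite lee_fin expR_ge0.
  - exact: (measurable_decoupled_integral _ mF).
  - apply/measurable_EFinP; apply: measurable_funD => //; exact: measurable_funM.
  move=> z _; rewrite /nr /=; set s := nrx V z.1.
  have [n0|n0] := eqVneq s 0.
    under eq_integral do rewrite /scx blx_nrx0//= -/s n0 normr0 addr0 mul0r expR0.
    rewrite integral_cst_probability lee_fin n0 expr0n/= mul0r expR0; lra.
  have s0 : 0 < s by rewrite lt_def n0 nrx_ge0.
  have mb : measurable_fun setT (fun z' => expR (blx sigma V z.1 (resid B z') ^+ 2 / (4 * s ^+ 2))).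
    apply: measurableT_comp => //; apply: measurable_funM => //.
    by apply: measurable_funX; exact: measurable_blx_resid.
  apply: (@le_trans _ _ (\int[PB]_z' ((2^-1 * expR (s ^+ 2 / 8))%:E +
     (expR (blx sigma V z.1 (resid B z') ^+ 2 / (4 * s ^+ 2)))%:E))%E).
    apply: ge0_le_integral => //.
    - apply/measurable_EFinP.
      have H := measurableT_comp mF (measurableT_comp (measurable_pair1 z.1) (measurable_resid B)).
      exact: H.
    - by apply: emeasurable_funD => //; exact/measurable_EFinP.
    - move=> z' _; rewrite -EFinD lee_fin /scx -/s.
      set b := blx _ _ _ _; set g := `|b| / s.
      have bg : `|b| = s * g by rewrite /g; field.
      have -> : b ^+ 2 / (4 * s ^+ 2) = g ^+ 2 / 4.
        by rewrite -(real_normK (num_real b)) bg; field.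
      have H1 : (`|b| + s) / 16 <= (s ^+ 2 / 8 + (g ^+ 2 / 4 + 16^-1)) / 2.
        rewrite bg; have : 0 <= (s - g) ^+ 2 by exact: sqr_ge0.
        have : 0 <= (s - 1) ^+ 2 by exact: sqr_ge0.
        have : 0 <= g ^+ 2 by exact: sqr_ge0.
        lra.
      apply: (@le_trans _ _ (expR ((s ^+ 2 / 8 + (g ^+ 2 / 4 + 16^-1)) / 2))).
        by rewrite ler_expR.
      apply: le_trans (expR_half_add _ _ _) _; rewrite mulrDl mulrC lerD2l.
      rewrite ler_pdivrMr// expRD ler_wpM2l ?expR_ge0//.
      have := expR_ge1Dx (- (16^-1) : R); rewrite expRN => H2.
      rewrite -(@lef_pV2 R) ?posrE ?expR_gt0//; lra.
  rewrite ge0_integralD//; last exact/measurable_EFinP.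
  rewrite integral_cst_probability EFinD leeD2l//.
  have mexp : measurable_fun setT (fun x : R => expR (x ^+ 2 / (4 * s ^+ 2))).
    by apply: measurableT_comp => //; apply: measurable_funM => //; exact: measurable_funX.
  rewrite (integral_law _ _ _ _ _ PB (normal_prob 0 s) _
    (fun x => expR (x ^+ 2 / (4 * s ^+ 2))) (measurable_blx_resid B sigma V z.1))//.
    exact: normal_expR_sqr.
  by move=> A mA; exact: (law_blx _ _ _ _ sigma0 HPB).
under eq_integral do rewrite EFinD.
rewrite ge0_integralD//; last first.
- by apply/measurable_EFinP; exact: measurable_funM.
rewrite integral_cst_probability.
under eq_integral do rewrite EFinM.
rewrite ge0_integralZl//; last exact/measurable_EFinP.
have -> : 3%:E = ((2^-1)%:E * 2%:E + 2%:E)%E :> \bar R.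
  by rewrite -EFinM -EFinD; congr (_%:E); lra.
by rewrite leeD2r// lee_wpmul2l// (nr_expR_sqr _ _ _ _ covS HPB).
Qed.

(** Markov's inequality after rescaling. First-order decay suffices: the chain uses [delta] of order
    [q ^ 6] against [r = q ^ 3]. *)
Lemma sc_tail V (delta r : R) : 0 < delta -> qn Sigma V <= delta ^+ 2 -> 0 < r ->
  (PB [set z | (r < sc V z)%R] <= (48 * delta / r)%:E)%E.
Proof.
move=> d0 Vd r0; pose W := delta^-1 *: V.
have W1 : qn Sigma W <= 1.
  by rewrite qnZ exprVn mulrC ler_pdivrMr ?exprn_gt0// mul1r.
have me : measurable_fun setT (fun z : Obs R p m => expR (sc W z / 16)).
  by apply: measurableT_comp => //; apply: measurable_funM => //; exact: measurable_sc.
apply: (@le_trans _ _ (\int[PB]_z (16 * delta / r * expR (sc W z / 16))%:E)%E).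
  apply: measure_le_integral.
  - by apply: measurable_gt_cst; exact: measurable_sc.
  - exact: measurable_funM.
  - move=> z; rewrite indicE; case: (boolP (z \in _)) => [|_]; last first.
      by rewrite mulr_ge0 ?expR_ge0// divr_ge0 ?mulr_ge0// ltW.
    rewrite inE/= => rV.
    have VW : sc V z = delta * sc W z.
      by rewrite /sc scxZ gtr0_norm ?invr_gt0// mulVKf ?gt_eqF.
    have := expR_ge1Dx (sc W z / 16) => H.
    apply: (@le_trans _ _ (16 * delta / r * (sc W z / 16))).
      have -> : 16 * delta / r * (sc W z / 16) = sc V z / r by rewrite VW; field; rewrite gt_eqF.
      by rewrite ler_pdivlMr// mul1r ltW.
    by rewrite ler_wpM2l ?divr_ge0 ?mulr_ge0 ?(ltW d0) ?(ltW r0)//; lra.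
under eq_integral do rewrite EFinM.
rewrite ge0_integralZl//; last 2 first.
- exact/measurable_EFinP.
- by rewrite lee_fin divr_ge0 ?mulr_ge0// ltW.
have -> : 48 * delta / r = (16 * delta / r) * 3 by field; rewrite gt_eqF.
rewrite [leRHS]EFinM lee_wpmul2l ?lee_fin ?divr_ge0 ?mulr_ge0 ?(ltW d0) ?(ltW r0)//.
exact: sc_expR.
Qed.

Lemma nr_window V : qn Sigma V = 1 ->
  ((2^-1)%:E <= PB [set z | (64^-1 < nr V z <= 8)%R])%E.
Proof.
move=> V1.
have m1 : measurable [set z : Obs R p m | 64^-1 < nr V z <= 8].
  have -> : [set z : Obs R p m | 64^-1 < nr V z <= 8] = nr V @^-1` `]64^-1, 8].
    by apply/seteqP; split => z /=; rewrite in_itv.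
  by apply: measurable_preimage_itv; exact: measurable_nr.
have m2 : measurable [set z : Obs R p m | nr V z <= 8^-1 ^+ 2].
  by apply: measurable_le_cst; exact: measurable_nr.
have m3 : measurable [set z : Obs R p m | 8 < nr V z].
  by apply: measurable_gt_cst; exact: measurable_nr.
(* The small ball with [q = 1/8] gives 1/4, and [expR (64 / 8) >= 9] gives 2/9 for the upper tail;
   together they stay below 1/2. *)
have P2 : (PB [set z | (nr V z <= 8^-1 ^+ 2)%R] <= (4^-1)%:E)%E.
  apply: le_trans (nr_small_ball _ _ _ _ covS HPB _ _ V1 _) _; last first.
    by rewrite lee_fin; lra.
  by apply/andP; split; lra.
have me : measurable_fun setT (fun z : Obs R p m => expR (nr V z ^+ 2 / 8)).
  apply: measurableT_comp => //; apply: measurable_funM => //.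
  by apply: measurable_funX; exact: measurable_nr.
have P3 : (PB [set z | (8 < nr V z)%R] <= (2 / 9)%:E)%E.
  apply: (@le_trans _ _ (\int[PB]_z (9^-1 * expR (nr V z ^+ 2 / 8))%:E)%E).
    apply: measure_le_integral => //; first exact: measurable_funM.
    move=> z; rewrite indicE; case: (boolP (z \in _)) => [|_]; last first.
      by rewrite mulr_ge0 ?expR_ge0.
    rewrite inE/= => n8; have := expR_ge1Dx (nr V z ^+ 2 / 8).
    have : 8 * 8 <= nr V z ^+ 2 by rewrite expr2; apply: ler_pM => //; exact: ltW.
    set q := nr V z ^+ 2; set e := expR _; rewrite /=; lra.
  under eq_integral do rewrite EFinM.
  rewrite ge0_integralZl//; last exact/measurable_EFinP.
  rewrite (_ : 2 / 9 = 9^-1 * 2); last by lra.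
  by rewrite [leRHS]EFinM lee_wpmul2l// (nr_expR_sqr _ _ _ _ covS HPB)// V1.
have [a aE] : exists a, PB [set z | 64^-1 < nr V z <= 8] = a%:E.
  by exists (fine (PB [set z | 64^-1 < nr V z <= 8])); rewrite fineK// fin_num_measure.
have : (1 <= PB [set z | (64^-1 < nr V z <= 8)%R] + ((4^-1)%:E + (2 / 9)%:E))%E.
  apply: (@le_trans _ _ (PB ([set z | 64^-1 < nr V z <= 8] `|`
      ([set z | nr V z <= 8^-1 ^+ 2] `|` [set z | 8 < nr V z])))).
    rewrite (_ : _ `|` _ = setT).
      by rewrite le_eqVlt; apply/orP; left; apply/eqP/esym; exact: probability_setT.
    apply/seteqP; split => z //= _.
    have -> : 8^-1 ^+ 2 = 64^-1 :> R by lra.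
    have [h|h] := leP (nr V z) 64^-1; first by right; left.
    have [h'|h'] := leP (nr V z) 8; first by left; apply/andP.
    by right; right.
  apply: le_trans (measureU2 _ _ _) _ => //; first exact: measurableU.
  rewrite leeD2l//; apply: le_trans (measureU2 _ _ _) _ => //.
  exact: leeD.
rewrite aE -!EFinD !lee_fin; lra.
Qed.

(** For a design norm between 1/64 and 8 the interval lies within one standard deviation, so its
    mass is at least its length over 48; such designs have probability at least 1/2. *)
Lemma bl_window V (tau : R) : qn Sigma V = 1 -> 0 < tau <= 1 ->
  ((tau / (96 * 2 ^+ 16))%:E <= PB [set z |
     ((tau / 2 ^+ 16 <= bl V z <= tau / 2 ^+ 15) && (64^-1 < nr V z))%R])%E.
Proof.
move=> V1 /andP[t0 t1].
pose E := [set u : p.-tuple R * m.-tuple R |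
  (tau / 2 ^+ 16 <= blx sigma V u.1 u.2 <= tau / 2 ^+ 15) && (64^-1 < nrx V u.1)].
have mE : measurable E.
  have -> : E = ((fun u : p.-tuple R * m.-tuple R => blx sigma V u.1 u.2) @^-1`
     `[tau / 2 ^+ 16, tau / 2 ^+ 15]) `&` [set u | 64^-1 < nrx V u.1].
    by apply/seteqP; split => u; rewrite /E /= in_itv/= => /andP.
  apply: measurableI.
    by apply: measurable_preimage_itv; exact: measurable_blx.
  apply: measurable_gt_cst; exact: measurableT_comp (measurable_nrx V) _.
rewrite (_ : [set z | _] = (fun z : Obs R p m => (z.1, resid B z)) @^-1` E)//.
rewrite (decouple_set _ _ _ _ HPB)//.
pose G := [set z : Obs R p m | 64^-1 < nr V z <= 8].
have mG : measurable G.
  have -> : G = nr V @^-1` `]64^-1, 8].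
    by apply/seteqP; split => z /=; rewrite in_itv.
  by apply: measurable_preimage_itv; exact: measurable_nr.
apply: (@le_trans _ _ (\int[PB]_z (tau / (48 * 2 ^+ 16) * \1_G z)%:E)%E).
  under eq_integral do rewrite EFinM.
  rewrite ge0_integralZl//; last 2 first.
  - by apply/measurable_EFinP; exact: measurable_indic.
  - by rewrite lee_fin divr_ge0// ltW.
  rewrite integral_indic// setIT.
  rewrite (_ : tau / (96 * 2 ^+ 16) = tau / (48 * 2 ^+ 16) * 2^-1); last by lra.
  by rewrite EFinM lee_wpmul2l ?nr_window// lee_fin divr_ge0// ltW.
apply: ge0_le_integral => //.
- by move=> z _; rewrite lee_fin mulr_ge0// divr_ge0// ltW.
- by apply/measurable_EFinP; apply: measurable_funM => //; exact: measurable_indic.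
- exact: (measurable_decoupled_section B PB).
move=> z _; rewrite indicE; case: (boolP (z \in G)) => [|_]; last first.
  by rewrite mulr0 measure_ge0.
rewrite inE /G /= mulr1 => /andP[]; rewrite /nr => n1 n2.
have n0 : 0 < nrx V z.1 by apply: lt_trans n1; lra.
have -> : [set z' | E (z.1, resid B z')] =
    (fun z' => blx sigma V z.1 (resid B z')) @^-1` `[tau / 2 ^+ 16, tau / 2 ^+ 15].
  by apply/seteqP; split => z'; rewrite /E /= in_itv/= n1 andbT.
rewrite (law_blx _ _ _ _ sigma0 HPB) ?gt_eqF//.
apply: le_trans (normal_prob_itv_ge _ _ _ n0 _ _ _); last 3 first.
- by rewrite divr_ge0// ltW.
- lra.
- lra.
rewrite lee_fin ler_pdivlMr ?mulr_gt0//.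
have : tau * nrx V z.1 <= tau * 8 by rewrite ler_wpM2l// ltW.
lra.
Qed.

(** Directions killed by [L^T] have zero variance, so the design almost surely lies in the range of
    [L]. There the score of [V] is bounded by its seminorm pointwise, even for singular [Sigma]. *)
Lemma design_range (L : 'M[R]_p) : Sigma = L *m L^T ->
  exists D : set (Obs R p m), [/\ measurable D, PB D = 1%E &
    forall z, D z -> exists y : 'cV[R]_p, tcol z.1 = L *m y].
Proof.
move=> SL; pose K := cokermx L^T.
have LK : L^T *m K = 0 by exact: mulmx_coker.
have : likely PB ((size (enum 'I_p))%:R * 0)
    (fun z => forall k, k \in enum 'I_p -> ((col k K)^T *m tcol z.1) 0 0 = 0).
  apply: likely_seq => k _.
  exists [set z | ((col k K)^T *m tcol z.1) 0 0 = 0]; split => //.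
    rewrite -[X in measurable X]setTI.
    exact: (@measurable_design R p m (col k K) measurableT [set 0] (measurable_set1 0)).
  rewrite subr0; have := law_design _ _ _ _ HPB (col k K) _ (measurable_set1 0).
  have -> : ((col k K)^T *m Sigma *m col k K) 0 0 = 0.
    have LKk : L^T *m col k K = 0 by rewrite colE mulmxA LK mul0mx.
    by rewrite SL -!mulmxA LKk !mulmx0 mxE.
  rewrite /gauss1 eqxx diracE mem_set// => H.
  by rewrite le_eqVlt; apply/orP; left; apply/eqP/esym; exact: H.
rewrite mulr0 => -[D [mD PD HD]]; exists D; split => //.
  apply/eqP; rewrite eq_le probability_le1//=.
  by move: PD; rewrite subr0.
move=> z /HD H.
have : ((tcol z.1)^T <= L^T)%MS.
  rewrite submxE; apply/eqP/matrixP => i j; rewrite ord1 -/K.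
  rewrite [RHS]mxE -(H j (mem_enum _ _)) [LHS]mxE [RHS]mxE.
  by apply: eq_bigr => k _; rewrite mulrC; congr (_ * _); rewrite !mxE.
move=> /submxP[y yE]; exists y^T.
by rewrite -[LHS]trmxK yE trmx_mul trmxK.
Qed.

End model_tails.

(** * Chaining estimates *)

Lemma expR_le_quad (R : realType) (x : R) : x <= 2^-1 ->
  expR x <= 1 + x + 2 * x ^+ 2.
Proof.
move=> x2; have := expR_ge1Dx (- x); rewrite expRN => H.
have x1 : 0 < 1 - x by lra.
have -> : expR x = ((expR x)^-1)^-1 by rewrite invrK.
apply: (@le_trans _ _ ((1 - x)^-1)).
  by rewrite lef_pV2// posrE invr_gt0 expR_gt0.
rewrite -[leLHS]mul1r ler_pdivrMr//.
have : 0 <= x ^+ 2 * (1 - 2 * x) by rewrite mulr_ge0 ?sqr_ge0//; lra.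
lra.
Qed.

Lemma expR1_ge2 (R : realType) : 2 <= expR 1 :> R.
Proof. by have := expR_ge1Dx (1 : R); lra. Qed.

Lemma expR_nat_ge (R : realType) (k : nat) : 2 ^+ k <= expR k%:R :> R.
Proof.
rewrite -[k%:R]mulr1 expRM_natl; apply: lerXn2r; rewrite ?nnegrE ?expR_ge0//.
exact: expR1_ge2.
Qed.

Lemma indic_pred (R : realType) (T : Type) (b : T -> bool) (x : T) :
  \1_[set x | b x] x = (b x)%:R :> R.
Proof. by rewrite indicE; congr (_%:R); rewrite mem_setE. Qed.

Section nets.
Context {R : realType} {p m n : nat}.
Variables (L : 'M[R]_p) (rho : R).
Hypothesis dX : (p * m)%:R <= n%:R * rho ^+ 2.
Local Notation X := (n%:R * rho ^+ 2).
Local Notation qn := (qn (L *m L^T)).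

(** [dX] converts the dimension into [X = n rho ^ 2], the unit in which entropies and tail exponents
    are compared below. *)
Lemma net_of_ball (S : set 'M[R]_(p, m)) (M : nat) (c : R) : (0 < M)%N ->
  (forall V, S V -> qn V <= 1) -> 0 <= c ->
  expR 1 * (2 * M.+1%:R) <= expR c ->
  exists s : seq 'M[R]_(p, m), [/\ forall V, V \in s -> S V,
    forall V, S V -> exists2 V', V' \in s & qn (V - V') <= (M%:R ^+ 2)^-1 &
    (size s)%:R <= expR (X * c)].
Proof.
move=> M0 S1 c0 Mc.
have [|s [sS sN ss]] := @finite_net R ('I_p * 'I_m)%type 'M[R]_(p, m)
    (fun V i => (L^T *m V) i.1 i.2) S M M0.
  by move=> V /S1; rewrite qn_gram.
exists s; split => //.
- move=> V /sN[V' sV' HV]; exists V' => //; rewrite qn_gram.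
  apply: le_trans HV; apply: ler_sum => i _.
  by rewrite mulmxBr !mxE.
- apply: le_trans ss _; rewrite card_prod !card_ord.
  apply: (@le_trans _ _ (expR c ^+ (p * m))).
    apply: lerXn2r; rewrite ?nnegrE ?expR_ge0//.
  by rewrite -expRM_natl ler_expR ler_wpM2r.
Qed.

(** The scale is [q ^ 6] for [q = 4 ^- k], as [likely_increment] requires; the entropy grows only
    linearly in [k]. *)
Lemma net_sphere (k : nat) :
  exists s : seq 'M[R]_(p, m), [/\ forall V, V \in s -> qn V = 1,
    forall V, qn V = 1 ->
      exists2 V', V' \in s & qn (V - V') <= (2 ^- (12 * k)) ^+ 2 &
    (size s)%:R <= expR (X * (3 + 12 * k%:R))].
Proof.
have [||||s [sS sN ss]] := @net_of_ball [set V | qn V = 1] (2 ^ (12 * k)) (3 + 12 * k%:R).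
- by rewrite expn_gt0.
- by move=> V /= ->.
- by rewrite addr_ge0// mulr_ge0.
- have -> : 3 + 12 * k%:R = 1 + (2 + (12 * k)%:R) :> R by rewrite natrM; lra.
  rewrite expRD ler_wpM2l ?expR_ge0// expRD.
  apply: (@le_trans _ _ (2 ^+ 2 * 2 ^+ (12 * k))).
    rewrite -[(_ ^ _).+1%:R]natr1 natrX; have : 1 <= 2 ^+ (12 * k) :> R by rewrite exprn_ege1// ler1n.
    set y := 2 ^+ (12 * k); lra.
  by apply: ler_pM; rewrite ?exprn_ge0// expR_nat_ge.
exists s; split => // V /sN[V' sV' HV]; exists V' => //.
by move: HV; rewrite natrX exprVn.
Qed.

Lemma net_half_ball :
  exists s : seq 'M[R]_(p, m), [/\ forall V, V \in s -> qn V <= 1,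
    forall V, qn V <= 1 -> exists2 V', V' \in s & qn (V - V') <= 2^-1 ^+ 2 &
    (size s)%:R <= expR (X * 4)].
Proof.
have [||||s [sS sN ss]] := @net_of_ball [set V | qn V <= 1] 2 4 => //.
- have -> : 4 = 1 + 3%:R :> R by lra.
  rewrite expRD ler_wpM2l ?expR_ge0//; apply: le_trans (expR_nat_ge _ _); lra.
exists s; split => // V /sN[V' sV' HV]; exists V' => //.
by move: HV; rewrite exprVn.
Qed.

End nets.

(** * Deviation bounds on the nets *)

Section sample.
Context {R : realType} {p m n : nat}.
Variables (Sigma : 'M[R]_p) (B : 'M[R]_(p, m)) (sigma eps rho : R)
  (PB mu : probability (Obs R p m) R) (h : Obs R p m -> R).
Context {dO : measure_display} {Omega : measurableType dO}.
Variables (P : probability Omega R) (Z : 'I_n -> Omega -> Obs R p m).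
Hypotheses (sigma0 : 0 < sigma) (covS : covariance_matrix Sigma)
  (HPB : is_PB Sigma B sigma PB) (m0 : (0 < m)%N).
Hypothesis mZ : forall i, measurable_fun setT (Z i).
Hypothesis lawZ : forall i (A : set (Obs R p m)), measurable A ->
  P (Z i @^-1` A) = mu A.
Hypothesis indepZ : forall A : 'I_n -> set (Obs R p m),
  (forall i, measurable (A i)) ->
  P (\bigcap_(i in [set: 'I_n]) (Z i @^-1` A i)) =
  (\prod_(i < n) P (Z i @^-1` A i))%E.
Hypotheses (mh : measurable_fun setT h) (h01 : forall z, 0 <= h z <= 1)
  (hge : ((1 - eps)%:E <= \int[mu]_z (h z)%:E)%E)
  (hphi : forall phi : Obs R p m -> R, measurable_fun setT phi ->
    (forall z, 0 <= phi z) ->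
    (\int[mu]_z (h z * phi z)%:E <= (1 - eps)%:E * \int[PB]_z (phi z)%:E)%E).
Hypotheses (eps0 : 0 <= eps) (eps_rho : eps <= rho) (rho0 : 0 < rho)
  (rho4 : rho <= 4^-1).
Local Notation X := (n%:R * rho ^+ 2).
Hypothesis X1 : 1 <= X.
Local Notation bl := (bl B sigma).
Local Notation sc := (sc B sigma).

Definition wsum (g : Obs R p m -> R) (w : Omega) : R :=
  \sum_(i < n) h (Z i w) * g (Z i w).

Lemma likely_wsum (g : Obs R p m -> R) (a b : R) : measurable_fun setT g ->
  (\int[PB]_z (expR (g z))%:E <= (1 + b)%:E)%E ->
  likely P (expR (n%:R * ((1 - eps) * b) - a)) (fun w => wsum g w <= a).
Proof.
move=> mg gb; have e1 : eps < 1 by move: eps_rho rho4; lra.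
have mhg : measurable_fun setT (fun z => h z * g z) by exact: measurable_funM.
have mgf := weighted_mgf _ _ _ _ _ _ _ _ _ mh h01 hge hphi e1 mg gb.
have [mE PE] := chernoff_sum _ _ _ _ mZ lawZ indepZ _ a _ mhg mgf.
by exists [set w | \sum_(i < n) h (Z i w) * g (Z i w) <= a].
Qed.

Lemma X_le_nrho : X <= n%:R * rho.
Proof.
rewrite ler_wpM2l// expr2 ler_piMr ?(ltW rho0)//; move: rho4; lra.
Qed.

Lemma likely_contamination :
  likely P (expR (- (7 * X)))
    (fun w => \sum_(i < n) (1 - h (Z i w)) <= 10 * (n%:R * rho)).
Proof.
have m1h : measurable_fun setT (fun z => 1 - h z) by exact: measurable_funB.
have mF : measurable_fun setT (fun z => rho * (1 - h z)) by exact: measurable_funM.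
have h1 z : 0 <= 1 - h z <= 1 by have := h01 z; lra.
have er : expR rho <= 1 + 2 * rho.
  apply: le_trans (expR_le_quad _ _ _) _; first by move: rho4; lra.
  have : 2 * rho * rho <= 2 * rho * 4^-1 by rewrite ler_wpM2l// mulr_ge0// ltW.
  move: rho0; lra.
have int1h : (\int[mu]_z (1 - h z)%:E <= eps%:E)%E by exact: integral_cst_probabilitym_le.
have mgf : (\int[mu]_z (expR (rho * (1 - h z)))%:E <= (expR (2 * rho ^+ 2))%:E)%E.
  apply: (@le_trans _ _ (\int[mu]_z (1%:E + (2 * rho)%:E * (1 - h z)%:E))%E).
    apply: ge0_le_integral => //.
    - by apply/measurable_EFinP; exact: measurableT_comp.
    - apply: emeasurable_funD => //; apply: measurable_funeM; exact/measurable_EFinP.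
    - move=> z _; rewrite -EFinM -EFinD lee_fin mulrC.
      apply: le_trans (convex_expR01 _ _ _ (h1 z)) _.
      have : (1 - h z) * expR rho <= (1 - h z) * (1 + 2 * rho).
        by rewrite ler_wpM2l//; case/andP: (h1 z).
      lra.
  have r20 : 0 <= 2 * rho by rewrite mulr_ge0// ltW.
  rewrite ge0_integralD//; last 2 first.
  - by move=> z _; rewrite -EFinM lee_fin mulr_ge0//; case/andP: (h1 z).
  - by apply: measurable_funeM; exact/measurable_EFinP.
  rewrite integral_cst_probability ge0_integralZl//; last 2 first.
  - exact/measurable_EFinP.
  - by move=> z _; rewrite lee_fin; case/andP: (h1 z).
  apply: (@le_trans _ _ (1%:E + (2 * rho)%:E * eps%:E)%E).
    by rewrite leeD2l// lee_wpmul2l.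
  rewrite -EFinM -EFinD lee_fin; apply: le_trans (expR_ge1Dx _).
  have : 2 * rho * eps <= 2 * rho * rho by rewrite ler_wpM2l.
  lra.
(* At tilt [rho] the moments cost [2 X] and the threshold gains [10 X]. *)
have [mE PE] := chernoff_sum _ _ _ _ mZ lawZ indepZ _ (10 * X) _ mF mgf.
apply: (@likely_weaken _ _ _ _ (expR (n%:R * (2 * rho ^+ 2) - 10 * X))).
  exists [set w | \sum_(i < n) rho * (1 - h (Z i w)) <= 10 * X]; split => // w /=.
  rewrite -mulr_sumr (_ : 10 * X = rho * (10 * (n%:R * rho))); last by ring.
  by rewrite ler_pM2l.
rewrite ler_expR; move: X1; lra.
Qed.

(** [c] is the entropy of the net and [d] the tail exponent of one point. The common failure bound
    [expR (- (7 * X))] lets six events add up to at most [expR (- X)]. *)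
Lemma likely_seq_expR (T : eqType) (s : seq T) (c d : R) (Phi : T -> Omega -> Prop) :
  (size s)%:R <= expR c ->
  (forall V, V \in s -> likely P (expR d) (Phi V)) ->
  c + d <= - (7 * X) ->
  likely P (expR (- (7 * X))) (fun w => forall V, V \in s -> Phi V w).
Proof.
move=> sc H cd; apply: likely_weaken (likely_seq _ _ _ _ _ H) _.
apply: (@le_trans _ _ (expR c * expR d)); first by rewrite ler_wpM2r ?expR_ge0.
by rewrite -expRD ler_expR.
Qed.

Lemma integral_expR_indic (A : set (Obs R p m)) (c a : R) : measurable A ->
  PB A = a%:E ->
  (\int[PB]_z (expR (c * \1_A z))%:E = (1 + (expR c - 1) * a)%:E)%E.
Proof.
move=> mA Aa.
have mI B' : measurable B' -> measurable_fun setT (fun z : Obs R p m => (\1_B' z : R)%:E).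
  by move=> mB'; apply/measurable_EFinP; exact: measurable_indic.
transitivity (\int[PB]_z ((expR c)%:E * (\1_A z)%:E + (\1_(~` A) z)%:E))%E.
  apply: eq_integral => z _; rewrite -EFinM -EFinD; congr (_%:E).
  rewrite !indicE in_setC; case: (z \in A); rewrite /= ?mulr1 ?addr0//.
  by rewrite !mulr0 expR0 add0r.
have mC : measurable (~` A) by exact: measurableC.
have mCA : measurable_fun setT (fun z => (expR c)%:E * (\1_A z)%:E)%E.
  by apply: measurable_funeM; exact: mI.
rewrite ge0_integralD//; last exact: mI.
rewrite ge0_integralZl//; last exact: mI.
rewrite !integral_indic// !setIT.
have PC : PB (~` A) = (1 - a)%:E by rewrite EFinB -Aa; exact: probability_setC.
transitivity ((expR c)%:E * a%:E + (1 - a)%:E)%E; first by congr (_ * _ + _)%E.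
by rewrite -EFinM -EFinD; congr (_%:E); ring.
Qed.

Lemma prob_fin (A : set (Obs R p m)) : measurable A ->
  exists2 a, PB A = a%:E & 0 <= a <= 1.
Proof.
move=> mA; have PA : PB A = (fine (PB A))%:E by rewrite fineK// fin_num_measure.
exists (fine (PB A)) => //; rewrite -!lee_fin -PA measure_ge0/=.
exact: probability_le1.
Qed.

Lemma measurable_bl_gt0 V : measurable [set z | 0 < bl V z].
Proof. by apply: measurable_gt_cst; exact: measurable_bl. Qed.

Lemma measurable_bl_abs_le V r : measurable [set z | `|bl V z| <= r].
Proof.
apply: measurable_le_cst; apply: measurableT_comp; first exact: normr_measurable.
exact: measurable_bl.
Qed.

Lemma wsumZ c (g : Obs R p m -> R) w : wsum (fun z => c * g z) w = c * wsum g w.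
Proof. by rewrite /wsum mulr_sumr; apply: eq_bigr => i _; ring. Qed.

Lemma likely_halfspace (s : seq 'M[R]_(p, m)) :
  (forall V, V \in s -> qn Sigma V = 1) -> (size s)%:R <= expR (X * 3) ->
  likely P (expR (- (7 * X))) (fun w => forall V, V \in s ->
    n%:R * (2^-1 - 12 * rho) <= wsum (\1_[set z | 0 < bl V z]) w).
Proof.
(* The tilt is [- rho]. Of the gain [12 X], the second-order term takes [X], the lost clean
   proportion [X / 2], and the net [3 X]. *)
move=> s1 ss; apply: (likely_seq_expR _ _ _ (3 / 2 * X - 12 * X) _ ss); last first.
  by move: X1; lra.
move=> V /s1 V1.
have mV := measurable_bl_gt0 V.
have mg : measurable_fun setT (fun z => - rho * \1_[set z | 0 < bl V z] z).
  by apply: measurable_funM => //; exact: measurable_indic.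
have er : expR (- rho) <= 1 - rho + 2 * rho ^+ 2.
  by apply: le_trans (expR_le_quad _ _ _) _; [move: rho0; lra|rewrite sqrrN].
have := likely_wsum _ (- rho * (n%:R * (2^-1 - 12 * rho)))
  (2^-1 * (- rho + 2 * rho ^+ 2)) mg.
rewrite (integral_expR_indic _ _ _ mV (bl_half _ _ _ _ sigma0 covS HPB _ V1)) lee_fin.
move=> H; apply: (likely_impl P _ _ _ (likely_weaken P _ _ _ (H _) _) _).
- by move: er; lra.
- rewrite ler_expR.
  have -> : (1 - eps) * (2^-1 * (- rho + 2 * rho ^+ 2)) =
    - rho / 2 + rho ^+ 2 + eps * rho / 2 - eps * rho ^+ 2 by field.
  have H1 : eps * rho <= rho ^+ 2 by rewrite expr2 ler_wpM2r// ltW.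
  have H2 : 0 <= eps * rho ^+ 2 by rewrite mulr_ge0// sqr_ge0.
  have : n%:R * (eps * rho / 2 - eps * rho ^+ 2) <= n%:R * (rho ^+ 2 / 2).
    by rewrite ler_wpM2l//; lra.
  lra.
- by move=> w; rewrite wsumZ ler_nM2l// oppr_lt0.
Qed.

(** Equal masses cancel the term linear in [c]; what remains is of second order, as in Bernstein's
    inequality. *)
Lemma integral_expR_diff (A1 A2 : set (Obs R p m)) (c a : R) :
  measurable A1 -> measurable A2 -> A1 `&` A2 = set0 ->
  PB A1 = a%:E -> PB A2 = a%:E ->
  (\int[PB]_z (expR (c * (\1_A1 z - \1_A2 z)))%:E =
   (1 + (expR c + expR (- c) - 2) * a)%:E)%E.
Proof.
move=> mA1 mA2 A12 Pa1 Pa2.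
have mI B' : measurable B' -> measurable_fun setT (fun z : Obs R p m => (\1_B' z : R)%:E).
  by move=> mB'; apply/measurable_EFinP; exact: measurable_indic.
have mU : measurable (A1 `|` A2) by exact: measurableU.
have mC : measurable (~` (A1 `|` A2)) by exact: measurableC.
transitivity (\int[PB]_z ((expR c)%:E * (\1_A1 z)%:E +
    ((expR (- c))%:E * (\1_A2 z)%:E + (\1_(~` (A1 `|` A2)) z)%:E)))%E.
  apply: eq_integral => z _; rewrite -!EFinM -!EFinD; congr (_%:E).
  rewrite !indicE in_setC in_setU.
  have : ~~ ((z \in A1) && (z \in A2)).
    apply/negP; rewrite -in_setI A12 inE; exact.
  case: (z \in A1); case: (z \in A2) => //= _.
  - by rewrite subr0 !mulr1 !mulr0 !addr0.
  - by rewrite sub0r mulrN !mulr1 !mulr0 addr0 add0r.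
  - by rewrite subrr !mulr0 expR0 !add0r.
have mZ1 (r : R) B' : measurable B' ->
    measurable_fun setT (fun z : Obs R p m => (expR r)%:E * (\1_B' z)%:E)%E.
  by move=> mB'; apply: measurable_funeM; exact: mI.
rewrite ge0_integralD//; last 3 first.
- exact: mZ1.
- by move=> z _; rewrite -EFinM -EFinD lee_fin addr_ge0// mulr_ge0// expR_ge0.
- by apply: emeasurable_funD; [exact: mZ1|exact: mI].
rewrite ge0_integralD//; last 2 first.
- exact: mZ1.
- exact: mI.
rewrite ge0_integralZl//; last exact: mI.
rewrite ge0_integralZl//; last exact: mI.
rewrite !integral_indic// !setIT.
have PU : PB (A1 `|` A2) = (a + a)%:E.
  by rewrite EFinD -{1}Pa1 -Pa2; exact: measureU.
have PC : PB (~` (A1 `|` A2)) = (1 - (a + a))%:E.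
  by rewrite EFinB -PU; exact: probability_setC.
transitivity ((expR c)%:E * a%:E + ((expR (- c))%:E * a%:E + (1 - (a + a))%:E))%E.
  by congr (_ * _ + (_ * _ + _))%E.
by rewrite -!EFinM -!EFinD; congr (_%:E); ring.
Qed.

(** A sign can change only where [|bl V| <= q ^+ 3] or where the increment exceeds [q ^+ 3]. *)
Lemma bl_sign_change V V' (q delta : R) : 0 < q <= 1 -> 0 < delta ->
  qn Sigma V = 1 -> qn Sigma (V' - V) <= delta ^+ 2 ->
  (PB ([set z | (0 < bl V z)%R] `\` [set z | (0 < bl V' z)%R] `|`
       [set z | (0 < bl V' z)%R] `\` [set z | (0 < bl V z)%R])
   <= (3 * q + 48 * delta / q ^+ 3)%:E)%E.
Proof.
move=> q01 d0 V1 VV'; have /andP[q0 _] := q01.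
have msc : measurable [set z | q ^+ 3 < sc (V' - V) z].
  by apply: measurable_gt_cst; exact: measurable_sc.
apply: (@le_trans _ _ (PB ([set z | `|bl V z| <= q ^+ 3] `|`
    [set z | q ^+ 3 < sc (V' - V) z]))).
  apply: le_measure; rewrite ?inE.
  - by apply: measurableU; apply: measurableD; exact: measurable_bl_gt0.
  - by apply: measurableU => //; exact: measurable_bl_abs_le.
  move=> z /= H; have [h1|h1] := leP `|bl V z| (q ^+ 3); [by left|right].
  apply: lt_le_trans h1 _.
  have : `|bl (V' - V) z| <= sc (V' - V) z by rewrite lerDl nrx_ge0.
  have -> : bl (V' - V) z = bl V' z - bl V z by exact: blxB.
  apply: le_trans; move: H; set b := bl V z; set b' := bl V' z.
  case=> -[h2 /negP]; rewrite -leNgt => h3.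
    rewrite gtr0_norm// ler0_norm; lra.
  rewrite ler0_norm// gtr0_norm; lra.
apply: le_trans (measureU2 _ _ _) _ => //; first exact: measurable_bl_abs_le.
rewrite EFinD; apply: leeD.
  exact: (bl_small_ball _ _ _ _ sigma0 covS HPB).
by apply: (sc_tail _ _ _ _ sigma0 covS HPB m0); rewrite ?exprn_gt0.
Qed.

(** The half-spaces differ with mass O(4 ^- k), so the tilt [rho 2 ^ k] costs only O(X); dividing
    the threshold by this tilt produces [(k + 1) / 2 ^ k]. One side is enough, as the chain
    propagates lower bounds only. *)
Lemma likely_increment (k : nat) V V' : rho * 2 ^+ k <= 2^-1 ->
  qn Sigma V = 1 -> qn Sigma V' = 1 ->
  qn Sigma (V' - V) <= (2 * 2 ^- (12 * k)) ^+ 2 ->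
  likely P (expR (198 * X - 230 * k.+1%:R * X)) (fun w =>
    wsum (\1_[set z | 0 < bl V z]) w - wsum (\1_[set z | 0 < bl V' z]) w
      <= 230 * (n%:R * rho) * (k.+1%:R / 2 ^+ k)).
Proof.
move=> lam2 V1 V'1 VV'.
set A := [set z | 0 < bl V z]; set A' := [set z | 0 < bl V' z].
have mA : measurable A by exact: measurable_bl_gt0.
have mA' : measurable A' by exact: measurable_bl_gt0.
pose lam := rho * 2 ^+ k.
have lam0 : 0 < lam by rewrite mulr_gt0// exprn_gt0.
pose q : R := 4 ^- k.
have p4 : 1 <= 4 ^+ k :> R by rewrite exprn_ege1// ler1n.
have q0 : 0 < q by rewrite invr_gt0 exprn_gt0.
have q1 : q <= 1 by rewrite invf_le1// exprn_gt0.
have d0 : 0 < 2 * 2 ^- (12 * k) :> R by rewrite mulr_gt0// invr_gt0 exprn_gt0.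
have mD1 : measurable (A `\` A') by exact: measurableD.
have mD2 : measurable (A' `\` A) by exact: measurableD.
have dsj : (A `\` A') `&` (A' `\` A) = set0.
  by apply/seteqP; split => z //= -[[? ?] [? ?]].
have [a Pa1 /andP[a0 _]] := prob_fin _ mD1.
(* Both half-spaces have mass 1/2, so the two differences have equal mass. *)
have Pa2 : PB (A' `\` A) = a%:E.
  have [a' Pa' _] := prob_fin _ mD2.
  have [c Pc _] := prob_fin _ (measurableI _ _ mA mA').
  have split2 C C' x : measurable C -> measurable C' -> PB (C `\` C') = x%:E ->
      PB (C `&` C') = c%:E -> PB C = (2^-1)%:E -> x + c = 2^-1.
    move=> mC mC' Hx Hc HC; have : PB (C `\` C') = (PB C - PB (C `&` C'))%E.
      by apply: measureD => //; rewrite ltey_eq fin_num_measure.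
    by rewrite Hx Hc HC -EFinB => -[->]; rewrite subrK.
  have e1 := split2 _ _ _ mA mA' Pa1 Pc (bl_half _ _ _ _ sigma0 covS HPB _ V1).
  rewrite setIC in Pc.
  have e2 := split2 _ _ _ mA' mA Pa' Pc (bl_half _ _ _ _ sigma0 covS HPB _ V'1).
  by rewrite Pa'; congr (_%:E); lra.
have aq : a + a <= 99 * q.
  have PU : PB (A `\` A' `|` A' `\` A) = (a + a)%:E.
    by rewrite EFinD -{1}Pa1 -Pa2; exact: measureU.
  rewrite -lee_fin -PU.
  have q01 : 0 < q <= 1 by rewrite q0 q1.
  apply: le_trans (bl_sign_change _ _ _ _ q01 d0 V1 VV') _.
  rewrite lee_fin.
  (* With increments of size [2 q ^+ 6] the tail term is [96 q ^+ 3]; adding the small ball [3 q]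
     gives 99. *)
  have -> : 2 ^- (12 * k) = q ^+ 3 * q ^+ 3 :> R.
    rewrite -exprD /q exprVn (_ : 4 = 2 ^+ 2 :> R); last by lra.
    have -> : (12 * k = 2 * k * 6)%N by rewrite mulnAC.
    by rewrite !exprM.
  have -> : 48 * (2 * (q ^+ 3 * q ^+ 3)) / q ^+ 3 = 96 * q ^+ 3.
    by field; rewrite gt_eqF.
  have : q ^+ 3 <= q by rewrite exprS ler_piMr ?(ltW q0)// exprn_ile1// ltW.
  lra.
have mg : measurable_fun setT (fun z => lam * (\1_A z - \1_A' z)).
  by apply: measurable_funM => //; apply: measurable_funB; exact: measurable_indic.
have mgf : (\int[PB]_z (expR (lam * (\1_A z - \1_A' z)))%:E <= (1 + 198 * rho ^+ 2)%:E)%E.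
  have -> : (\int[PB]_z (expR (lam * (\1_A z - \1_A' z)))%:E =
     \int[PB]_z (expR (lam * (\1_(A `\` A') z - \1_(A' `\` A) z)))%:E)%E.
    apply: eq_integral => z _; congr (expR (lam * _))%:E.
    rewrite !indicE !in_setD; case: (z \in A); case: (z \in A') => //=.
    by rewrite !subrr.
  rewrite (integral_expR_diff _ _ _ _ mD1 mD2 dsj Pa1 Pa2) lee_fin lerD2l.
  have H1 : expR lam <= 1 + lam + 2 * lam ^+ 2 by apply: expR_le_quad.
  have H2 : expR (- lam) <= 1 - lam + 2 * lam ^+ 2.
    by apply: le_trans (expR_le_quad _ _ _) _; [move: lam0; lra|rewrite sqrrN].
  apply: (@le_trans _ _ (4 * lam ^+ 2 * a)).
    by rewrite ler_wpM2r//; lra.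
  apply: (@le_trans _ _ (2 * lam ^+ 2 * (99 * q))).
    have : 2 * lam ^+ 2 * (a + a) <= 2 * lam ^+ 2 * (99 * q).
      by rewrite ler_wpM2l// mulr_ge0// sqr_ge0.
    lra.
  have H3 : lam ^+ 2 * q = rho ^+ 2.
    rewrite /lam /q exprMn -exprM mulnC exprM (_ : 2 ^+ 2 = 4 :> R); last by lra.
    by rewrite mulfK// gt_eqF// exprn_gt0.
  lra.
have := likely_wsum _ (230 * k.+1%:R * X) _ mg mgf.
move=> H; apply: (likely_impl P _ _ _ (likely_weaken P _ _ _ H _)).
  rewrite ler_expR.
  have : n%:R * ((1 - eps) * (198 * rho ^+ 2)) <= n%:R * (198 * rho ^+ 2).
    have e1 : 1 - eps <= 1 by rewrite gerBl.
    have r0 : 0 <= 198 * rho ^+ 2 by rewrite mulr_ge0// sqr_ge0.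
    by rewrite ler_wpM2l// ler_piMl.
  lra.
move=> w; have -> : wsum (fun z => lam * (\1_A z - \1_A' z)) w =
    lam * (wsum \1_A w - wsum \1_A' w).
  rewrite wsumZ; congr (_ * _); rewrite /wsum -sumrB.
  by apply: eq_bigr => i _; ring.
have -> : 230 * k.+1%:R * X = lam * (230 * (n%:R * rho) * (k.+1%:R / 2 ^+ k)).
  by rewrite /lam; field; rewrite gt_eqF// exprn_gt0.
by rewrite ler_pM2l.
Qed.

Lemma sum_expR_geometric (K : nat) :
  \sum_(k < K) expR (- (8 * k.+1%:R * X)) <= expR (- (7 * X)).
Proof.
have pw (k : nat) : 0 < 2 ^- k :> R by rewrite invr_gt0 exprn_gt0.
have half (N : nat) : \sum_(k < N) 2 ^- k.+1 = 1 - 2 ^- N :> R.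
  elim: N => [|N IH]; first by rewrite big_ord0 expr0 invr1 subrr.
  rewrite big_ord_recr/= IH exprS invfM; lra.
apply: (@le_trans _ _ (\sum_(k < K) expR (- (7 * X)) * 2 ^- k.+1)); last first.
  by rewrite -mulr_sumr ler_piMr ?expR_ge0// half; have := pw K; lra.
apply: ler_sum => k _; apply: (@le_trans _ _ (expR (- (7 * X) - k.+1%:R))).
  rewrite ler_expR; have k1 : 1 <= k.+1%:R :> R by rewrite ler1n.
  have : 1 * (8 * X - 1) <= k.+1%:R * (8 * X - 1) by rewrite ler_wpM2r//; move: X1; lra.
  move: X1; lra.
rewrite expRD ler_wpM2l ?expR_ge0// expRN lef_pV2 ?posrE ?expR_gt0 ?exprn_gt0//.
exact: expR_nat_ge.
Qed.

Lemma likely_chain (N : nat -> seq 'M[R]_(p, m)) (K : nat) :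
  (forall k V, V \in N k -> qn Sigma V = 1) ->
  (forall k, (size (N k))%:R <= expR (X * (3 + 12 * k%:R))) ->
  (forall k, (k < K)%N -> rho * 2 ^+ k <= 2^-1) ->
  likely P (expR (- (7 * X))) (fun w => forall k, (k < K)%N ->
    forall V V', V \in N k -> V' \in N k.+1 ->
      qn Sigma (V' - V) <= (2 * 2 ^- (12 * k)) ^+ 2 ->
      wsum (\1_[set z | 0 < bl V z]) w - wsum (\1_[set z | 0 < bl V' z]) w
        <= 230 * (n%:R * rho) * (k.+1%:R / 2 ^+ k)).
Proof.
move=> N1 Ns rk.
pose Psi k w := forall V V', V \in N k -> V' \in N k.+1 ->
  qn Sigma (V' - V) <= (2 * 2 ^- (12 * k)) ^+ 2 ->
  wsum (\1_[set z | 0 < bl V z]) w - wsum (\1_[set z | 0 < bl V' z]) w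
    <= 230 * (n%:R * rho) * (k.+1%:R / 2 ^+ k).
suff H0 k : (k < K)%N -> likely P (expR (- (8 * k.+1%:R * X))) (Psi k).
  exact: (likely_weaken P _ _ _ (likely_lt P K _ Psi H0) (sum_expR_geometric K)).
move=> kK.
pose s := [seq (V, V') | V <- N k, V' <- N k.+1].
pose Phi (VV : 'M[R]_(p, m) * 'M[R]_(p, m)) w :=
  qn Sigma (VV.2 - VV.1) <= (2 * 2 ^- (12 * k)) ^+ 2 ->
  wsum (\1_[set z | 0 < bl VV.1 z]) w - wsum (\1_[set z | 0 < bl VV.2 z]) w
        <= 230 * (n%:R * rho) * (k.+1%:R / 2 ^+ k).
have H : likely P ((size s)%:R * expR (198 * X - 230 * k.+1%:R * X))
    (fun w => forall VV, VV \in s -> Phi VV w).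
  apply: likely_seq => VV /allpairsP[[V V'] /= [VN V'N ->]]; rewrite /Phi /=.
  have [close|far] := leP (qn Sigma (V' - V)) ((2 * 2 ^- (12 * k)) ^+ 2).
    by apply: (likely_impl P _ _ _
      (likely_increment k V V' (rk k kK) (N1 _ _ VN) (N1 _ _ V'N) close)).
  apply: (likely_weaken P _ _ _ _ (expR_ge0 _)).
  by apply: (likely_impl P _ _ _ (likely_true P)) => w.
apply: (likely_impl P _ _ _ (likely_weaken P _ _ _ H _)); last first.
  move=> w Hw V V' VN V'N; apply: (Hw (V, V')).
  by apply/allpairsP; exists (V, V').
(* The entropy [(18 + 24 k) X] of the pairs and the moment term [198 X] are paid out of
   [230 (k + 1) X], with at least [8 (k + 1) X] to spare. *)
rewrite size_allpairs natrM.
apply: (@le_trans _ _ ((expR (X * (3 + 12 * k%:R)) * expR (X * (3 + 12 * k.+1%:R)))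
    * expR (198 * X - 230 * k.+1%:R * X))).
  by rewrite ler_wpM2r ?expR_ge0// ler_pM.
rewrite -!expRD ler_expR -natr1.
have : 0 <= k%:R * X by rewrite mulr_ge0//; move: X1; lra.
move: X1; lra.
Qed.

(** The expected count is itself O(n rho), so a constant tilt can afford the entropy [15 n rho] of
    the finest net: of the gain 25, the mean takes 3 and the net 15. *)
Lemma likely_band (s : seq 'M[R]_(p, m)) :
  (forall V, V \in s -> qn Sigma V = 1) ->
  (size s)%:R <= expR (15 * (n%:R * rho)) ->
  likely P (expR (- (7 * X))) (fun w => forall V, V \in s ->
    wsum (\1_[set z | `|bl V z| <= rho ^+ 3]) w <= 50 * (n%:R * rho)).
Proof.
move=> s1 ss; apply: (likely_seq_expR _ _ _ (- (22 * (n%:R * rho))) _ ss); last first.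
  by have := X_le_nrho; lra.
move=> V /s1 V1; have mV := measurable_bl_abs_le V (rho ^+ 3).
have [a Pa /andP[a0 _]] := prob_fin _ mV.
have a3 : a <= 3 * rho.
  rewrite -lee_fin -Pa; apply: (bl_small_ball _ _ _ _ sigma0 covS HPB) => //.
  by apply/andP; split => //; move: rho4; lra.
have mg : measurable_fun setT (fun z => 2^-1 * \1_[set z | `|bl V z| <= rho ^+ 3] z : R).
  by apply: measurable_funM => //; exact: measurable_indic.
have := likely_wsum _ (2^-1 * (50 * (n%:R * rho))) (3 * rho) mg.
rewrite (integral_expR_indic _ _ _ mV Pa) lee_fin.
move=> H; apply: (likely_impl P _ _ _ (likely_weaken P _ _ _ (H _) _) _).
- rewrite lerD2l; apply: le_trans a3; rewrite ler_piMl//.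
  have := expR_le_quad _ (2^-1 : R) (lexx _); lra.
- rewrite ler_expR.
  have : n%:R * ((1 - eps) * (3 * rho)) <= n%:R * (3 * rho).
    have e1 : 1 - eps <= 1 by rewrite gerBl.
    have r0 : 0 <= 3 * rho by rewrite mulr_ge0// ltW.
    by rewrite ler_wpM2l// ler_piMl.
  lra.
- by move=> w; rewrite wsumZ ler_pM2l.
Qed.

(** The gain [208 n / 16 = 13 n] covers the moments, [2 n], and the entropy [4 X <= 4 n]. *)
Lemma likely_moment (s : seq 'M[R]_(p, m)) :
  (forall V, V \in s -> qn Sigma V <= 1) -> (size s)%:R <= expR (X * 4) ->
  likely P (expR (- (7 * X))) (fun w => forall V, V \in s ->
    wsum (sc V) w <= 208 * n%:R).
Proof.
move=> s1 ss.
have Xn : X <= n%:R.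
  by rewrite ler_piMr// exprn_ile1// ?(ltW rho0)//; move: rho4; lra.
apply: (likely_seq_expR _ _ _ (- (11 * n%:R)) _ ss); last by lra.
move=> V /s1 V1.
have mg : measurable_fun setT (fun z => 16^-1 * sc V z).
  by apply: measurable_funM => //; exact: measurable_sc.
have := likely_wsum _ (16^-1 * (208 * n%:R)) 2 mg.
move=> H; apply: (likely_impl P _ _ _ (likely_weaken P _ _ _ (H _) _) _).
- under eq_integral do rewrite mulrC.
  apply: le_trans (sc_expR _ _ _ _ sigma0 covS HPB m0 V V1) _.
  by rewrite lee_fin; lra.
- rewrite ler_expR.
  have : n%:R * ((1 - eps) * 2) <= n%:R * 2.
    by rewrite ler_wpM2l//; move: eps0; lra.
  lra.
- by move=> w; rewrite wsumZ ler_pM2l.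
Qed.

(** This set lies well inside [0 <= bl V < tau |V^T x|^2]: in units of [t = tau / 2 ^ 16], the score
    is between [t] and [2 t], while a norm of 1/128, half of the bound here, already puts the upper
    end at [4 t]. The margins absorb the passage to a nearby direction. *)
Definition window (tau : R) V : set (Obs R p m) :=
  [set z | (tau / 2 ^+ 16 <= bl V z <= tau / 2 ^+ 15) && (64^-1 < nr V z)].

Lemma measurable_window tau V : measurable (window tau V).
Proof.
have -> : window tau V = (bl V @^-1` `[tau / 2 ^+ 16, tau / 2 ^+ 15]) `&`
    [set z | 64^-1 < nr V z].
  by apply/seteqP; split => z; rewrite /window /= in_itv/= => /andP.
apply: measurableI.
  by apply: measurable_preimage_itv; exact: measurable_bl.
by apply: measurable_gt_cst; exact: measurable_nr.
Qed.

Lemma likely_window (s : seq 'M[R]_(p, m)) (tau : R) :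
  (forall V, V \in s -> qn Sigma V = 1) ->
  (size s)%:R <= expR (15 * (n%:R * rho)) ->
  tau <= 1 -> 176 * rho <= tau / (96 * 2 ^+ 16) ->
  likely P (expR (- (7 * X))) (fun w => forall V, V \in s ->
    n%:R * (tau / (96 * 2 ^+ 16) / 8) <= wsum (\1_(window tau V)) w).
Proof.
(* The hypothesis on [tau] makes the exponent at least [176 / 8 = 22] times [n rho], which exceeds
   the entropy by [7 n rho]. *)
move=> s1 ss t1 tr; apply: (likely_seq_expR _ _ _ (- (22 * (n%:R * rho))) _ ss); last first.
  by have := X_le_nrho; lra.
set c := tau / (96 * 2 ^+ 16) in tr *.
have c0 : 0 < c by apply: lt_le_trans tr; rewrite mulr_gt0.
have t0 : 0 < tau.
  by move: c0; rewrite /c pmulr_lgt0// invr_gt0 mulr_gt0// exprn_gt0.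
move=> V /s1 V1; have mV := measurable_window tau V.
have [a Pa /andP[a0 _]] := prob_fin _ mV.
have ca : c <= a.
  rewrite -lee_fin -Pa; apply: (bl_window _ _ _ _ sigma0 covS HPB m0) => //.
  by rewrite t0.
have mg : measurable_fun setT (fun z => - 1 * \1_(window tau V) z : R).
  by apply: measurable_funM => //; exact: measurable_indic.
have := likely_wsum _ (- 1 * (n%:R * (c / 8))) (- (c / 2)) mg.
rewrite (integral_expR_indic _ _ _ mV Pa) lee_fin.
have e1 : expR (- 1) <= 2^-1 :> R.
  by rewrite expRN lef_pV2 ?posrE ?expR_gt0// expR1_ge2.
move=> H; apply: (likely_impl P _ _ _ (likely_weaken P _ _ _ (H _) _) _).
- rewrite lerD2l; have : (expR (- 1) - 1) * a <= - 2^-1 * a by rewrite ler_wpM2r//; lra.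
  lra.
- rewrite ler_expR.
  have : n%:R * (c / 4) <= n%:R * ((1 - eps) * (c / 2)).
    rewrite ler_wpM2l//; have : 2^-1 * (c / 2) <= (1 - eps) * (c / 2).
      by rewrite ler_wpM2r ?divr_ge0 ?(ltW c0)//; move: eps_rho rho4; lra.
    lra.
  have : n%:R * (176 * rho) <= n%:R * c by rewrite ler_wpM2l.
  lra.
- by move=> w; rewrite wsumZ ler_nM2l.
Qed.

End sample.

(** * From uniform estimates to the depth *)

Section gram.
Context {R : realType} {p m : nat}.
Variable L : 'M[R]_p.
Implicit Types V W : 'M[R]_(p, m).
Local Notation qn := (qn (L *m L^T)).

Lemma qn_ge0 V : 0 <= qn V.
Proof. by rewrite qn_gram sumr_ge0// => i _; exact: sqr_ge0. Qed.

Lemma qn_add_le V W : qn (V + W) <= 2 * qn V + 2 * qn W.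
Proof.
rewrite !qn_gram !mulr_sumr -big_split/=; apply: ler_sum => i _.
have -> : (L^T *m (V + W)) i.1 i.2 = (L^T *m V) i.1 i.2 + (L^T *m W) i.1 i.2.
  by rewrite mulmxDr mxE.
set a := (L^T *m V) _ _; set b := (L^T *m W) _ _.
have : 0 <= (a - b) ^+ 2 by exact: sqr_ge0.
lra.
Qed.

Lemma nrx_le_range V (x : p.-tuple R) (y : 'cV[R]_p) : tcol x = L *m y ->
  nrx V x <= Num.sqrt (\sum_j y j 0 ^+ 2) * Num.sqrt (qn V).
Proof.
move=> xy; rewrite -sqrtrM; last by apply: sumr_ge0 => j _; exact: sqr_ge0.
rewrite ler_wsqrtr// qn_gram -(pair_bigA _ (fun i j => (L^T *m V) i j ^+ 2))/=.
rewrite exchange_big/= mulr_sumr; apply: ler_sum => k _.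
have -> : cx V x k = \sum_j y j 0 * (L^T *m V) j k.
  rewrite /cx xy mulmxA mxE; apply: eq_bigr => j _; rewrite mulrC; congr (_ * _).
  by rewrite -[V^T *m L]trmxK trmx_mul trmxK mxE.
exact: sum_cauchy_schwarz.
Qed.

Lemma sc_le_range (B : 'M[R]_(p, m)) (sigma : R) (z : Obs R p m) (y : 'cV[R]_p) :
  0 < sigma -> tcol z.1 = L *m y ->
  exists2 C, 0 <= C & forall V, sc B sigma V z <= C * Num.sqrt (qn V).
Proof.
move=> s0 xy; pose a := Num.sqrt (\sum_j y j 0 ^+ 2).
pose b := Num.sqrt (\sum_k tnth (resid B z) k ^+ 2) / sigma.
have a0 : 0 <= a by exact: sqrtr_ge0.
have b0 : 0 <= b by rewrite divr_ge0 ?sqrtr_ge0// ltW.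
exists (a * b + a); first by rewrite addr_ge0// mulr_ge0.
move=> V; have nV := nrx_le_range V _ _ xy.
rewrite mulrDl; apply: lerD; last exact: nV.
have -> : a * b * Num.sqrt (qn V) = b * (a * Num.sqrt (qn V)) by ring.
apply: le_trans (ler_wpM2l b0 nV); rewrite /blx /b normrM normfV (gtr0_norm s0).
rewrite mulrAC ler_wpM2r ?invr_ge0 ?(ltW s0)//.
rewrite -sqrtr_sqr mulrC /nrx -sqrtrM ?sqx_ge0// ler_wsqrtr//.
exact: sum_cauchy_schwarz.
Qed.

End gram.

Section deterministic.
Context {R : realType} {p m n : nat}.
Variables (L : 'M[R]_p) (B : 'M[R]_(p, m)) (sigma rho : R)
  (h : Obs R p m -> R) (z : 'I_n -> Obs R p m).
Hypotheses (sigma0 : 0 < sigma) (h01 : forall u, 0 <= h u <= 1)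
  (h_range : forall u, h u != 0 -> exists y : 'cV[R]_p, tcol u.1 = L *m y).
Hypotheses (rho0 : 0 < rho) (rho8 : rho <= 8^-1).
Implicit Types V W : 'M[R]_(p, m).
Local Notation qn := (qn (L *m L^T)).
Local Notation bl := (bl B sigma).
Local Notation sc := (sc B sigma).

Definition hsum (g : Obs R p m -> R) : R := \sum_(i < n) h (z i) * g (z i).

Lemma hsum_le (f g : Obs R p m -> R) : (forall u, f u <= g u) -> hsum f <= hsum g.
Proof.
by move=> fg; apply: ler_sum => i _; rewrite ler_wpM2l//; case/andP: (h01 (z i)).
Qed.

Lemma hsumD (f g : Obs R p m -> R) : hsum (fun u => f u + g u) = hsum f + hsum g.
Proof. by rewrite /hsum -big_split/=; apply: eq_bigr => i _; rewrite mulrDr. Qed.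

Lemma hsumZ c (f : Obs R p m -> R) : hsum (fun u => c * f u) = c * hsum f.
Proof. by rewrite /hsum mulr_sumr; apply: eq_bigr => i _; rewrite mulrCA. Qed.

(** Observations off the range of [L] have weight zero. The constant depends on the sample, and its
    finiteness is what starts the halving in [hsum_sc_le]. *)
Lemma hsum_sc_bounded :
  exists2 C, 0 <= C & forall V, hsum (sc V) <= C * Num.sqrt (qn V).
Proof.
have /choice[C HC] : forall i : 'I_n, exists C, 0 <= C /\
    forall V, h (z i) * sc V (z i) <= C * Num.sqrt (qn V).
  move=> i; have /andP[h0 h1] := h01 (z i).
  have [hz|hz] := eqVneq (h (z i)) 0.
    by exists 0; split=> // V; rewrite hz !mul0r.
  have [y xy] := h_range _ hz.
  have [C C0 HC] := sc_le_range L B sigma _ _ sigma0 xy.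
  exists C; split => // V; apply: le_trans (HC V).
  by rewrite ler_piMl// scx_ge0.
exists (\sum_i C i); first by apply: sumr_ge0 => i _; exact: (HC i).1.
by move=> V; rewrite mulr_suml; apply: ler_sum => i _; exact: (HC i).2.
Qed.

(* A bound on a 1/2-net of the unit ball doubles on the whole space: starting
   from the crude constant [C], each passage to the net halves the excess. *)
Lemma hsum_sc_le (s : seq 'M[R]_(p, m)) (c : R) :
  (forall V, qn V <= 1 -> exists2 V', V' \in s & qn (V - V') <= 2^-1 ^+ 2) ->
  0 <= c -> (forall V, V \in s -> hsum (sc V) <= c) ->
  forall V, hsum (sc V) <= 2 * c * Num.sqrt (qn V).
Proof.
move=> net c0 Hs; have [C C0 HC] := hsum_sc_bounded.
have step (j : nat) V : hsum (sc V) <= (2 * c + C / 2 ^+ j) * Num.sqrt (qn V).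
  elim: j V => [|j IH] V.
    apply: le_trans (HC V) _; rewrite expr0 divr1 ler_wpM2r ?sqrtr_ge0//; lra.
  set q := Num.sqrt (qn V).
  have [q0|qn0] := eqVneq q 0.
    by have := HC V; rewrite -/q q0 !mulr0.
  have qp : 0 < q by rewrite lt_def qn0 sqrtr_ge0.
  pose W := q^-1 *: V.
  have VW : V = q *: W by rewrite scalerA mulfV ?scale1r// gt_eqF.
  have W1 : qn W = 1.
    by rewrite qnZ exprVn sqr_sqrtr ?qn_ge0// mulVf// -[qn V]sqr_sqrtr ?qn_ge0// expf_neq0.
  have [|W' sW' WW'] := net W; first by rewrite W1.
  have cj0 : 0 <= 2 * c + C / 2 ^+ j by rewrite addr_ge0 ?mulr_ge0 ?invr_ge0 ?exprn_ge0.
  have H1 : hsum (sc W) <= hsum (sc W') + hsum (sc (W - W')).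
    rewrite -hsumD; apply: hsum_le => u.
    by apply: le_trans (scxD _ _ _ _ _); rewrite /sc subrKC.
  have H2 : hsum (sc (W - W')) <= (2 * c + C / 2 ^+ j) * 2^-1.
    apply: le_trans (IH _) _; rewrite ler_wpM2l//.
    rewrite -[leRHS](@ger0_norm _ (2^-1 : R)) ?invr_ge0// -sqrtr_sqr.
    by rewrite ler_wsqrtr.
  have -> : hsum (sc V) = q * hsum (sc W).
    rewrite -hsumZ; apply: eq_bigr => i _; congr (_ * _).
    by rewrite /sc {1}VW scxZ gtr0_norm.
  rewrite mulrC ler_wpM2r ?(ltW qp)//.
  have -> : C / 2 ^+ j.+1 = C / 2 ^+ j / 2 by rewrite exprS invfM; ring.
  have := Hs _ sW'; lra.
(* Letting [j] grow: an excess [d > 0] would satisfy [d 2 ^ j <= C q] for every [j]. *)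
move=> V; rewrite leNgt; apply/negP => lt.
set q := Num.sqrt (qn V) in lt; have q0 : 0 <= q by exact: sqrtr_ge0.
set d := hsum (sc V) - 2 * c * q.
have d0 : 0 < d by rewrite subr_gt0.
have [j Hj] : exists j : nat, C * q < d * j%:R.
  exists (Num.truncn (C * q / d)).+1.
  rewrite -ltr_pdivrMl// mulrC.
  by have /andP[] := truncn_itv (divr_ge0 (mulr_ge0 C0 q0) (ltW d0)).
have := step j V; rewrite -/q mulrDl => H.
have p2 : 0 < 2 ^+ j :> R by rewrite exprn_gt0.
have H3 : d * 2 ^+ j <= C * q.
  have : d <= C / 2 ^+ j * q by rewrite /d; lra.
  by rewrite mulrAC ler_pdivlMr.
have : d * j%:R <= d * 2 ^+ j.
  by rewrite ler_wpM2l ?(ltW d0)// -natrX ler_nat; apply: ltnW; exact: ltn_expl.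
lra.
Qed.

Lemma sum_arith_geometric (k : nat) :
  \sum_(j < k) j.+1%:R / 2 ^+ j = 4 - (2 * k%:R + 4) / 2 ^+ k :> R.
Proof.
elim: k => [|k IH]; first by rewrite big_ord0 expr0; lra.
rewrite big_ord_recr/= IH exprS invfM -[k.+1%:R]natr1; lra.
Qed.

Section chaining.
Variables (N : nat -> seq 'M[R]_(p, m)) (K : nat).
Hypothesis netN : forall k V, qn V = 1 ->
  exists2 W, W \in N k & qn (V - W) <= (2 ^- (12 * k)) ^+ 2.
Hypothesis base : forall V, V \in N 0 ->
  n%:R * (2^-1 - 12 * rho) <= hsum (\1_[set u | 0 < bl V u]).
Hypothesis incr : forall k, (k < K)%N -> forall V V',
  V \in N k -> V' \in N k.+1 -> qn (V' - V) <= (2 * 2 ^- (12 * k)) ^+ 2 ->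
  hsum (\1_[set u | 0 < bl V u]) - hsum (\1_[set u | 0 < bl V' u])
    <= 230 * (n%:R * rho) * (k.+1%:R / 2 ^+ k).
Hypothesis band : forall V, V \in N K ->
  hsum (\1_[set u | `|bl V u| <= rho ^+ 3]) <= 50 * (n%:R * rho).
Hypothesis moment : forall V, hsum (sc V) <= 416 * n%:R * Num.sqrt (qn V).
Hypothesis fine_scale : 2 ^- (12 * K) <= rho ^+ 4.

Let nrho : R := n%:R * rho.

(** Telescoping along nearest net points costs 12 at the base and 230 times a series below 4, hence
    932. The moment bound at distance [rho ^ 4], divided by [rho ^ 3], leaves [416 n rho]. *)
Lemma chain_approximant V : qn V = 1 -> exists W, [/\ W \in N K,
  n%:R / 2 - 932 * nrho <= hsum (\1_[set u | 0 < bl W u]) &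
  hsum (fun u => sc (V - W) u / rho ^+ 3) <= 416 * nrho].
Proof.
move=> V1.
have /choice[f Hf] : forall k, exists W, W \in N k /\ qn (V - W) <= (2 ^- (12 * k)) ^+ 2.
  by move=> k; have [W NW HW] := netN k V V1; exists W.
have nr0 : 0 <= nrho by rewrite mulr_ge0// ltW.
have chain k : (k <= K)%N -> n%:R * (2^-1 - 12 * rho)
    - 230 * nrho * (\sum_(j < k) j.+1%:R / 2 ^+ j)
    <= hsum (\1_[set u | 0 < bl (f k) u]).
  elim: k => [_|k IH kK].
    by rewrite big_ord0 mulr0 subr0; apply: base; exact: (Hf 0).1.
  have := IH (ltnW kK); rewrite big_ord_recr/=.
  (* Both points are close to [V], so [qn_add_le] costs a factor 2 in distance; the increments allow
     for it. *)
  have close : qn (f k.+1 - f k) <= (2 * 2 ^- (12 * k)) ^+ 2.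
    have -> : f k.+1 - f k = (V - f k) + (- 1) *: (V - f k.+1).
      by rewrite scaleN1r opprB [RHS]addrC addrA subrK.
    apply: le_trans (qn_add_le _ _ _) _; rewrite qnZ sqrrN expr1n mul1r.
    have H1 := (Hf k).2; have H2 := (Hf k.+1).2.
    have H3 : (2 ^- (12 * k.+1)) ^+ 2 <= (2 ^- (12 * k)) ^+ 2 :> R.
      rewrite -!exprVn ler_pXn2r ?nnegrE ?exprn_ge0// ler_wiXn2l//; last by rewrite leq_mul2l leqnSn.
      lra.
    move: H1 H2 H3; set e := 2 ^- (12 * k); set e' := 2 ^- (12 * k.+1); lra.
  have := incr k kK _ _ (Hf k).1 (Hf k.+1).1 close; rewrite -/nrho; lra.
exists (f K); split; first exact: (Hf K).1.
- apply: le_trans (chain K (leqnn K)); rewrite sum_arith_geometric.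
  have : 0 <= 230 * nrho * ((2 * K%:R + 4) / 2 ^+ K).
    have q0 : 0 <= (2 * K%:R + 4) / 2 ^+ K :> R.
      by apply: divr_ge0; rewrite ?exprn_ge0// addr_ge0// mulr_ge0.
    exact: (mulr_ge0 (mulr_ge0 (ler0n _ _) nr0) q0).
  rewrite /nrho; lra.
- have r30 : 0 < rho ^+ 3 by rewrite exprn_gt0.
  have -> : hsum (fun u => sc (V - f K) u / rho ^+ 3) = hsum (sc (V - f K)) / rho ^+ 3.
    by rewrite mulrC -hsumZ; apply: eq_bigr => i _; rewrite [_ / _]mulrC.
  rewrite ler_pdivrMr//; apply: le_trans (moment _) _.
  have : Num.sqrt (qn (V - f K)) <= rho ^+ 4.
    apply: le_trans fine_scale.
    rewrite -[leRHS]ger0_norm ?invr_ge0 ?exprn_ge0// -sqrtr_sqr.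
    by rewrite ler_wsqrtr// (Hf K).2.
  have c0 : 0 <= 416 * n%:R :> R := mulr_ge0 (ler0n _ _) (ler0n _ _).
  move=> /(ler_wpM2l c0) H; apply: le_trans H _.
  by rewrite /nrho exprS; lra.
Qed.

(** A point that leaves the half-space when [W] becomes [V] is in the band of [W] or has
    [sc (V - W) >= rho ^+ 3], and then the last sum counts it at least once. The total loss is
    [932 + 50 + 416 = 1398]. *)
Lemma halfspace_lower V : qn V = 1 ->
  n%:R / 2 - 1398 * nrho <= hsum (fun u => ((0 < bl V u)%R)%:R).
Proof.
move=> V1; have [W [NW HW HVW]] := chain_approximant _ V1.
have r30 : 0 < rho ^+ 3 by rewrite exprn_gt0.
have : hsum (\1_[set u | 0 < bl W u]) <= hsum (fun u => ((0 < bl V u)%R)%:R) +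
    hsum (\1_[set u | `|bl W u| <= rho ^+ 3]) +
    hsum (fun u => sc (V - W) u / rho ^+ 3).
  rewrite -!hsumD; apply: hsum_le => u; rewrite !indic_pred.
  have s0 : 0 <= sc (V - W) u / rho ^+ 3 by rewrite divr_ge0 ?scx_ge0 ?(ltW r30).
  have [W0|_] := ltP 0 (bl W u); last by rewrite !addr_ge0.
  have [_|V0] := ltP 0 (bl V u); first by rewrite -addrA lerDl addr_ge0.
  have [_|W3] := leP `|bl W u| (rho ^+ 3); first by rewrite add0r lerDl.
  rewrite !add0r ler_pdivlMr// mul1r; apply: le_trans (ltW W3) _.
  have : `|bl (V - W) u| <= sc (V - W) u by rewrite lerDl nrx_ge0.
  have -> : bl (V - W) u = bl V u - bl W u by exact: blxB.
  by apply: le_trans; rewrite gtr0_norm// ler0_norm; lra.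
have := band _ NW; rewrite -/nrho; lra.
Qed.

(** Where [sc (V - W)] is at least [rho ^+ 3] the last sum pays for the point; elsewhere the margins
    of [window] absorb the change of score and norm. *)
Lemma window_lower V (tau c : R) :
  (forall W, W \in N K -> n%:R * c <= hsum (\1_(window B sigma tau W))) ->
  rho <= tau / 2 ^+ 16 -> tau <= 1 -> qn V = 1 ->
  n%:R * c - 416 * nrho <= hsum (fun u => ((0 <= bl V u < tau * sqx V u.1)%R)%:R).
Proof.
move=> win rt t1 V1; have [W [NW HW HVW]] := chain_approximant _ V1.
have r30 : 0 < rho ^+ 3 by rewrite exprn_gt0.
have r31 : rho ^+ 3 <= rho by rewrite exprS ler_piMr ?(ltW rho0)// exprn_ile1// ?(ltW rho0)//; move: rho8; lra.
have r32 : rho ^+ 3 <= 8^-1 ^+ 3 by rewrite ler_pXn2r// ?nnegrE ?(ltW rho0).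
have r33 : 8^-1 ^+ 3 <= 128^-1 :> R by lra.
have t0 : 0 < tau.
  by have := lt_le_trans rho0 rt; rewrite pmulr_lgt0// invr_gt0 exprn_gt0.
set t := tau / 2 ^+ 16 in rt.
have tE : tau / 2 ^+ 15 = 2 * t by rewrite /t; lra.
have : hsum (\1_(window B sigma tau W)) <=
    hsum (fun u => ((0 <= bl V u < tau * sqx V u.1)%R)%:R) +
    hsum (fun u => sc (V - W) u / rho ^+ 3).
  rewrite -!hsumD; apply: hsum_le => u; rewrite indic_pred.
  have s0 : 0 <= sc (V - W) u by exact: scx_ge0.
  have [/andP[]|_] := boolP (_ && _); last first.
    by rewrite addr_ge0// divr_ge0// ltW.
  rewrite tE -/t => /andP[b1 b2] n1.
  have [far|close] := leP (rho ^+ 3) (sc (V - W) u).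
    by apply: ler_wpDl => //; rewrite ler_pdivlMr// mul1r.
  have bVW : bl (V - W) u = bl V u - bl W u by exact: blxB.
  have bs : `|bl (V - W) u| <= sc (V - W) u by rewrite lerDl nrx_ge0.
  have ns : nrx (V - W) u.1 <= sc (V - W) u by rewrite lerDr.
  have /andP[b3 b4] : - sc (V - W) u <= bl V u - bl W u <= sc (V - W) u.
    by rewrite -bVW -ler_norml.
  have nV : 128^-1 <= nrx V u.1.
    have : nrx W u.1 <= nrx V u.1 + nrx (V - W) u.1.
      rewrite -(nrxN (V - W)); apply: le_trans (nrxD _ _ _).
      by rewrite opprB addrC subrK.
    by move: n1; rewrite /nr; lra.
  have sV : 128^-1 ^+ 2 <= sqx V u.1.
    by rewrite -nrx_sqr ler_pXn2r ?nnegrE ?nrx_ge0.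
  have tsV : tau * 128^-1 ^+ 2 <= tau * sqx V u.1 by rewrite ler_wpM2l// ltW.
  have t4 : tau * 128^-1 ^+ 2 = 4 * t by rewrite /t; lra.
  rewrite (_ : _ && _ = true); last by apply/andP; split; lra.
  by rewrite lerDl divr_ge0// ltW.
have := win _ NW; lra.
Qed.

End chaining.

Definition depth_count (B' U : 'M[R]_(p, m)) : R :=
  \sum_(i < n) (if 0 <= score U B' (z i) then 1 else 0).

Lemma score_bl V u : score V B u = sigma * bl V u.
Proof.
rewrite /bl /blx mulrC divfK ?gt_eqF//; apply: eq_bigr => k _.
by rewrite tnth_mktuple.
Qed.

Lemma score_shift V u : score V (B + V) u = score V B u - sqx V u.1.
Proof.
rewrite /score /sqx -sumrB; apply: eq_bigr => k _; rewrite -/(cx V u.1 k).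
have -> : (tcol u.2 - (B + V)^T *m tcol u.1) k 0 =
    (tcol u.2 - B^T *m tcol u.1) k 0 - cx V u.1 k.
  by rewrite linearD/= mulmxDl /cx !mxE; ring.
by rewrite mulrBr expr2.
Qed.

Lemma emp_depth_le (B' U : 'M[R]_(p, m)) : U != 0 ->
  emp_depth B' z <= depth_count B' U / n%:R.
Proof.
move=> U0; apply: ge_inf; last by exists U.
exists 0 => _ [V [_ ->]]; rewrite divr_ge0// sumr_ge0// => i _.
by case: ifP.
Qed.

Lemma emp_depth_ge (B' : 'M[R]_(p, m)) (a : R) : (0 < p)%N -> (0 < m)%N ->
  (forall U, U != 0 -> a <= depth_count B' U / n%:R) -> a <= emp_depth B' z.
Proof.
move=> p0 m0 H; apply: lb_le_inf; last by move=> _ [V [V0 ->]]; exact: H.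
(* The infimum needs a nonempty set, and a nonzero direction exists since [p] and [m] are
   positive. *)
exists (depth_count B' (const_mx 1) / n%:R), (const_mx 1); split => //.
apply/eqP => /matrixP/(_ (Ordinal p0) (Ordinal m0)); rewrite !mxE.
by move/eqP; rewrite oner_eq0.
Qed.

Lemma qn_normalize V : 0 < qn V -> qn ((Num.sqrt (qn V))^-1 *: V) = 1.
Proof. by move=> V0; rewrite qnZ exprVn sqr_sqrtr ?qn_ge0// mulVf// gt_eqF. Qed.

(** * Comparison of depths *)

Section depth_comparison.
Variables (a a0 b tau : R).
Hypotheses (n0 : (0 < n)%N) (p0 : (0 < p)%N) (m0 : (0 < m)%N).
Hypothesis half : forall V, qn V = 1 ->
  n%:R / 2 - a <= hsum (fun u => ((0 < bl V u)%R)%:R).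
Hypothesis contam : \sum_(i < n) (1 - h (z i)) <= a0.
Hypothesis win : forall V, qn V = 1 ->
  b <= hsum (fun u => ((0 <= bl V u < tau * sqx V u.1)%R)%:R).
Hypotheses (a_ge0 : 0 <= a) (a0n : a0 <= n%:R / 2) (ab : 2 * a < b)
  (tau0 : 0 <= tau).

Lemma depth_truth : (n%:R / 2 - a) / n%:R <= emp_depth B z.
Proof.
have n0' : 0 < n%:R :> R by rewrite ltr0n.
apply: emp_depth_ge => // U U0; rewrite ler_wpM2r ?invr_ge0//.
(* In a direction of zero seminorm every observation of nonzero weight has score 0 and is counted,
   so the count is at least [n - a0 >= n / 2]. *)
have [qU|qU] := ltP 0 (qn U); last first.
  have sU i : h (z i) != 0 -> score U B (z i) = 0.
    move=> /h_range[y xy]; rewrite score_bl (_ : bl U (z i) = 0) ?mulr0//.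
    apply: blx_nrx0; apply/eqP; rewrite eq_le nrx_ge0 andbT.
    apply: le_trans (nrx_le_range L _ _ _ xy) _.
    by rewrite (_ : qn U = 0) ?sqrtr0 ?mulr0//; apply/eqP; rewrite eq_le qU qn_ge0.
  have : \sum_(i < n) h (z i) <= depth_count B U.
    apply: ler_sum => i _; have [->|hz] := eqVneq (h (z i)) 0; first by case: ifP.
    by rewrite sU// lexx; case/andP: (h01 (z i)).
  have : \sum_(i < n) (1 - h (z i)) = n%:R - \sum_(i < n) h (z i).
    by rewrite sumrB sumr_const card_ord.
  by move: contam a0n a_ge0; lra.
apply: le_trans (half _ (qn_normalize _ qU)) _.
apply: ler_sum => i _; rewrite score_bl.
have q0 : 0 < Num.sqrt (qn U) by rewrite sqrtr_gt0.
have -> : bl ((Num.sqrt (qn U))^-1 *: U) (z i) = (Num.sqrt (qn U))^-1 * bl U (z i).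
  exact: blxZ.
rewrite pmulr_rgt0 ?invr_gt0// pmulr_rge0//.
have /andP[h0 h1] := h01 (z i).
have [bp|_] := ltP 0 (bl U (z i)); first by rewrite (ltW bp) mulr1.
by rewrite mulr0; case: ifP.
Qed.

Lemma depth_far V : (tau * sigma) ^+ 2 < qn V ->
  emp_depth (B + V) z <= (n%:R / 2 + a - b) / n%:R.
Proof.
move=> far.
have qV : 0 < qn V by apply: le_lt_trans far; rewrite sqr_ge0.
have V0 : V != 0.
  apply: contraTneq qV => ->; rewrite -(scale0r (0 : 'M[R]_(p, m))) qnZ expr0n/=.
  by rewrite mul0r ltxx.
apply: le_trans (emp_depth_le _ _ V0) _; rewrite ler_wpM2r ?invr_ge0//.
set q := Num.sqrt (qn V); have q0 : 0 < q by rewrite sqrtr_gt0.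
pose W := q^-1 *: V.
have W1 : qn W = 1 by exact: qn_normalize.
have mW1 : qn (- W) = 1 by rewrite -scaleN1r qnZ sqrrN expr1n mul1r.
have VW : V = q *: W by rewrite scalerA mulfV ?scale1r// gt_eqF.
have qtau : tau * sigma < q.
  rewrite -(ltr_pXn2r (_ : 0 < 2)%N) ?nnegrE ?mulr_ge0 ?(ltW sigma0) ?(ltW q0)//.
  by rewrite sqr_sqrtr// ltW.
(* The three conditions exclude one another at each observation. Contaminated ones count fully in
   the first term, which is harmless as the weights are at most 1. *)
have key : depth_count (B + V) V + (hsum (fun u => ((0 < bl (- W) u)%R)%:R) +
    hsum (fun u => ((0 <= bl W u < tau * sqx W u.1)%R)%:R)) <= n%:R.
  rewrite -hsumD -big_split/=.
  have -> : n%:R = \sum_(i < n) 1 :> R by rewrite sumr_const card_ord.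
  apply: ler_sum => i _; have /andP[h0 h1] := h01 (z i).
  have -> : bl (- W) (z i) = - bl W (z i) by exact: blxN.
  rewrite score_shift score_bl.
  have -> : bl V (z i) = q * bl W (z i) by rewrite {1}VW; exact: blxZ.
  have -> : sqx V (z i).1 = q ^+ 2 * sqx W (z i).1 by rewrite {1}VW sqxZ.
  set c := bl W (z i); set d := sqx W (z i).1; have d0 : 0 <= d by exact: sqx_ge0.
  have -> : sigma * (q * c) - q ^+ 2 * d = q * (sigma * c - q * d) by ring.
  rewrite pmulr_rge0// oppr_gt0.
  have td : sigma * (tau * d) <= q * d.
    by rewrite mulrA (mulrC sigma) ler_wpM2r// ltW.
  have [c0|c0] := ltP c 0; rewrite /=.
    rewrite addr0 mulr1 ifF ?add0r//.
    have sc0 : sigma * c < 0 by rewrite pmulr_rlt0.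
    have qd0 : 0 <= q * d by rewrite mulr_ge0// ltW.
    by apply/negbTE; rewrite -ltNge; lra.
  rewrite add0r; have [ct|_] := ltP c (tau * d); last first.
    by rewrite mulr0 addr0; case: ifP.
  rewrite mulr1 ifF ?add0r//.
  have : sigma * c < sigma * (tau * d) by rewrite ltr_pM2l.
  by move=> H; apply/negbTE; rewrite -ltNge; lra.
have := half _ mW1; have := win _ W1; lra.
Qed.

Lemma maximizer_error (Bh : 'M[R]_(p, m)) :
  (forall B' : 'M[R]_(p, m), emp_depth B' z <= emp_depth Bh z) ->
  qn (Bh - B) <= (tau * sigma) ^+ 2.
Proof.
move=> Bmax; rewrite leNgt; apply/negP => /depth_far; rewrite addrC subrK => H.
have n0' : 0 < n%:R :> R by rewrite ltr0n.
have := le_trans (le_trans depth_truth (Bmax B)) H.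
by rewrite ler_pM2r ?invr_gt0//; move: ab; lra.
Qed.

End depth_comparison.

End deterministic.

(** * The Frobenius norm and the final assembly *)

Section kappa_bound.
Context {R : realType} {p m : nat}.
Variable S : 'M[R]_p.
Hypotheses (covS : covariance_matrix S) (p0 : (0 < p)%N).

Let ratios := [set r : R | exists v : 'cV[R]_p, v != 0 /\
  r = Num.sqrt ((v^T *m S *m v) 0 0) / Num.sqrt ((v^T *m v) 0 0)].

Let ratios_ge0 r : ratios r -> 0 <= r.
Proof. by move=> [v [_ ->]]; rewrite divr_ge0 ?sqrtr_ge0. Qed.

Lemma kappa_sqr_le (v : 'cV[R]_p) :
  kappa S ^+ 2 * (v^T *m v) 0 0 <= (v^T *m S *m v) 0 0.
Proof.
have vvE : (v^T *m v) 0 0 = \sum_i v i 0 ^+ 2.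
  by rewrite mxE; apply: eq_bigr => i _; rewrite mxE expr2.
have vv0 : 0 <= (v^T *m v) 0 0 by rewrite vvE sumr_ge0// => i _; exact: sqr_ge0.
have [v0|vn0] := eqVneq ((v^T *m v) 0 0) 0; first by rewrite v0 mulr0; exact: covS.2.
have vp : 0 < (v^T *m v) 0 0 by rewrite lt_def vn0.
have k0 : 0 <= kappa S.
  apply: lb_le_inf; last exact: ratios_ge0.
  exists (Num.sqrt ((v^T *m S *m v) 0 0) / Num.sqrt ((v^T *m v) 0 0)), v; split => //.
  by apply: contraNneq vn0 => ->; rewrite mulmx0 mxE.
have kv : kappa S <= Num.sqrt ((v^T *m S *m v) 0 0) / Num.sqrt ((v^T *m v) 0 0).
  apply: ge_inf; first by exists 0; exact: ratios_ge0.
  by exists v; split => //; apply: contraNneq vn0 => ->; rewrite mulmx0 mxE.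
rewrite -ler_pdivlMr//.
apply: (@le_trans _ _ ((Num.sqrt ((v^T *m S *m v) 0 0) / Num.sqrt ((v^T *m v) 0 0)) ^+ 2)).
  by rewrite ler_pXn2r ?nnegrE ?divr_ge0 ?sqrtr_ge0.
by rewrite expr_div_n !sqr_sqrtr//; exact: covS.2.
Qed.

(** Column by column; keeping [kappa] as a factor avoids dividing by zero for singular [S]. *)
Lemma kappa_frob2_le (A : 'M[R]_(p, m)) : kappa S ^+ 2 * frob2 A <= qn S A.
Proof.
rewrite qn_col /frob2 exchange_big/= mulr_sumr; apply: ler_sum => k _.
apply: le_trans (kappa_sqr_le (col k A)); rewrite ler_wpM2l ?sqr_ge0//.
by rewrite mxE; apply: ler_sum => i _; rewrite !mxE expr2.
Qed.

End kappa_bound.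

(** [K] is the least integer with [rho 8 ^ K >= 1]. The finest scale is [(8 ^ K) ^ -4], and
    minimality gives [rho 8 ^ (K - 1) < 1], hence [(rho 2 ^ k) ^ 2 <= rho (rho 8 ^ (K - 1)) <= 1/4]
    and [rho K <= 1]. *)
Lemma chaining_depth (R : realType) (rho : R) : 0 < rho -> rho <= 4^-1 ->
  exists K : nat, [/\ forall k, (k < K)%N -> rho * 2 ^+ k <= 2^-1,
    2 ^- (12 * K) <= rho ^+ 4 & rho * K%:R <= 1].
Proof.
move=> r0 r4.
have exK : exists K, 1 <= rho * 8 ^+ K.
  exists (Num.truncn rho^-1).+1; rewrite -ler_pdivrMl// mulr1.
  have ri : 0 < rho^-1 by rewrite invr_gt0.
  have /andP[_ /ltW H] := truncn_itv (ltW ri).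
  apply: (le_trans H).
  by rewrite -natrX ler_nat; apply: ltnW; exact: ltn_expl.
pose K := ex_minn exK; exists K; rewrite /K.
case: ex_minnP => -[|K'] K1 Kmin; first by move: K1; rewrite expr0 mulr1; lra.
have K'1 : rho * 8 ^+ K' < 1.
  by rewrite ltNge; apply/negP => /Kmin; rewrite ltnn.
split.
- move=> k kK; have r2k : 0 <= rho * 2 ^+ k by rewrite mulr_ge0 ?exprn_ge0// ltW.
  rewrite -(ler_pXn2r (_ : 0 < 2)%N) ?nnegrE//.
  have H : 4 ^+ k <= 8 ^+ K' :> R.
    apply: (@le_trans _ _ (8 ^+ k)); first by apply: lerXn2r; rewrite ?nnegrE//; lra.
    by rewrite ler_weXn2l//; lra.
  have -> : (rho * 2 ^+ k) ^+ 2 = rho * (rho * 4 ^+ k).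
    by rewrite exprMn -exprM mulnC exprM (_ : 2 ^+ 2 = 4 :> R); [ring|lra].
  apply: (@le_trans _ _ (4^-1 * 1)); last by lra.
  apply: ler_pM => //; rewrite ?(ltW r0) ?mulr_ge0 ?exprn_ge0 ?(ltW r0)//.
  by apply: le_trans (ltW K'1); rewrite ler_wpM2l// ltW.
- rewrite -[leLHS]mul1r ler_pdivrMr ?exprn_gt0//.
  have -> : rho ^+ 4 * 2 ^+ (12 * K'.+1) = (rho * 8 ^+ K'.+1) ^+ 4.
    rewrite exprMn (_ : 8 = 2 ^+ 3 :> R); last by lra.
    by rewrite -[in RHS]exprM -[in RHS]exprM mulnAC.
  by rewrite exprn_ege1.
- apply: le_trans (ltW K'1); rewrite ler_wpM2l ?(ltW r0)// -natrX ler_nat.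
  exact: ltn_expl.
Qed.

Lemma union_bound_expR (R : realType) (X e : R) : 1 <= X ->
  e = expR (- (7 * X)) -> e + (e + (e + (e + (e + e)))) <= expR (- X).
Proof.
move=> X1 eE; have H6 : 6 <= expR 6 :> R by have := expR_ge1Dx (6 : R); lra.
have : 6 * e <= expR (- X).
  have -> : - X = 6 * X - 7 * X by ring.
  rewrite expRD -eE ler_wpM2r ?eE ?expR_ge0//; apply: le_trans H6 _.
  by rewrite ler_expR; lra.
lra.
Qed.

(** The hypothesis gives [w >= 3750 x], above the required [2 * 1398 + 416 = 3212]. *)
Lemma depth_margin (R : realType) (x N w : R) : 0 < x ->
  30 * 1000 * x <= 8 * w -> x <= N * 20^-1 ->
  [/\ 0 <= 1398 * x, 10 * x <= N / 2 & 2 * (1398 * x) < w - 416 * x].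
Proof. by move=> x0 xw xN; split; lra. Qed.

(** [M] is the ratio [tau / rho]. Its three conditions say that [tau <= 1], that the window starts
    above [rho], and that the mass of the window outweighs all deviations. *)
Lemma likely_maximizer_error (R : realType) (p m n : nat) (sigma eps rho M : R)
    (L : 'M[R]_p) (B : 'M[R]_(p, m)) (PB Q : probability (Obs R p m) R)
    (dO : measure_display) (Omega : measurableType dO) (P : probability Omega R)
    (Z : 'I_n -> Omega -> Obs R p m) :
  (0 < p)%N -> (0 < m)%N -> (0 < n)%N -> 0 < sigma ->
  covariance_matrix (L *m L^T) -> is_PB (L *m L^T) B sigma PB ->
  (forall i, measurable_fun setT (Z i)) ->
  (forall i (A : set (Obs R p m)), measurable A ->
      P (Z i @^-1` A) = ((1 - eps)%:E * PB A + eps%:E * Q A)%E) ->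
  (forall A : 'I_n -> set (Obs R p m), (forall i, measurable (A i)) ->
      P (\bigcap_(i in [set: 'I_n]) (Z i @^-1` A i)) =
      (\prod_(i < n) P (Z i @^-1` A i))%E) ->
  0 <= eps -> eps <= rho -> 0 < rho -> rho <= 20^-1 ->
  (p * m)%:R <= n%:R * rho ^+ 2 ->
  M * rho <= 1 -> 1 <= M / 2 ^+ 16 -> 30 * 1000 <= M / (96 * 2 ^+ 16) ->
  likely P (expR (- (n%:R * rho ^+ 2))) (fun w => forall Bh : 'M[R]_(p, m),
    (forall B' : 'M[R]_(p, m),
        emp_depth B' (fun i => Z i w) <= emp_depth Bh (fun i => Z i w)) ->
    qn (L *m L^T) (Bh - B) <= (M * rho * sigma) ^+ 2).
Proof.
move=> p0 m0 n0 sigma0 covS HPB mZ lawQ indepZ eps0 eps_rho rho0 rho20 dX tau1 M1 M2.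
have n0' : 0 < n%:R :> R by rewrite ltr0n.
have rho8 : rho <= 8^-1 by lra.
have rho4 : rho <= 4^-1 by lra.
have eps1 : eps < 1 by lra.
have X1 : 1 <= n%:R * rho ^+ 2.
  by apply: le_trans dX; rewrite ler1n muln_gt0 p0.
pose i0 := Ordinal n0.
(* The common law is realized as that of one observation, which exists since [n > 0]. *)
pose fZ : {mfun Omega >-> Obs R p m} := mfun_Sub (mem_set (mZ i0)).
pose mu : probability (Obs R p m) R := distribution P fZ.
have lawZ i A : measurable A -> P (Z i @^-1` A) = mu A.
  move=> mA; rewrite lawQ//; apply/esym; exact: lawQ.
have [D [mD PD Drange]] := design_range _ _ _ _ HPB L erefl.
have muge A : measurable A -> ((1 - eps)%:E * PB A <= mu A)%E.
  move=> mA; have -> : mu A = ((1 - eps)%:E * PB A + eps%:E * Q A)%E by exact: lawQ.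
  by rewrite leeDl// mule_ge0.
have eps01 : 0 <= eps < 1 by rewrite eps0.
have [h [mh h01 hD hge hphi]] := clean_weight _ _ _ mu PB eps D eps01 muge mD PD.
have h_range u : h u != 0 -> exists y : 'cV[R]_p, tcol u.1 = L *m y.
  by move=> /hD/Drange.
have /choice[N HN] := net_sphere L rho dX (m := m).
have [s [s1 sN ss]] := net_half_ball L rho dX (m := m).
have [K [Klam Kfine Krho]] := chaining_depth _ _ rho0 rho4.
pose tau := M * rho.
have NK : (size (N K))%:R <= expR (15 * (n%:R * rho)).
  have [_ _ HK] := HN K; apply: le_trans HK _; rewrite ler_expR.
  (* As [rho K <= 1], the finest net has entropy O(n rho), although not O(X). *)
  have H : rho * (3 + 12 * K%:R) <= 15 by lra.
  have : n%:R * rho * (rho * (3 + 12 * K%:R)) <= n%:R * rho * 15.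
    by rewrite ler_wpM2l// mulr_ge0// ltW.
  lra.
have N1 k V : V \in N k -> qn (L *m L^T) V = 1 by have [+ _ _] := HN k; apply.
have Ns k : (size (N k))%:R <= expR (n%:R * rho ^+ 2 * (3 + 12 * k%:R)) by have [_ _ +] := HN k.
have N0s : (size (N 0))%:R <= expR (n%:R * rho ^+ 2 * 3).
  by have := Ns 0; rewrite mulr0 addr0.
have tauE : tau / (96 * 2 ^+ 16) = M / (96 * 2 ^+ 16) * rho by rewrite /tau mulrAC.
set a := M / (96 * 2 ^+ 16) in M2 tauE.
have taur : 176 * rho <= tau / (96 * 2 ^+ 16).
  rewrite tauE ler_wpM2r ?(ltW rho0)//; lra.
have L1 := likely_contamination eps rho mu h P Z mZ lawZ indepZ mh h01 hge eps_rho rho0 rho4 X1.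
have L2 := likely_halfspace _ _ _ _ _ _ _ _ P Z sigma0 covS HPB mZ lawZ indepZ
  mh h01 hge hphi eps0 eps_rho rho0 rho4 X1 (N 0) (N1 0) N0s.
have L3 := likely_chain _ _ _ _ _ _ _ _ P Z sigma0 covS HPB m0 mZ lawZ indepZ
  mh h01 hge hphi eps0 eps_rho rho0 rho4 X1 N K N1 Ns Klam.
have L4 := likely_band _ _ _ _ _ _ _ _ P Z sigma0 covS HPB mZ lawZ indepZ
  mh h01 hge hphi eps0 eps_rho rho0 rho4 (N K) (N1 K) NK.
have L5 := likely_moment _ _ _ _ _ _ _ _ P Z sigma0 covS HPB m0 mZ lawZ indepZ
  mh h01 hge hphi eps0 eps_rho rho0 rho4 s s1 ss.
have L6 := likely_window _ _ _ _ _ _ _ _ P Z sigma0 covS HPB m0 mZ lawZ indepZ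
  mh h01 hge hphi eps_rho rho0 rho4 (N K) tau (N1 K) NK tau1 taur.
have [E [mE PE HE]] := likely_and P _ _ _ _ L1 (likely_and P _ _ _ _ L2
  (likely_and P _ _ _ _ L3 (likely_and P _ _ _ _ L4 (likely_and P _ _ _ _ L5 L6)))).
exists E; split => //.
  apply: le_trans PE; rewrite lee_fin lerB//.
  exact: (union_bound_expR _ _ _ X1 erefl).
move=> w /HE[Hcontam [Hbase [Hincr [Hband [Hmoment Hwin]]]]] Bh Bmax.
pose z i := Z i w.
have netN k V : qn (L *m L^T) V = 1 ->
    exists2 W, W \in N k & qn (L *m L^T) (V - W) <= (2 ^- (12 * k)) ^+ 2.
  by have [_ + _] := HN k; apply.
have moment V : hsum h z (sc B sigma V) <= 416 * n%:R * Num.sqrt (qn (L *m L^T) V).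
  have -> : 416 * n%:R = 2 * (208 * n%:R) :> R by ring.
  exact: (hsum_sc_le L B sigma h z sigma0 h01 h_range s).
have half V : qn (L *m L^T) V = 1 -> n%:R / 2 - 1398 * (n%:R * rho)
    <= hsum h z (fun u => ((0 < bl B sigma V u)%R)%:R).
  exact: (halfspace_lower L B sigma rho h z h01 rho0 N K netN Hbase Hincr Hband
    moment Kfine).
pose c : R := tau / (96 * 2 ^+ 16) / 8.
have win V : qn (L *m L^T) V = 1 -> n%:R * c - 416 * (n%:R * rho)
    <= hsum h z (fun u => ((0 <= bl B sigma V u < tau * sqx V u.1)%R)%:R).
  apply: (window_lower L B sigma rho h z h01 rho0 rho8 N K netN Hbase Hincr
    moment Kfine) => //.
  by rewrite /tau mulrAC ler_peMl// ltW.
have nr0 : 0 < n%:R * rho by rewrite mulr_gt0.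
have ar : 30 * 1000 * (n%:R * rho) <= n%:R * (a * rho).
  by rewrite [leRHS]mulrCA ler_wpM2r ?(ltW nr0).
have xn : n%:R * rho <= n%:R * 20^-1 by rewrite ler_wpM2l.
have wE : n%:R * (a * rho) = 8 * (n%:R * c) by rewrite /c tauE; field.
rewrite wE in ar; have [a_ge0 a0n ab] := depth_margin _ _ _ _ nr0 ar xn.
have tau0 : 0 <= tau.
  rewrite /tau mulr_ge0 ?(ltW rho0)//.
  move: M1; rewrite ler_pdivlMr ?exprn_gt0// mul1r; apply: le_trans.
  by rewrite exprn_ge0.
exact: (maximizer_error L B sigma h z sigma0 h01 h_range _ _ _ tau n0 p0 m0
  half Hcontam win a_ge0 a0n ab tau0 Bh Bmax).
Qed.

Lemma numeric_constants (R : realType) :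
  [/\ 2 ^- 40 <= 20^-1 :> R, 2 ^+ 38 * 2 ^- 40 <= 1 :> R,
    1 <= 2 ^+ 38 / 2 ^+ 16 :> R & 30 * 1000 <= 2 ^+ 38 / (96 * 2 ^+ 16) :> R].
Proof. by split; lra. Qed.

Theorem theorem7 (R : realType) :
  exists c0 C C' : R, [/\ 0 < c0, 0 < C & 0 < C'] /\
  forall (p m n : nat) (sigma eps : R) (Sigma : 'M[R]_p) (B : 'M[R]_(p, m))
    (PB Q : probability (Obs R p m) R)
    (dO : measure_display) (Omega : measurableType dO) (P : probability Omega R)
    (Z : 'I_n -> Omega -> Obs R p m),
    (0 < p)%N -> (0 < m)%N -> (0 < n)%N -> 0 < sigma ->
    covariance_matrix Sigma ->
    0 <= eps < 1 ->
    eps ^+ 2 + (p * m)%:R / n%:R <= c0 ->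
    is_PB Sigma B sigma PB ->
    (* Z_1, ..., Z_n are i.i.d. with law (1 - eps) P_B + eps Q *)
    (forall i, measurable_fun setT (Z i)) ->
    (forall i (A : set (Obs R p m)), measurable A ->
        P (Z i @^-1` A) = ((1 - eps)%:E * PB A + eps%:E * Q A)%E) ->
    (forall A : 'I_n -> set (Obs R p m), (forall i, measurable (A i)) ->
        P (\bigcap_(i in [set: 'I_n]) (Z i @^-1` A i)) =
        (\prod_(i < n) P (Z i @^-1` A i))%E) ->
    exists E : set Omega, measurable E /\
      ((1 - expR (- (C' * ((p * m)%:R + n%:R * eps ^+ 2))))%:E <= P E)%E /\
      forall w, E w ->
      forall Bh : 'M[R]_(p, m),
        (forall B' : 'M[R]_(p, m),
            emp_depth B' (fun i => Z i w) <= emp_depth Bh (fun i => Z i w)) ->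
        \tr ((Bh - B)^T *m Sigma *m (Bh - B)) <=
          C * sigma ^+ 2 * Num.max ((p * m)%:R / n%:R) (eps ^+ 2) /\
        kappa Sigma ^+ 2 * frob2 (Bh - B) <=
          C * sigma ^+ 2 * Num.max ((p * m)%:R / n%:R) (eps ^+ 2).
Proof.
(* [2 ^- 80] forces [rho <= 2 ^- 40], so that [M = 2 ^ 38] keeps [tau] below 1; [2 ^ 76] is
   [M ^ 2]. *)
exists (2 ^- 80), (2 ^+ 76), 2^-1; split.
  by split; rewrite ?invr_gt0 ?exprn_gt0.
move=> p m n sigma eps Sigma B PB Q dO Omega P Z p0 m0 n0 sigma0 covS /andP[eps0 _].
move=> small HPB mZ lawQ indepZ.
set mx := Num.max _ _.
have n0' : 0 < n%:R :> R by rewrite ltr0n.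
have dn0 : 0 < (p * m)%:R / n%:R :> R by rewrite divr_gt0// ltr0n muln_gt0 p0.
have e20 : 0 <= eps ^+ 2 by exact: sqr_ge0.
have mx0 : 0 < mx by rewrite lt_max dn0.
have mxs : mx <= 2 ^- 80.
  by apply: le_trans small; rewrite ge_max lerDr lerDl e20 (ltW dn0).
pose rho := Num.sqrt mx.
have rho2 : rho ^+ 2 = mx by rewrite sqr_sqrtr// ltW.
have rho0 : 0 < rho by rewrite sqrtr_gt0.
have rho40 : rho <= 2 ^- 40.
  rewrite -(ler_pXn2r (_ : 0 < 2)%N) ?nnegrE ?invr_ge0 ?exprn_ge0 ?(ltW rho0)//.
  by rewrite rho2 exprVn -exprM.
have eps_rho : eps <= rho.
  rewrite -(ler_pXn2r (_ : 0 < 2)%N) ?nnegrE ?(ltW rho0)// rho2.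
  by rewrite le_max lexx orbT.
have dX : (p * m)%:R <= n%:R * rho ^+ 2.
  by rewrite rho2 mulrC -ler_pdivrMr// le_max lexx.
have [L SL] := psd_cholesky _ _ _ covS.1 covS.2; subst Sigma.
have [M1 M2 M3 M4] := numeric_constants R.
have [E [mE PE HE]] := likely_maximizer_error _ _ _ _ _ _ _ (2 ^+ 38) _ _ _ _ _ _ _ _
  p0 m0 n0 sigma0 covS HPB mZ lawQ indepZ eps0 eps_rho rho0 (le_trans rho40 M1) dX
  (le_trans (ler_wpM2l (exprn_ge0 _ (ler0n _ _)) rho40) M2) M3 M4.
exists E; split => //; split.
  (* A maximum is at least half of the sum, whence the constant 1/2. *)
  apply: le_trans PE; rewrite lee_fin lerB// ler_expR lerN2 mulrC ler_pdivrMr//.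
  rewrite mulr_natr mulr2n lerD// ler_wpM2l// rho2 le_max lexx orbT//.
move=> w /HE H Bh /H {}H.
have errC : qn (L *m L^T) (Bh - B) <= 2 ^+ 76 * sigma ^+ 2 * mx.
  have sq38 : (2 ^+ 38) ^+ 2 = 2 ^+ 76 :> R by rewrite -exprM.
  by apply: le_trans H _; rewrite -rho2 exprMn exprMn sq38 mulrAC.
split; first exact: errC.
by apply: le_trans errC; exact: kappa_frob2_le.
Qed.
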